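(* Let $X$ be a geodesic metric space homeomorphic to $\overline{D}$, with boundary circle $\partial X$. Let $v\colon\overline{D}\to X$ be a continuous surjective map such that: (i) the restriction of $v$ to $S^1$ is a weakly monotone parametrization of $\partial X$; and (ii) whenever $T\subset X$ is a single point or is biLipschitz homeomorphic to a closed interval, every connected component of $v^{-1}(T)$ is cell-like. Then $v$ is a cell-like map.
   Context: $\overline{D}$ is the closed unit disc in $\mathbb{R}^2$ with boundary $S^1$. A continuous $c\colon S^1\to\Gamma$ onto a Jordan curve $\Gamma$ is a weakly monotone parametrization if it is a uniform limit of homeomorphisms $S^1\to\Gamma$. A compact metric space is cell-like if it admits an embedding into the Hilbert cube in which it is null-homotopic in every neighborhood of itself. A continuous surjection $f\colon Y\to Z$ is cell-like if $f^{-1}(q)$ is cell-like for every $q\in Z$. *)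

(* Defs.v *)
From Stdlib Require Import Reals Lra.
From Coquelicot Require Import Coquelicot.
Open Scope R_scope.

Definition is_metric {T : Type} (d : T -> T -> R) : Prop :=
  (forall x y, 0 <= d x y) /\
  (forall x y, d x y = 0 <-> x = y) /\
  (forall x y, d x y = d y x) /\
  (forall x y z, d x z <= d x y + d y z).

Definition is_open {T : Type} (d : T -> T -> R) (U : T -> Prop) : Prop :=
  forall x, U x -> exists r, 0 < r /\ forall y, d x y < r -> U y.

Definition rel_open {T : Type} (d : T -> T -> R) (Y U : T -> Prop) : Prop :=
  (forall x, U x -> Y x) /\
  forall x, U x -> exists r, 0 < r /\ forall y, Y y -> d x y < r -> U y.

Definition cont_on {T1 T2 : Type} (d1 : T1 -> T1 -> R) (e2 : T2 -> T2 -> R)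
  (S : T1 -> Prop) (f : T1 -> T2) : Prop :=
  forall x, S x -> forall eps, 0 < eps -> exists delta, 0 < delta /\
    forall y, S y -> d1 x y < delta -> e2 (f x) (f y) < eps.

Definition homeo_onto {T1 T2 : Type} (d1 : T1 -> T1 -> R) (e2 : T2 -> T2 -> R)
  (S : T1 -> Prop) (Y : T2 -> Prop) (f : T1 -> T2) : Prop :=
  (forall x, S x -> Y (f x)) /\
  (forall y, Y y -> exists x, S x /\ f x = y) /\
  (forall x x', S x -> S x' -> f x = f x' -> x = x') /\
  cont_on d1 e2 S f /\
  (forall x, S x -> forall eps, 0 < eps -> exists delta, 0 < delta /\
     forall x', S x' -> e2 (f x) (f x') < delta -> d1 x x' < eps).

(* sequential compactness (equivalent to compactness for metric spaces) *)
Definition compact_set {T : Type} (d : T -> T -> R) (K : T -> Prop) : Prop :=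
  forall u : nat -> T, (forall n, K (u n)) ->
    exists (phi : nat -> nat) (l : T),
      (forall n, (phi n < phi (S n))%nat) /\ K l /\
      forall eps, 0 < eps -> exists N, forall n, (N <= n)%nat ->
        d (u (phi n)) l < eps.

(* connectedness of a subset (separation by open sets of the ambient metric
   space; equivalent to separation by relatively open sets) *)
Definition connected_set {T : Type} (d : T -> T -> R) (A : T -> Prop) : Prop :=
  ~ exists U V : T -> Prop,
      is_open d U /\ is_open d V /\
      (forall x, A x -> U x \/ V x) /\
      (exists x, A x /\ U x) /\ (exists x, A x /\ V x) /\
      (forall x, A x -> U x -> V x -> False).

Definition component_of {T : Type} (d : T -> T -> R) (A C : T -> Prop) : Prop :=
  (exists x, C x) /\ (forall x, C x -> A x) /\ connected_set d C /\
  forall K : T -> Prop, connected_set d K -> (forall x, C x -> K x) ->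
    (forall x, K x -> A x) -> forall x, K x -> C x.

Definition hilbert_cube (x : nat -> R) : Prop := forall n, 0 <= x n <= 1.

Definition dQ (x y : nat -> R) : R :=
  Series (fun n => Rabs (x n - y n) / 2 ^ (S n)).

Definition dprod {T : Type} (d : T -> T -> R) (p q : R * T) : R :=
  Rmax (Rabs (fst p - fst q)) (d (snd p) (snd q)).

Definition cell_like {T : Type} (d : T -> T -> R) (K : T -> Prop) : Prop :=
  compact_set d K /\
  exists e : T -> (nat -> R),
    homeo_onto d dQ K (fun z => exists x, K x /\ e x = z) e /\
    (forall x, K x -> hilbert_cube (e x)) /\
    forall U : (nat -> R) -> Prop,
      rel_open dQ hilbert_cube U -> (forall x, K x -> U (e x)) ->
      exists (H : R * T -> (nat -> R)) (c : nat -> R),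
        cont_on (dprod d) dQ (fun p => 0 <= fst p <= 1 /\ K (snd p)) H /\
        (forall x, K x -> H (0, x) = e x) /\
        (forall x, K x -> H (1, x) = c) /\
        (forall t x, 0 <= t <= 1 -> K x -> U (H (t, x))).

Definition dR2 (p q : R * R) : R :=
  sqrt ((fst p - fst q) ^ 2 + (snd p - snd q) ^ 2).

Definition cdisc (p : R * R) : Prop := fst p ^ 2 + snd p ^ 2 <= 1.
Definition circle (p : R * R) : Prop := fst p ^ 2 + snd p ^ 2 = 1.

Definition geodesic {X : Type} (d : X -> X -> R) : Prop :=
  forall x y, exists g : R -> X, g 0 = x /\ g (d x y) = y /\
    forall s t, 0 <= s <= d x y -> 0 <= t <= d x y ->
      d (g s) (g t) = Rabs (s - t).

Definition bilip_arc {X : Type} (d : X -> X -> R) (T : X -> Prop) : Prop :=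
  exists (a b L : R) (g : R -> X), a < b /\ 0 < L /\
    (forall y, T y <-> exists s, a <= s <= b /\ g s = y) /\
    forall s t, a <= s <= b -> a <= t <= b ->
      Rabs (s - t) / L <= d (g s) (g t) /\ d (g s) (g t) <= L * Rabs (s - t).

Definition weakly_monotone_param {X : Type} (d : X -> X -> R)
  (Gamma : X -> Prop) (c : R * R -> X) : Prop :=
  (forall p, circle p -> Gamma (c p)) /\
  (forall y, Gamma y -> exists p, circle p /\ c p = y) /\
  cont_on dR2 d circle c /\
  exists cn : nat -> R * R -> X,
    (forall n, homeo_onto dR2 d circle Gamma (cn n)) /\
    forall eps, 0 < eps -> exists N, forall n, (N <= n)%nat ->
      forall p, circle p -> d (cn n p) (c p) < eps.

Definition cell_like_map {X : Type} (v : R * R -> X) : Prop :=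
  forall q : X, cell_like dR2 (fun p => cdisc p /\ v p = q).

(* Main.v *)
(** Since every component of a fiber is cell-like by hypothesis, it suffices to show that fibers
    are connected.  Planar topology is done with continuous logarithms: call a set log-trivial if
    every map from it to the circle lifts to the line.  A cell-like set is log-trivial, hence so
    is the preimage of a biLipschitz arc [T], whose components are all cell-like.  Let [S] be a
    closed set whose boundary lies in such a [T].  Extending logarithms over complementary pieces
    shows that the preimage of [S] is log-trivial, and that any clopen part of it missing the
    boundary circle is mapped into [T] (otherwise the no-retraction theorem fails).

    In the disc chart of [X], a vertical ray from a point [q] to the boundary is surrounded by
    biLipschitz arcs, which exist near every connected set: they are the geodesics of a metric that
    makes travelling away from that set expensive.  So the preimages of the upper and the lower ray
    from [q] are connected.  The preimage of their union, a chord, is log-trivial, being squeezed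
    between two arcs.  By a Mayer-Vietoris argument the intersection of the two preimages, which is
    the fiber over [q], is connected. *)

Require Import Defs.
From Stdlib Require Import Reals.
From Stdlib Require Import Lra Lia Psatz Classical ClassicalEpsilon.
From Stdlib Require Import FunctionalExtensionality PropExtensionality.
From Coquelicot Require Import Coquelicot.
Open Scope R_scope.

(** * Real-valued continuous functions, Tietze extension, connectedness *)

(** A straight ray of the chart need not be rectifiable in [X], so hypothesis (ii) says nothing
    about its preimage; it speaks only of biLipschitz arcs nearby. Hence the arguments are run on
    closed regions slightly larger than the ray and bounded by such arcs, and compactness of the
    disc carries a supposed separation, or a map to the circle, from the ray over to a region close
    enough.

    Connectedness of the boundary fibers is what starts the argument for rays: the ray from q ends
    at one boundary point, whose fiber on the circle is connected, so of two clopen parts of the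
    preimage of the ray one misses the circle. Enlarged to a region, that part is mapped into the
    bounding arc; but the arc crosses the line of the ray only behind its starting point, so the
    part contains no point over the ray.

    Logarithms replace homology because they reduce all separation arguments to Tietze extension and
    one global fact: the identity of the circle has no logarithm. *)

Definition contR {T : Type} (d : T -> T -> R) (S : T -> Prop) (f : T -> R) : Prop :=
  cont_on d (fun a b => Rabs (a - b)) S f.

(** The filter of relative neighbourhoods of [x] in [S]; through it sums, products and composites
    inherit continuity from Coquelicot's [filterlim]. *)
Definition near_in {T : Type} (d : T -> T -> R) (S : T -> Prop) (x : T) :
    (T -> Prop) -> Prop :=
  fun P => exists r, 0 < r /\ forall y, S y -> d x y < r -> P y.

#[global] Instance near_in_filter {T : Type} (d : T -> T -> R) (S : T -> Prop) (x : T) :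
  Filter (near_in d S x).
Proof.
  constructor.
  - exists 1. split; [lra | auto].
  - intros P Q [r [Hr HP]] [s [Hs HQ]]. exists (Rmin r s).
    split; [apply Rmin_glb_lt; auto |].
    intros y Hy Hd. split.
    + apply HP; auto. eapply Rlt_le_trans; [apply Hd | apply Rmin_l].
    + apply HQ; auto. eapply Rlt_le_trans; [apply Hd | apply Rmin_r].
  - intros P Q HPQ [r [Hr HP]]. exists r. split; auto.
Qed.

Lemma contR_filterlim {T : Type} (d : T -> T -> R) (S : T -> Prop) (f : T -> R) :
  contR d S f <-> forall x, S x -> filterlim f (near_in d S x) (locally (f x)).
Proof.
  split.
  - intros H x Hx. apply filterlim_locally. intros [eps He].
    destruct (H x Hx eps He) as [r [Hr Hy]]. exists r. split; auto.
    intros y Sy dy. simpl. unfold ball; simpl; unfold AbsRing_ball, abs, minus, plus, opp; simpl.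
    specialize (Hy y Sy dy). rewrite Rabs_minus_sym in Hy. exact Hy.
  - intros H x Hx eps He.
    pose proof (proj1 (filterlim_locally f (f x)) (H x Hx) (mkposreal eps He)) as [r [Hr Hy]].
    exists r. split; auto. intros y Sy dy. specialize (Hy y Sy dy).
    unfold ball in Hy; simpl in Hy; unfold AbsRing_ball, abs, minus, plus, opp in Hy; simpl in Hy.
    rewrite Rabs_minus_sym. exact Hy.
Qed.

Lemma contR_const {T : Type} (d : T -> T -> R) S (c : R) : contR d S (fun _ => c).
Proof.
  intros x Hx e He. exists 1. split; [lra |]. intros. rewrite Rminus_diag, Rabs_R0. auto.
Qed.

Lemma contR_plus {T : Type} (d : T -> T -> R) S f g :
  contR d S f -> contR d S g -> contR d S (fun x => f x + g x).
Proof.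
  rewrite !contR_filterlim. intros Hf Hg x Hx.
  exact (filterlim_comp_2 _ _ _ (Hf x Hx) (Hg x Hx) (filterlim_plus (f x) (g x))).
Qed.

Lemma contR_mult {T : Type} (d : T -> T -> R) S f g :
  contR d S f -> contR d S g -> contR d S (fun x => f x * g x).
Proof.
  rewrite !contR_filterlim. intros Hf Hg x Hx.
  exact (filterlim_comp_2 _ _ _ (Hf x Hx) (Hg x Hx) (filterlim_mult (f x) (g x))).
Qed.

Lemma contR_comp {T : Type} (d : T -> T -> R) S f (u : R -> R) :
  contR d S f -> (forall x, S x -> continuous u (f x)) -> contR d S (fun x => u (f x)).
Proof.
  rewrite !contR_filterlim. intros Hf Hu x Hx.
  exact (filterlim_comp _ _ _ _ _ _ _ _ (Hf x Hx) (Hu x Hx)).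
Qed.

Lemma contR_ext {T : Type} (d : T -> T -> R) (S : T -> Prop) f g :
  (forall x, S x -> f x = g x) -> contR d S f -> contR d S g.
Proof.
  intros E H x Hx e He. destruct (H x Hx e He) as [r [Hr Hy]]. exists r. split; auto.
  intros y Sy dy. rewrite <- !E; auto.
Qed.

Lemma contR_sub {T : Type} (d : T -> T -> R) (S S' : T -> Prop) f :
  (forall x, S' x -> S x) -> contR d S f -> contR d S' f.
Proof.
  intros E H x Hx e He. destruct (H x (E x Hx) e He) as [r [Hr Hy]]. exists r. split; auto.
Qed.

Lemma contR_opp {T : Type} (d : T -> T -> R) S f :
  contR d S f -> contR d S (fun x => - f x).
Proof.
  intros H. apply contR_ext with (fun x => (-1) * f x); [intros; ring |].
  apply contR_mult; auto using contR_const.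
Qed.

Lemma contR_minus {T : Type} (d : T -> T -> R) S f g :
  contR d S f -> contR d S g -> contR d S (fun x => f x - g x).
Proof. intros. apply contR_plus; auto. apply contR_opp; auto. Qed.

Lemma contR_div {T : Type} (d : T -> T -> R) (S : T -> Prop) f g :
  contR d S f -> contR d S g -> (forall x, S x -> g x <> 0) ->
  contR d S (fun x => f x / g x).
Proof.
  intros Hf Hg H0. apply contR_mult; auto. apply contR_comp with (u := Rinv); auto.
  intros x Hx. apply (ex_derive_continuous (fun y : R => / y)). auto_derive. auto.
Qed.

Lemma contR_cos {T : Type} (d : T -> T -> R) S f :
  contR d S f -> contR d S (fun x => cos (f x)).
Proof. intros. apply (contR_comp d S f cos); auto. intros; apply continuous_cos. Qed.

Lemma contR_sin {T : Type} (d : T -> T -> R) S f :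
  contR d S f -> contR d S (fun x => sin (f x)).
Proof. intros. apply (contR_comp d S f sin); auto. intros; apply continuous_sin. Qed.

Lemma contR_atan {T : Type} (d : T -> T -> R) S f :
  contR d S f -> contR d S (fun x => atan (f x)).
Proof. intros. apply (contR_comp d S f atan); auto. intros; apply continuous_atan. Qed.

Lemma contR_sqrt {T : Type} (d : T -> T -> R) S f :
  contR d S f -> contR d S (fun x => sqrt (f x)).
Proof. intros. apply (contR_comp d S f sqrt); auto. intros; apply continuous_sqrt. Qed.

Lemma contR_pow2 {T : Type} (d : T -> T -> R) S f :
  contR d S f -> contR d S (fun x => f x ^ 2).
Proof.
  intros. apply contR_ext with (fun x => f x * f x); [intros; ring |].
  apply contR_mult; auto.
Qed.

Lemma cont_on_comp {T1 T2 T3 : Type} (d1 : T1 -> T1 -> R) (d2 : T2 -> T2 -> R)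
    (d3 : T3 -> T3 -> R) (S1 : T1 -> Prop) (S2 : T2 -> Prop) f g :
  cont_on d1 d2 S1 f -> cont_on d2 d3 S2 g -> (forall x, S1 x -> S2 (f x)) ->
  cont_on d1 d3 S1 (fun x => g (f x)).
Proof.
  intros Hf Hg HS x Hx e He. destruct (Hg (f x) (HS x Hx) e He) as [r [Hr Hy]].
  destruct (Hf x Hx r Hr) as [s [Hs Hz]]. exists s. split; auto.
Qed.

Lemma cont_on_sub {T1 T2 : Type} (d1 : T1 -> T1 -> R) (d2 : T2 -> T2 -> R)
    (S S' : T1 -> Prop) f :
  (forall x, S' x -> S x) -> cont_on d1 d2 S f -> cont_on d1 d2 S' f.
Proof.
  intros E H x Hx e He. destruct (H x (E x Hx) e He) as [r [Hr Hy]]. exists r. split; auto.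
Qed.

Lemma contR_pos_nbhd {T : Type} (d : T -> T -> R) (S : T -> Prop) f x c :
  contR d S f -> S x -> c < f x ->
  exists r, 0 < r /\ forall y, S y -> d x y < r -> c < f y.
Proof.
  intros Hf Sx Hc. destruct (Hf x Sx (f x - c)) as [r [Hr H]]; [lra |].
  exists r. split; auto. intros y Sy dy. specialize (H y Sy dy).
  apply Rabs_def2 in H. lra.
Qed.

Ltac contR_auto :=
  repeat first
    [ assumption | apply contR_const
    | match goal with |- contR _ _ (fun x => @?f x / @?g x) => apply (contR_div _ _ f g) end
    | apply contR_plus | apply contR_minus
    | apply contR_opp | apply contR_mult | apply contR_pow2
    | apply contR_cos | apply contR_sin | apply contR_atan | apply contR_sqrt ].

(** Pasting along a relatively open [P]: the two formulas have to agree only at frontier points of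
    [P], since any other point outside [P] has a neighbourhood where only [g] is seen. *)
Lemma contR_glue {T : Type} (d : T -> T -> R) (S P : T -> Prop) (f g : T -> R) :
  (forall x, S x -> P x -> exists r, 0 < r /\ forall y, S y -> d x y < r -> P y) ->
  contR d S f ->
  contR d (fun x => S x /\ ~ P x) g ->
  (forall x, S x -> ~ P x -> f x = g x \/
     exists r, 0 < r /\ forall y, S y -> d x y < r -> ~ P y) ->
  contR d S (fun x => if excluded_middle_informative (P x) then f x else g x).
Proof.
  intros HP Hf Hg HN x Sx e He.
  destruct (Hf x Sx e He) as [r [Hr Fr]].
  destruct (excluded_middle_informative (P x)) as [Px | NPx].
  - destruct (HP x Sx Px) as [s [Hs Fs]]. exists (Rmin r s).
    split; [apply Rmin_glb_lt; auto |]. intros y Sy dy.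
    destruct (excluded_middle_informative (P y)) as [Py | NPy].
    + apply Fr; auto. eapply Rlt_le_trans; [apply dy | apply Rmin_l].
    + contradict NPy. apply Fs; auto. eapply Rlt_le_trans; [apply dy | apply Rmin_r].
  - destruct (Hg x (conj Sx NPx) e He) as [s [Hs Gs]].
    destruct (HN x Sx NPx) as [E | [t [Ht Ft]]].
    + exists (Rmin r s). split; [apply Rmin_glb_lt; auto |]. intros y Sy dy.
      destruct (excluded_middle_informative (P y)) as [Py | NPy].
      * rewrite <- E. apply Fr; auto. eapply Rlt_le_trans; [apply dy | apply Rmin_l].
      * apply Gs; auto. eapply Rlt_le_trans; [apply dy | apply Rmin_r].
    + exists (Rmin t s). split; [apply Rmin_glb_lt; auto |]. intros y Sy dy.
      destruct (excluded_middle_informative (P y)) as [Py | NPy].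
      * contradict Py. apply Ft; auto. eapply Rlt_le_trans; [apply dy | apply Rmin_l].
      * apply Gs; auto. eapply Rlt_le_trans; [apply dy | apply Rmin_r].
Qed.

(** Relative to a set because [dQ], being the value of a series, obeys the metric axioms only where
    that series converges, as on the Hilbert cube. *)
Definition metric_on {T : Type} (d : T -> T -> R) (Y : T -> Prop) : Prop :=
  (forall x y, Y x -> Y y -> 0 <= d x y) /\
  (forall x y, Y x -> Y y -> (d x y = 0 <-> x = y)) /\
  (forall x y, Y x -> Y y -> d x y = d y x) /\
  (forall x y z, Y x -> Y y -> Y z -> d x z <= d x y + d y z).

Lemma is_metric_on {T : Type} (d : T -> T -> R) Y : is_metric d -> metric_on d Y.
Proof. intros [A [B [C D]]]. repeat split; auto; apply B. Qed.

Definition closed_in {T : Type} (d : T -> T -> R) (Y K : T -> Prop) : Prop :=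
  forall x, Y x -> (forall eps, 0 < eps -> exists a, K a /\ d x a < eps) -> K x.

Lemma not_closed_in {T : Type} (d : T -> T -> R) (Y K : T -> Prop) x :
  closed_in d Y K -> Y x -> ~ K x -> exists r, 0 < r /\ forall a, K a -> r <= d x a.
Proof.
  intros C Yx NK. apply NNPP. intro H. apply NK. apply C; auto. intros eps He.
  apply NNPP. intro H2. apply H. exists eps. split; auto. intros a Ka.
  destruct (Rle_lt_dec eps (d x a)); auto. exfalso. apply H2. eauto.
Qed.

Definition infK {T : Type} (K : T -> Prop) (phi : T -> R) : R :=
  real (Glb_Rbar (fun r => exists a, K a /\ r = phi a)).

Lemma infK_spec {T : Type} (K : T -> Prop) (phi : T -> R) :
  (exists a, K a) -> (forall a, K a -> 0 <= phi a) ->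
  (forall a, K a -> infK K phi <= phi a) /\
  (forall m, (forall a, K a -> m <= phi a) -> m <= infK K phi).
Proof.
  intros [a0 K0] Hpos. unfold infK.
  destruct (Glb_Rbar_correct (fun r => exists a, K a /\ r = phi a)) as [Hlb Hgl].
  assert (H1 : Rbar_le 0 (Glb_Rbar (fun r => exists a, K a /\ r = phi a))).
  { apply Hgl. intros r [a [Ka ->]]. simpl. auto. }
  assert (H2 : Rbar_le (Glb_Rbar (fun r => exists a, K a /\ r = phi a)) (phi a0)).
  { apply Hlb. eauto. }
  destruct (Glb_Rbar _) as [g | |]; simpl in *; try tauto.
  split.
  - intros a Ka. apply (Hlb (phi a)). eauto.
  - intros m Hm. apply (Hgl (Finite m)). intros r [a [Ka ->]]. simpl. auto.
Qed.

(** The functions [p a * d x a] are [B]-Lipschitz in [x] uniformly in [a], and an infimum of such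
    functions is again [B]-Lipschitz. *)
Lemma infK_lip {T : Type} (d : T -> T -> R) (Y K : T -> Prop) (p : T -> R) B :
  metric_on d Y -> (forall a, K a -> Y a) -> (exists a, K a) ->
  (forall a, K a -> 0 <= p a <= B) ->
  contR d Y (fun x => infK K (fun a => p a * d x a)).
Proof.
  intros [M0 [M1 [M2 M3]]] KY Kne Hp x Yx e He.
  assert (HB : 0 <= B). { destruct Kne as [a Ka]. specialize (Hp a Ka). lra. }
  assert (Hpos : forall x, Y x -> forall a, K a -> 0 <= p a * d x a).
  { intros z Yz a Ka. apply Rmult_le_pos; auto. apply Hp; auto. }
  assert (L : forall x y, Y x -> Y y ->
     infK K (fun a => p a * d x a) <= infK K (fun a => p a * d y a) + B * d x y).
  { intros z y Yz Yy.
    destruct (infK_spec K (fun a => p a * d z a) Kne (Hpos z Yz)) as [A1 A2].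
    destruct (infK_spec K (fun a => p a * d y a) Kne (Hpos y Yy)) as [B1 B2].
    assert (infK K (fun a => p a * d z a) - B * d z y <= infK K (fun a => p a * d y a)).
    { apply B2. intros a Ka. specialize (A1 a Ka). simpl in A1.
      specialize (Hp a Ka). pose proof (M3 z y a Yz Yy (KY a Ka)).
      pose proof (M0 z y Yz Yy).
      assert (p a * d z a <= p a * (d z y + d y a)) by (apply Rmult_le_compat_l; lra).
      assert (p a * d z y <= B * d z y) by (apply Rmult_le_compat_r; lra). nra. }
    lra. }
  exists (e / (B + 1)). assert (0 < e / (B + 1)) by (apply Rdiv_lt_0_compat; lra).
  split; auto. intros y Yy dxy.
  pose proof (L x y Yx Yy). pose proof (L y x Yy Yx). rewrite (M2 y x Yy Yx) in H1.
  assert (B * d x y < e).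
  { assert ((B + 1) * d x y < e).
    { apply Rmult_lt_compat_l with (r := B + 1) in dxy; [| lra].
      replace ((B + 1) * (e / (B + 1))) with e in dxy by (field; lra). lra. }
    pose proof (M0 x y Yx Yy). nra. }
  apply Rabs_def1; lra.
Qed.

(* Hausdorff's formula [inf_a p(a) d(x,a) / inf_a d(x,a)] for data with values in [1,2]. *)
Lemma tietze12 {T : Type} (d : T -> T -> R) (Y K : T -> Prop) (p : T -> R) :
  metric_on d Y -> (forall a, K a -> Y a) -> closed_in d Y K ->
  contR d K p -> (forall a, K a -> 1 <= p a <= 2) ->
  exists F, contR d Y F /\ forall x, K x -> F x = p x.
Proof.
  intros M KY CK Cp Hp.
  destruct (classic (exists a, K a)) as [Kne | Kem].
  2: { exists (fun _ => 0). split; [apply contR_const |].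
       intros x Kx. exfalso. eauto. }
  pose proof M as [M0 [M1 [M2 M3]]].
  set (N := fun x => infK K (fun a => p a * d x a)).
  set (D := fun x => infK K (fun a => 1 * d x a)).
  assert (CN : contR d Y N).
  { apply (infK_lip d Y K p 2); auto. intros a Ka. specialize (Hp a Ka). lra. }
  assert (CD : contR d Y D).
  { apply (infK_lip d Y K (fun _ => 1) 1); auto. intros; lra. }
  assert (SN : forall x, Y x -> (forall a, K a -> N x <= p a * d x a) /\
                 (forall m, (forall a, K a -> m <= p a * d x a) -> m <= N x)).
  { intros x Yx. apply infK_spec; auto. intros a Ka. apply Rmult_le_pos; auto.
    specialize (Hp a Ka). lra. }
  assert (SD : forall x, Y x -> (forall a, K a -> D x <= 1 * d x a) /\
                 (forall m, (forall a, K a -> m <= 1 * d x a) -> m <= D x)).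
  { intros x Yx. apply infK_spec; auto. intros a Ka. apply Rmult_le_pos; auto. lra. }
  assert (PD : forall x, Y x -> ~ K x -> 0 < D x).
  { intros x Yx NK. destruct (not_closed_in d Y K x CK Yx NK) as [r [Hr Fr]].
    apply Rlt_le_trans with r; auto. apply SD; auto. intros. rewrite Rmult_1_l; auto. }
  exists (fun x => if excluded_middle_informative (K x) then p x else N x / D x).
  split.
  2: { intros x Kx. destruct (excluded_middle_informative (K x)); tauto. }
  assert (CQ : contR d (fun x => Y x /\ ~ K x) (fun x => N x / D x)).
  { apply contR_div.
    - apply contR_sub with Y; auto; tauto.
    - apply contR_sub with Y; auto; tauto.
    - intros x [Yx NK]. pose proof (PD x Yx NK). lra. }
  intros x Yx e He.
  destruct (excluded_middle_informative (K x)) as [Kx | NKx].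
  - destruct (Cp x Kx (e/2)) as [r [Hr Fr]]; [lra |].
    (* Only points [a] with [d y a < r / 2] matter, and these lie in the [r]-ball of [x]. Any other
       [a] costs at least [1 * (r / 2)], while [x] itself costs at most [2 * (r / 4)]: this is where
       the range [1,2] of the data is used. *)
    exists (r / 4). split; [lra |]. intros y Yy dxy.
    destruct (excluded_middle_informative (K y)) as [Ky | NKy].
    + apply Rlt_trans with (e / 2); [apply Fr; auto; lra | lra].
    + pose proof (PD y Yy NKy) as Dp. destruct (SN y Yy) as [N1 N2].
      destruct (SD y Yy) as [D1 D2].
      pose proof (Hp x Kx) as Hpx.
      assert (Dsm : D y <= d x y). { rewrite M2; auto. specialize (D1 x Kx). lra. }
      assert (Near : forall a, K a -> d y a < r / 2 -> Rabs (p x - p a) < e / 2).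
      { intros a Ka Ha. apply Fr; auto. pose proof (M3 x y a Yx Yy (KY a Ka)). lra. }
      assert (U : N y <= (p x + e / 2) * D y).
      { assert (N y / (p x + e / 2) <= D y).
        { apply D2. intros a Ka. rewrite Rmult_1_l.
          apply Rle_div_l; [lra |].
          pose proof (M0 y a Yy (KY a Ka)).
          destruct (Rlt_le_dec (d y a) (r / 2)) as [h | h].
          - specialize (Near a Ka h). apply Rabs_def2 in Near.
            specialize (N1 a Ka). nra.
          - specialize (N1 x Kx). rewrite (M2 y x) in N1; auto.
            pose proof (M0 x y Yx Yy).
            assert (p x * d x y <= p x * d y a) by (apply Rmult_le_compat_l; lra). nra. }
        apply Rle_div_l in H; lra. }
      assert (L : (p x - e / 2) * D y <= N y).
      { apply N2. intros a Ka. pose proof (D1 a Ka). pose proof (Hp a Ka).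
        destruct (Rlt_le_dec (d y a) (r / 2)) as [h | h].
        - specialize (Near a Ka h). apply Rabs_def2 in Near.
          assert ((p x - e / 2) * D y <= p a * D y) by (apply Rmult_le_compat_r; lra).
          assert (p a * D y <= p a * d y a) by (apply Rmult_le_compat_l; lra). lra.
        - assert ((p x - e / 2) * D y <= 2 * D y) by (apply Rmult_le_compat_r; lra).
          nra. }
      assert (A : N y / D y <= p x + e / 2) by (apply Rle_div_l; auto).
      assert (B : p x - e / 2 <= N y / D y) by (apply Rle_div_r; auto).
      apply Rabs_def1; lra.
  - destruct (CQ x (conj Yx NKx) e He) as [r [Hr Fr]].
    destruct (not_closed_in d Y K x CK Yx NKx) as [s [Hs Fs]].
    exists (Rmin r s). split; [apply Rmin_glb_lt; auto |]. intros y Yy dxy.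
    destruct (excluded_middle_informative (K y)) as [Ky | NKy].
    + specialize (Fs y Ky). pose proof (Rmin_r r s). lra.
    + apply Fr; auto. eapply Rlt_le_trans; [apply dxy | apply Rmin_l].
Qed.

(** Cluster points instead of convergent subsequences: in this form compactness passes to products
    and images without composing index maps. *)
Definition cluster_compact {T : Type} (d : T -> T -> R) (K : T -> Prop) : Prop :=
  forall u : nat -> T, (forall n, K (u n)) -> exists l, K l /\
    forall eps, 0 < eps -> forall N, exists n, (N <= n)%nat /\ d (u n) l < eps.

Lemma compact_set_cluster {T : Type} (d : T -> T -> R) K :
  compact_set d K -> cluster_compact d K.
Proof.
  intros H u Hu. destruct (H u Hu) as [phi [l [Hphi [Kl Hl]]]].
  exists l. split; auto. intros eps He N. destruct (Hl eps He) as [M HM].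
  assert (G : forall n, (n <= phi n)%nat).
  { induction n; [lia |]. specialize (Hphi n). lia. }
  exists (phi (max N M)). split.
  - specialize (G (max N M)). lia.
  - apply HM. lia.
Qed.

(* A failing [exists n, forall x in K, ...] yields a sequence, to which compactness applies. *)
Lemma compact_uniform {T : Type} (d : T -> T -> R) (K : T -> Prop) (P : nat -> T -> Prop) :
  cluster_compact d K ->
  (forall l, K l -> exists eps N, 0 < eps /\
     forall n x, (N <= n)%nat -> K x -> d x l < eps -> P n x) ->
  exists n, forall x, K x -> P n x.
Proof.
  intros HK HP. apply NNPP. intro H.
  assert (B : forall n, exists x, K x /\ ~ P n x).
  { intros n. apply NNPP. intro H2. apply H. exists n. intros x Kx.
    apply NNPP. intro. apply H2. eauto. }
  destruct (HK (fun n => proj1_sig (constructive_indefinite_description _ (B n))))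
    as [l [Kl Hl]].
  { intros n. destruct (constructive_indefinite_description _ (B n)) as [x [Hx1 Hx2]]; auto. }
  destruct (HP l Kl) as [eps [N [He HN]]].
  destruct (Hl eps He N) as [n [Hn Hd]].
  destruct (constructive_indefinite_description _ (B n)) as [x [Hx1 Hx2]].
  simpl in Hd. apply Hx2. eapply HN; eauto.
Qed.

Lemma inv_INR_lt eps : 0 < eps ->
  exists N : nat, forall n, (N <= n)%nat -> 0 < / INR (S n) < eps.
Proof.
  intros He. destruct (archimed_cor1 eps He) as [N [H1 H2]].
  exists N. intros n Hn.
  assert (0 < INR N) by (apply lt_0_INR; lia).
  assert (INR N <= INR (S n)) by (apply le_INR; lia).
  split; [apply Rinv_0_lt_compat; lra |].
  apply Rle_lt_trans with (/ INR N); auto. apply Rinv_le_contravar; auto.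
Qed.

Lemma closed_in_compact {T : Type} (d : T -> T -> R) (K A : T -> Prop) :
  is_metric d -> cluster_compact d K -> (forall x, A x -> K x) -> closed_in d K A ->
  cluster_compact d A.
Proof.
  intros [_ [_ [M2 _]]] HK AK CA u Hu. destruct (HK u) as [l [Kl Hl]]; [auto |].
  exists l. split; auto. apply CA; auto. intros eps He.
  destruct (Hl eps He 0%nat) as [n [_ Hn]]. exists (u n). split; auto. rewrite M2. auto.
Qed.

Lemma compact_closed {T : Type} (d : T -> T -> R) (Y K : T -> Prop) :
  metric_on d Y -> (forall x, K x -> Y x) -> cluster_compact d K -> closed_in d Y K.
Proof.
  intros [M0 [M1 [M2 M3]]] KY HK x Yx Hx.
  destruct (HK (fun n => epsilon (inhabits x) (fun a => K a /\ d x a < / INR (S n))))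
    as [l [Kl Hl]].
  { intros n. apply (epsilon_spec (inhabits x) (fun a => K a /\ d x a < / INR (S n))).
    apply Hx. apply Rinv_0_lt_compat, lt_0_INR. lia. }
  replace x with l; auto. symmetry. apply M1; auto.
  destruct (Rle_lt_or_eq_dec 0 (d x l)) as [h | h]; auto.
  destruct (inv_INR_lt (d x l / 2)) as [N HN]; [lra |].
  destruct (Hl (d x l / 2) ltac:(lra) N) as [n [Hn Hd]].
  pose proof (epsilon_spec (inhabits x) (fun a => K a /\ d x a < / INR (S n))) as E.
  cbv beta in Hd, E. set (a := epsilon _ _) in *.
  destruct E as [Ka da].
  { apply Hx. apply Rinv_0_lt_compat, lt_0_INR. lia. }
  destruct (HN n Hn). pose proof (M3 x a l Yx (KY a Ka) (KY l Kl)). lra.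
Qed.

Lemma contR_bounded {T : Type} (d : T -> T -> R) (Y K : T -> Prop) f :
  metric_on d Y -> (forall x, K x -> Y x) ->
  cluster_compact d K -> contR d K f -> exists B, 0 < B /\ forall x, K x -> Rabs (f x) <= B.
Proof.
  intros [M0 [M1 [M2 M3]]] KY HK Cf.
  destruct (compact_uniform d K (fun n x => Rabs (f x) <= INR (S n)) HK) as [n Hn].
  - intros l Kl. destruct (Cf l Kl 1) as [r [Hr Fr]]; [lra |].
    destruct (nfloor_ex (Rabs (f l) + 1)) as [N HN]; [pose proof (Rabs_pos (f l)); lra |].
    exists r, N. split; auto. intros n x Hn Kx dx.
    rewrite M2 in dx by auto. specialize (Fr x Kx dx).
    assert (INR N <= INR n) by (apply le_INR; auto). rewrite S_INR.
    pose proof (Rabs_triang_inv (f x) (f l)). rewrite Rabs_minus_sym in Fr. lra.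
  - exists (INR (S n)). split; [apply lt_0_INR; lia | auto].
Qed.

Lemma tietze {T : Type} (d : T -> T -> R) (Y K : T -> Prop) (f : T -> R) :
  metric_on d Y -> (forall a, K a -> Y a) -> cluster_compact d K -> contR d K f ->
  exists F, contR d Y F /\ forall x, K x -> F x = f x.
Proof.
  intros M KY HK Cf.
  destruct (contR_bounded d Y K f M KY HK Cf) as [B [HB Bf]].
  (* The affine change of values takes [-B,B] to [1,2]. *)
  destruct (tietze12 d Y K (fun x => 3 / 2 + f x * / (2 * B))) as [F [CF EF]]; auto.
  - apply compact_closed; auto.
  - contR_auto.
  - intros a Ka. specialize (Bf a Ka). apply Rabs_le_between in Bf.
    assert (0 < / (2 * B)) by (apply Rinv_0_lt_compat; lra).
    assert (B * / (2 * B) = 1 / 2) by (field; lra). nra.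
  - exists (fun x => (F x - 3 / 2) * (2 * B)). split; [contR_auto |].
    intros x Kx. rewrite EF; auto. field. lra.
Qed.

(** A separation only has to be disjoint on [A]. Shrinking to balls of half the radius around points
    of [A] makes it disjoint everywhere: if two half balls met, the centre of the smaller would lie
    in the full ball of the larger. *)
Lemma connected_disjoint {T : Type} (d : T -> T -> R) (A : T -> Prop) :
  is_metric d -> ~ connected_set d A ->
  exists U V : T -> Prop, is_open d U /\ is_open d V /\
    (forall x, A x -> U x \/ V x) /\ (exists x, A x /\ U x) /\ (exists x, A x /\ V x) /\
    (forall x, U x -> V x -> False).
Proof.
  intros [M0 [M1 [M2 M3]]] H. apply NNPP in H.
  destruct H as [U [V [OU [OV [Cov [NU [NV Dis]]]]]]].
  set (half := fun W : T -> Prop => fun x => exists a r, A a /\ W a /\ 0 < r /\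
     (forall y, d a y < 2 * r -> W y) /\ d a x < r).
  assert (OH : forall W, is_open d (half W)).
  { intros W x [a [r [Aa [Wa [Hr [HW Hx]]]]]]. exists (r - d a x). split; [lra |].
    intros y Hy. exists a, r. repeat split; auto. pose proof (M3 a x y). lra. }
  assert (HH : forall W x, is_open d W -> A x -> W x -> half W x).
  { intros W x OW Ax Wx. destruct (OW x Wx) as [r [Hr HW]]. exists x, (r / 2).
    repeat split; auto; [lra | intros; apply HW; lra |].
    rewrite (proj2 (M1 x x) eq_refl). lra. }
  exists (half U), (half V). repeat split; auto.
  - intros x Ax. destruct (Cov x Ax); auto.
  - destruct NU as [x [? ?]]. eauto.
  - destruct NV as [x [? ?]]. eauto.
  - intros x [a [r [Aa [Ua [Hr [HU Hx]]]]]] [b [s [Ab [Vb [Hs [HV Hy]]]]]].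
    pose proof (M3 a x b) as T1. rewrite (M2 x b) in T1.
    destruct (Rle_lt_dec r s) as [h | h].
    + apply (Dis a); auto. apply HV. rewrite M2. lra.
    + apply (Dis b); auto. apply HU. lra.
Qed.

Lemma connected_ivt {T : Type} (d : T -> T -> R) (K : T -> Prop) f a b c :
  is_metric d -> connected_set d K -> contR d K f -> K a -> K b -> f a < c < f b ->
  exists x, K x /\ f x = c.
Proof.
  intros [M0 [M1 [M2 M3]]] HK Cf Ka Kb Hc. apply NNPP. intro H. apply HK.
  assert (C0 : forall x, K x -> f x <> c) by (intros x Kx E; apply H; eauto).
  (* Separations are by sets open in the whole space, whereas [f] is continuous only on [K]; so the
     sets [f < c] and [f > c] are thickened by balls. *)
  set (near := fun P : R -> Prop => fun x => exists a r, K a /\ 0 < r /\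
     (forall y, K y -> d a y < 2 * r -> P (f y)) /\ d a x < r).
  assert (OH : forall W, is_open d (near W)).
  { intros W x [p [r [Aa [Hr [HW Hx]]]]]. exists (r - d p x). split; [lra |].
    intros y Hy. exists p, r. repeat split; auto. pose proof (M3 p x y). lra. }
  assert (L : forall x, K x -> f x < c -> near (fun t => t < c) x).
  { intros x Kx Hx. destruct (Cf x Kx (c - f x)) as [r [Hr Fr]]; [lra |].
    exists x, (r / 2). repeat split; auto; [lra | |].
    - intros y Ky dy. specialize (Fr y Ky ltac:(lra)). apply Rabs_def2 in Fr. lra.
    - rewrite (proj2 (M1 x x) eq_refl). lra. }
  assert (G : forall x, K x -> c < f x -> near (fun t => c < t) x).
  { intros x Kx Hx. destruct (Cf x Kx (f x - c)) as [r [Hr Fr]]; [lra |].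
    exists x, (r / 2). repeat split; auto; [lra | |].
    - intros y Ky dy. specialize (Fr y Ky ltac:(lra)). apply Rabs_def2 in Fr. lra.
    - rewrite (proj2 (M1 x x) eq_refl). lra. }
  exists (near (fun t => t < c)), (near (fun t => c < t)). repeat split; auto.
  - intros x Kx. destruct (Rtotal_order (f x) c) as [h | [h | h]]; auto.
    exfalso. eapply C0; eauto.
  - exists a. split; auto. apply L; auto; lra.
  - exists b. split; auto. apply G; auto; lra.
  - intros x Kx [p [r [Kp [Hr [HW Hx]]]]] [q [s [Kq [Hs [HV Hy]]]]].
    assert (f x < c) by (apply HW; auto; lra). assert (c < f x) by (apply HV; auto; lra). lra.
Qed.

Lemma connected_star {T : Type} (d : T -> T -> R) (K : T -> Prop) x0 :
  (forall x, K x -> exists A, connected_set d A /\ (forall y, A y -> K y) /\ A x /\ A x0) ->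
  connected_set d K.
Proof.
  intros H [U [V [OU [OV [Cov [[a [Ka Ua]] [[b [Kb Vb]] Dis]]]]]]].
  destruct (H a Ka) as [A [HA [AK [Aa A0]]]].
  destruct (Cov x0 (AK _ A0)) as [h | h].
  - destruct (H b Kb) as [B [HB [BK [Bb B0]]]]. apply HB.
    exists U, V. repeat split; eauto.
  - apply HA. exists U, V. repeat split; eauto.
Qed.

Lemma connected_image {T1 T2 : Type} (d1 : T1 -> T1 -> R) (d2 : T2 -> T2 -> R)
    (A : T1 -> Prop) (f : T1 -> T2) :
  is_metric d1 -> is_metric d2 ->
  connected_set d1 A -> cont_on d1 d2 A f ->
  connected_set d2 (fun y => exists x, A x /\ f x = y).
Proof.
  intros [M0 [M1 [M2 M3]]] [N0 [N1 _]] HA Cf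
    [U [V [OU [OV [Cov [[a [[p [Ap <-]] Ua]] [[b [[q [Aq <-]] Vb]] Dis]]]]]]].
  apply HA.
  set (pre := fun W : T2 -> Prop => fun x => exists a r, A a /\ 0 < r /\
     (forall y, A y -> d1 a y < r -> W (f y)) /\ d1 a x < r).
  assert (OH : forall W, is_open d1 (pre W)).
  { intros W x [c [r [Aa [Hr [HW Hx]]]]]. exists (r - d1 c x). split; [lra |].
    intros y Hy. exists c, r. repeat split; auto. pose proof (M3 c x y). lra. }
  assert (HH : forall W x, is_open d2 W -> A x -> W (f x) -> pre W x).
  { intros W x OW Ax Wx. destruct (OW _ Wx) as [r [Hr HW]].
    destruct (Cf x Ax r Hr) as [s [Hs Hy]]. exists x, s. repeat split; auto.
    rewrite (proj2 (M1 x x) eq_refl). lra. }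
  assert (HB : forall W x, A x -> pre W x -> W (f x)).
  { intros W x Ax [c [r [Ac [Hr [HW Hx]]]]]. auto. }
  exists (pre U), (pre V). repeat split; auto.
  - intros x Ax. destruct (Cov (f x)); eauto.
  - exists p. auto.
  - exists q. auto.
  - intros x Ax Hu Hv. apply (Dis (f x)); [exists x | apply HB | apply HB]; auto.
Qed.

Lemma R_metric : is_metric (fun a b : R => Rabs (a - b)).
Proof.
  repeat split; intros.
  - apply Rabs_pos.
  - destruct (Req_dec (x - y) 0); [lra |]. exfalso. eapply Rabs_no_R0; eauto.
  - subst. rewrite Rminus_diag. apply Rabs_R0.
  - apply Rabs_minus_sym.
  - replace (x - z) with ((x - y) + (y - z)) by ring. apply Rabs_triang.
Qed.

Lemma interval_connected a b :
  connected_set (fun x y : R => Rabs (x - y)) (fun t => a <= t <= b).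
Proof.
  intro H.
  destruct (connected_disjoint _ _ R_metric (fun F => F H))
    as [U [V [OU [OV [Cov [[p [Hp Up]] [[q [Hq Vq]] Dis]]]]]]].
  assert (Main : forall (U V : R -> Prop) p q,
    is_open (fun x y : R => Rabs (x - y)) U -> is_open (fun x y : R => Rabs (x - y)) V ->
    (forall x, a <= x <= b -> U x \/ V x) -> a <= p <= b -> a <= q <= b -> U p -> V q ->
    (forall x, U x -> V x -> False) -> p < q -> False).
  { clear. intros U V p q OU OV Cov Hp Hq Up Vq Dis Hpq.
    destruct (completeness (fun t => p <= t <= q /\ U t)) as [s [S1 S2]].
    - exists q. intros t Ht. tauto || lra.
    - exists p. split; auto; lra.
    - assert (p <= s) by (apply S1; split; auto; lra).
      assert (s <= q) by (apply S2; intros t Ht; lra).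
      destruct (Cov s ltac:(lra)) as [h | h].
      + destruct (OU s h) as [r [Hr Fr]].
        assert (s <> q) by (intros ->; eauto).
        set (t := Rmin q (s + r / 2)).
        assert (s < t <= q /\ t <= s + r / 2).
        { unfold t. split; [split |]; [apply Rmin_glb_lt; lra | apply Rmin_l | apply Rmin_r]. }
        assert (t <= s); [| lra]. apply S1. split; [lra |]. apply Fr.
        apply Rabs_def1; lra.
      + destruct (OV s h) as [r [Hr Fr]].
        assert (s <= s - r / 2); [| lra]. apply S2. intros t [Ht Ut].
        destruct (Rle_lt_dec t (s - r / 2)); auto.
        exfalso. apply (Dis t); auto. apply Fr.
        assert (t <= s) by (apply S1; auto). apply Rabs_def1; lra. }
  destruct (Rtotal_order p q) as [h | [h | h]].
  - apply (Main U V p q); auto.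
  - subst. eauto.
  - apply (Main V U q p); auto.
    + intros x Hx. destruct (Cov x Hx); auto.
    + intros x ? ?; eauto.
Qed.

Lemma homeo_inverse {T1 T2 : Type} (d1 : T1 -> T1 -> R) (d2 : T2 -> T2 -> R)
    (S : T1 -> Prop) (Y : T2 -> Prop) (f : T1 -> T2) :
  homeo_onto d1 d2 S Y f -> (exists x, S x) ->
  exists g, (forall y, Y y -> S (g y) /\ f (g y) = y) /\ (forall x, S x -> g (f x) = x) /\
    cont_on d2 d1 Y g.
Proof.
  intros [E1 [E2 [E3 [E4 E5]]]] [x0 _].
  set (g := fun y => epsilon (inhabits x0) (fun x => S x /\ f x = y)).
  assert (Hg : forall y, Y y -> S (g y) /\ f (g y) = y).
  { intros y Hy. apply (epsilon_spec (inhabits x0) (fun x => S x /\ f x = y)). auto. }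
  exists g. split; auto. split.
  - intros x Sx. destruct (Hg (f x) (E1 x Sx)). apply E3; auto.
  - intros y Hy eps He. destruct (Hg y Hy) as [A B].
    destruct (E5 (g y) A eps He) as [r [Hr Fr]]. exists r. split; auto.
    intros z Hz dz. destruct (Hg z Hz) as [A' B']. apply Fr; auto. rewrite B, B'. auto.
Qed.

(** * Continuous logarithms *)

Definition has_log {T : Type} (d : T -> T -> R) (K : T -> Prop) (f g : T -> R) : Prop :=
  exists th, contR d K th /\ forall x, K x -> cos (th x) = f x /\ sin (th x) = g x.

Definition circle_map {T : Type} (d : T -> T -> R) (K : T -> Prop) (f g : T -> R) : Prop :=
  contR d K f /\ contR d K g /\ forall x, K x -> f x ^ 2 + g x ^ 2 = 1.

(** For compact [K] this is the vanishing of the first integral Cech cohomology group, read as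
    homotopy classes of maps to the circle. *)
Definition log_trivial {T : Type} (d : T -> T -> R) (K : T -> Prop) : Prop :=
  forall f g, circle_map d K f g -> has_log d K f g.

Lemma has_log_sub {T : Type} (d : T -> T -> R) (K K' : T -> Prop) f g :
  (forall x, K' x -> K x) -> has_log d K f g -> has_log d K' f g.
Proof.
  intros S [th [C H]]. exists th. split; auto. apply contR_sub with K; auto.
Qed.

Lemma circle_map_sub {T : Type} (d : T -> T -> R) (K K' : T -> Prop) f g :
  (forall x, K' x -> K x) -> circle_map d K f g -> circle_map d K' f g.
Proof.
  intros S [Cf [Cg U]].
  split; [apply contR_sub with K; auto | split; [apply contR_sub with K |]; auto].
Qed.

(** The tangent half-angle formula: [2 * atan (C / (1 + D))] is the principal argument of D + iC,
    continuous away from -1. *)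
Lemma half_angle D C : D ^ 2 + C ^ 2 = 1 -> -1 < D ->
  cos (2 * atan (C / (1 + D))) = D /\ sin (2 * atan (C / (1 + D))) = C.
Proof.
  intros H HD. set (t := C / (1 + D)).
  assert (Ht : 1 + t ^ 2 = 2 / (1 + D)).
  { replace (1 + t ^ 2) with (((1 + D) ^ 2 + C ^ 2) / (1 + D) ^ 2) by (unfold t; field; lra).
    replace ((1 + D) ^ 2 + C ^ 2) with (2 * (1 + D)) by lra. field. lra. }
  assert (P : 0 < 1 + t ^ 2) by nra.
  assert (Q : sqrt (1 + t²) * sqrt (1 + t²) = 1 + t ^ 2).
  { rewrite sqrt_sqrt; unfold Rsqr; nra. }
  assert (Q0 : sqrt (1 + t²) <> 0) by (intro E; rewrite E in Q; lra).
  rewrite cos_2a, sin_2a, cos_atan, sin_atan. split.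
  - replace (1 / sqrt (1 + t²) * (1 / sqrt (1 + t²)) - t / sqrt (1 + t²) * (t / sqrt (1 + t²)))
      with ((1 - t ^ 2) / (sqrt (1 + t²) * sqrt (1 + t²))) by (field; auto).
    rewrite Q. replace (1 - t ^ 2) with (2 - (1 + t ^ 2)) by ring. rewrite Ht. field. lra.
  - replace (2 * (t / sqrt (1 + t²)) * (1 / sqrt (1 + t²)))
      with (2 * t / (sqrt (1 + t²) * sqrt (1 + t²))) by (field; auto).
    rewrite Q, Ht. unfold t. field. lra.
Qed.

Lemma cos_sin_2 t : cos t ^ 2 + sin t ^ 2 = 1.
Proof. pose proof (sin2_cos2 t). unfold Rsqr in H. lra. Qed.

(* The quotient of the two maps avoids -1, so it has a principal argument. *)
Lemma has_log_close {T : Type} (d : T -> T -> R) (K : T -> Prop) f1 f2 g1 g2 :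
  circle_map d K f1 f2 -> circle_map d K g1 g2 -> has_log d K g1 g2 ->
  (forall x, K x -> -1 < f1 x * g1 x + f2 x * g2 x) -> has_log d K f1 f2.
Proof.
  intros [F1 [F2 F]] [G1 [G2 G]] [th [Cth Hth]] Hd.
  exists (fun x => th x + 2 * atan ((g1 x * f2 x - g2 x * f1 x) /
                                    (1 + (f1 x * g1 x + f2 x * g2 x)))).
  split.
  - contR_auto.
    intros x Kx. specialize (Hd x Kx). lra.
  - intros x Kx. specialize (F x Kx). specialize (G x Kx). specialize (Hd x Kx).
    destruct (Hth x Kx) as [E1 E2].
    destruct (half_angle (f1 x * g1 x + f2 x * g2 x) (g1 x * f2 x - g2 x * f1 x)) as [A B]; auto.
    + replace ((f1 x * g1 x + f2 x * g2 x) ^ 2 + (g1 x * f2 x - g2 x * f1 x) ^ 2)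
        with ((f1 x ^ 2 + f2 x ^ 2) * (g1 x ^ 2 + g2 x ^ 2)) by ring.
      rewrite F, G. ring.
    + rewrite cos_plus, sin_plus, A, B, E1, E2. split.
      * replace (g1 x * (f1 x * g1 x + f2 x * g2 x) - g2 x * (g1 x * f2 x - g2 x * f1 x))
          with (f1 x * (g1 x ^ 2 + g2 x ^ 2)) by ring. rewrite G. ring.
      * replace (g2 x * (f1 x * g1 x + f2 x * g2 x) + g1 x * (g1 x * f2 x - g2 x * f1 x))
          with (f2 x * (g1 x ^ 2 + g2 x ^ 2)) by ring. rewrite G. ring.
Qed.

Lemma has_log_const {T : Type} (d : T -> T -> R) (K : T -> Prop) f g a b :
  a ^ 2 + b ^ 2 = 1 -> (forall x, K x -> f x = a /\ g x = b) -> has_log d K f g.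
Proof.
  intros H E.
  assert (X : exists t, cos t = a /\ sin t = b).
  { destruct (Req_dec a (-1)) as [-> | h].
    - exists PI. rewrite cos_PI, sin_PI. nra.
    - exists (2 * atan (b / (1 + a))). apply half_angle; auto. nra. }
  destruct X as [t [Ht1 Ht2]]. exists (fun _ => t). split; [apply contR_const |].
  intros x Kx. destruct (E x Kx). lra.
Qed.

Lemma interval_compact a b :
  cluster_compact (fun x y : R => Rabs (x - y)) (fun t => a <= t <= b).
Proof.
  intros u Hu.
  destruct (Bolzano_Weierstrass u (fun t => a <= t <= b) (compact_P3 a b) Hu) as [t Ht].
  assert (Near : forall eps, 0 < eps -> forall N, exists n, (N <= n)%nat /\ Rabs (u n - t) < eps).
  { intros eps He N. destruct (Ht (disc t (mkposreal eps He)) N) as [p [Hp Hd]]; eauto.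
    exists (mkposreal eps He). intros y Hy; auto. }
  exists t. split; auto.
  split; apply Rnot_lt_le; intro h.
  - destruct (Near (a - t) ltac:(lra) 0%nat) as [n [_ Hn]].
    specialize (Hu n). apply Rabs_def2 in Hn. lra.
  - destruct (Near (t - b) ltac:(lra) 0%nat) as [n [_ Hn]].
    specialize (Hu n). apply Rabs_def2 in Hn. lra.
Qed.

Lemma product_compact {T : Type} (d : T -> T -> R) (K : T -> Prop) a b :
  is_metric d -> cluster_compact d K ->
  cluster_compact (dprod d) (fun p => a <= fst p <= b /\ K (snd p)).
Proof.
  intros [M0 [M1 [M2 M3]]] HK u Hu.
  destruct (interval_compact a b (fun n => fst (u n))) as [t [Tab Near]]; [apply Hu |].
  (* [k n] is an index beyond [n] whose first coordinate is already within 1/(n+1) of [t]; a cluster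
     point of the second coordinates along [k] then serves for the pair. *)
  set (P := fun n m : nat => (n <= m)%nat /\ Rabs (fst (u m) - t) < / INR (S n)).
  assert (EP : forall n, P n (epsilon (inhabits 0%nat) (P n))).
  { intros n. apply epsilon_spec. apply Near. apply Rinv_0_lt_compat, lt_0_INR. lia. }
  set (k := fun n => epsilon (inhabits 0%nat) (P n)) in *.
  destruct (HK (fun n => snd (u (k n)))) as [l [Kl Hl]]; [intros; apply Hu |].
  exists (t, l). split; [simpl; auto |]. intros eps He N.
  destruct (inv_INR_lt eps He) as [M HM].
  destruct (Hl eps He (max M N)) as [n [Hn Hd]].
  exists (k n). destruct (EP n) as [E1 E2]. fold (k n) in E1, E2. split; [lia |].
  unfold dprod; simpl. apply Rmax_lub_lt; auto.
  eapply Rlt_trans; [apply E2 | apply HM; lia].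
Qed.

Lemma dprod_metric {T : Type} (d : T -> T -> R) : is_metric d -> is_metric (dprod d).
Proof.
  intros [M0 [M1 [M2 M3]]]. destruct R_metric as [N0 [N1 [N2 N3]]].
  unfold dprod. repeat split; intros.
  - eapply Rle_trans; [apply (M0 (snd x) (snd y)) | apply Rmax_r].
  - destruct x as [s x], y as [t y]; simpl in *.
    pose proof (Rmax_l (Rabs (s - t)) (d x y)). pose proof (Rmax_r (Rabs (s - t)) (d x y)).
    pose proof (M0 x y). pose proof (N0 s t). f_equal; [apply N1 | apply M1]; lra.
  - subst. rewrite (proj2 (N1 _ _) eq_refl), (proj2 (M1 _ _) eq_refl).
    apply Rmax_left. lra.
  - rewrite N2, M2. reflexivity.
  - apply Rmax_lub.
    + eapply Rle_trans; [apply (N3 _ (fst y)) |]. apply Rplus_le_compat; apply Rmax_l.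
    + eapply Rle_trans; [apply (M3 _ (snd y)) |]. apply Rplus_le_compat; apply Rmax_r.
Qed.

Lemma contR_slice {T : Type} (d : T -> T -> R) (K : T -> Prop) (F : R * T -> R) t :
  is_metric d -> 0 <= t <= 1 -> contR (dprod d) (fun p => 0 <= fst p <= 1 /\ K (snd p)) F ->
  contR d K (fun x => F (t, x)).
Proof.
  intros [M0 _] Ht CF x Kx e He.
  destruct (CF (t, x)) with (eps := e) as [r [Hr Fr]]; auto. exists r. split; auto.
  intros y Ky dy. apply Fr; auto. unfold dprod; simpl.
  rewrite Rminus_diag, Rabs_R0. apply Rmax_lub_lt; auto.
Qed.

(** By compactness the homotopy moves little during a time step 1/(n+1), uniformly over [K];
    consecutive slices are then never antipodal, and [has_log_close] carries the logarithm from
    slice to slice. *)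
Lemma has_log_homotopy {T : Type} (d : T -> T -> R) (K : T -> Prop) (F G : R * T -> R) :
  is_metric d -> cluster_compact d K ->
  circle_map (dprod d) (fun p => 0 <= fst p <= 1 /\ K (snd p)) F G ->
  has_log d K (fun x => F (0, x)) (fun x => G (0, x)) ->
  has_log d K (fun x => F (1, x)) (fun x => G (1, x)).
Proof.
  intros Md HK [CF [CG U]] H0.
  set (I := fun p : R * T => 0 <= fst p <= 1 /\ K (snd p)) in *.
  assert (HI : cluster_compact (dprod d) I) by (apply product_compact; auto).
  pose proof (dprod_metric d Md) as MD.
  destruct (compact_uniform (dprod d) I (fun n p => forall t, 0 <= t <= 1 ->
     Rabs (fst p - t) <= / INR (S n) ->
     -1 < F (t, snd p) * F p + G (t, snd p) * G p) HI) as [n Hn].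
  - intros l Il.
    (* Each coordinate then changes by less than 1/2, so two unit vectors at squared distance at
       most 1/2 are compared; their inner product is at least 3/4. *)
    destruct (CF l Il (1 / 4)) as [r [Hr Fr]]; [lra |].
    destruct (CG l Il (1 / 4)) as [s [Hs Gs]]; [lra |].
    destruct (archimed_cor1 (Rmin r s / 2)) as [N [HN HN0]].
    { apply Rdiv_lt_0_compat; [apply Rmin_glb_lt; auto | lra]. }
    exists (Rmin r s / 2), N. split.
    { apply Rdiv_lt_0_compat; [apply Rmin_glb_lt; auto | lra]. }
    intros m p Hm Ip Hd t Ht Hpt.
    assert (/ INR (S m) <= / INR N).
    { apply Rinv_le_contravar; [apply lt_0_INR; auto | apply le_INR; lia]. }
    destruct MD as [_ [_ [D2 D3]]]. destruct Md as [_ [M1 _]].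
    assert (It : I (t, snd p)) by (split; simpl; auto; apply Ip).
    assert (Dpt : dprod d p (t, snd p) < Rmin r s / 2).
    { unfold dprod; simpl. rewrite (proj2 (M1 _ _) eq_refl). apply Rmax_lub_lt; [lra |].
      apply Rdiv_lt_0_compat; [apply Rmin_glb_lt; auto | lra]. }
    pose proof (D3 l p (t, snd p)). rewrite (D2 p l) in Hd.
    assert (0 < Rmin r s) by (apply Rmin_glb_lt; auto).
    pose proof (Rmin_l r s). pose proof (Rmin_r r s).
    pose proof (Fr p Ip ltac:(lra)) as A1. pose proof (Gs p Ip ltac:(lra)) as A2.
    pose proof (Fr _ It ltac:(lra)) as A3. pose proof (Gs _ It ltac:(lra)) as A4.
    apply Rabs_def2 in A1, A2, A3, A4.
    pose proof (U p Ip). pose proof (U _ It).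
    assert ((F p - F (t, snd p)) ^ 2 <= 1 / 4) by nra.
    assert ((G p - G (t, snd p)) ^ 2 <= 1 / 4) by nra. nra.
  - assert (Step : forall k, (k <= S n)%nat ->
      has_log d K (fun x => F (INR k / INR (S n), x)) (fun x => G (INR k / INR (S n), x))).
    { assert (P : 0 < INR (S n)) by (apply lt_0_INR; lia).
      assert (R : forall k, (k <= S n)%nat -> 0 <= INR k / INR (S n) <= 1).
      { intros k Hk. pose proof (pos_INR k). pose proof (le_INR _ _ Hk).
        split; [apply Rle_div_r; lra | apply Rle_div_l; lra]. }
      induction k; intros Hk.
      - replace (INR 0 / INR (S n)) with 0
          by (change (INR 0) with 0; unfold Rdiv; ring). auto.
      - pose proof (R k ltac:(lia)) as R1. pose proof (R (S k) Hk) as R2.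
        apply has_log_close with (fun x => F (INR k / INR (S n), x))
                                 (fun x => G (INR k / INR (S n), x)).
        + split; [| split]; [apply contR_slice; auto | apply contR_slice; auto |].
          intros x Kx. apply U; split; auto.
        + split; [| split]; [apply contR_slice; auto | apply contR_slice; auto |].
          intros x Kx. apply U; split; auto.
        + apply IHk; lia.
        + intros x Kx. apply (Hn (INR k / INR (S n), x)); [split; auto | auto |].
          cbv [fst]. rewrite (S_INR k).
          replace (INR k / INR (S n) - (INR k + 1) / INR (S n)) with (- / INR (S n)) by (field; lra).
          rewrite Rabs_Ropp, Rabs_pos_eq; [lra | left; apply Rinv_0_lt_compat; auto]. }
    specialize (Step (S n) (le_n _)).
    replace (INR (S n) / INR (S n)) with 1 in Step; auto.
    field. apply not_0_INR. lia.
Qed.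

(** * The disc and cell-like sets *)

Lemma dR2_metric : is_metric dR2.
Proof.
  unfold dR2. repeat split; intros.
  - apply sqrt_pos.
  - destruct x as [a b], y as [a' b']; simpl fst in *; simpl snd in *.
    apply sqrt_eq_0 in H; [| apply Rplus_le_le_0_compat; apply pow2_ge_0].
    pose proof (pow2_ge_0 (a - a')). pose proof (pow2_ge_0 (b - b')).
    assert (a - a' = 0) by (apply Rsqr_0_uniq; unfold Rsqr; lra).
    assert (b - b' = 0) by (apply Rsqr_0_uniq; unfold Rsqr; lra). f_equal; lra.
  - subst. replace (_ + _) with 0 by ring. apply sqrt_0.
  - f_equal. ring.
  - pose proof (triangle (fst x) (snd x) (fst z) (snd z) (fst y) (snd y)) as H.
    unfold dist_euc, Rsqr in H. simpl. rewrite !Rmult_1_r. exact H.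
Qed.

Lemma dR2_fst p q : Rabs (fst p - fst q) <= dR2 p q.
Proof.
  unfold dR2. rewrite <- sqrt_Rsqr_abs. apply sqrt_le_1_alt. unfold Rsqr.
  pose proof (pow2_ge_0 (snd p - snd q)). lra.
Qed.

Lemma dR2_snd p q : Rabs (snd p - snd q) <= dR2 p q.
Proof.
  unfold dR2. rewrite <- sqrt_Rsqr_abs. apply sqrt_le_1_alt. unfold Rsqr.
  pose proof (pow2_ge_0 (fst p - fst q)). lra.
Qed.

Lemma dR2_le p q : dR2 p q <= Rabs (fst p - fst q) + Rabs (snd p - snd q).
Proof.
  unfold dR2. pose proof (Rabs_pos (fst p - fst q)). pose proof (Rabs_pos (snd p - snd q)).
  rewrite <- (sqrt_Rsqr (Rabs (fst p - fst q) + Rabs (snd p - snd q))) by lra.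
  apply sqrt_le_1_alt. unfold Rsqr.
  rewrite <- (pow2_abs (fst p - fst q)), <- (pow2_abs (snd p - snd q)). nra.
Qed.

Lemma dR2_sq p q : dR2 p q ^ 2 = (fst p - fst q) ^ 2 + (snd p - snd q) ^ 2.
Proof.
  unfold dR2. apply pow2_sqrt. apply Rplus_le_le_0_compat; apply pow2_ge_0.
Qed.

Lemma cont_pair {T : Type} (d : T -> T -> R) S (f g : T -> R) :
  contR d S f -> contR d S g -> cont_on d dR2 S (fun x => (f x, g x)).
Proof.
  intros Hf Hg x Sx e He.
  destruct (Hf x Sx (e / 2)) as [r [Hr Fr]]; [lra |].
  destruct (Hg x Sx (e / 2)) as [s [Hs Fs]]; [lra |].
  exists (Rmin r s). split; [apply Rmin_glb_lt; auto |]. intros y Sy dy.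
  eapply Rle_lt_trans; [apply dR2_le |]. simpl.
  pose proof (Rmin_l r s). pose proof (Rmin_r r s).
  specialize (Fr y Sy ltac:(lra)). specialize (Fs y Sy ltac:(lra)). simpl in *. lra.
Qed.

Lemma cont_fst {T : Type} (d : T -> T -> R) S (f : T -> R * R) :
  cont_on d dR2 S f -> contR d S (fun x => fst (f x)).
Proof.
  intros H x Sx e He. destruct (H x Sx e He) as [r [Hr Fr]]. exists r. split; auto.
  intros y Sy dy. eapply Rle_lt_trans; [apply dR2_fst | auto].
Qed.

Lemma cont_snd {T : Type} (d : T -> T -> R) S (f : T -> R * R) :
  cont_on d dR2 S f -> contR d S (fun x => snd (f x)).
Proof.
  intros H x Sx e He. destruct (H x Sx e He) as [r [Hr Fr]]. exists r. split; auto.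
  intros y Sy dy. eapply Rle_lt_trans; [apply dR2_snd | auto].
Qed.

Lemma cont_on_id {T : Type} (d : T -> T -> R) S : cont_on d d S (fun x => x).
Proof. intros x Sx e He. exists e. auto. Qed.

Lemma contR_fst S : contR dR2 S fst.
Proof. apply (cont_fst dR2 S (fun x => x)). apply cont_on_id. Qed.

Lemma contR_snd S : contR dR2 S snd.
Proof. apply (cont_snd dR2 S (fun x => x)). apply cont_on_id. Qed.

Lemma contR_id S : contR (fun x y : R => Rabs (x - y)) S (fun t => t).
Proof. apply cont_on_id. Qed.

Lemma cdisc_compact : cluster_compact dR2 cdisc.
Proof.
  intros u Hu.
  destruct (product_compact _ _ (-1) 1 R_metric (interval_compact (-1) 1) u) as [l [_ Hl]].
  { intros n. specialize (Hu n). unfold cdisc in Hu. split; split; nra. }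
  assert (N : forall eps, 0 < eps -> forall N, exists n, (N <= n)%nat /\ dR2 (u n) l < eps).
  { intros eps He N. destruct (Hl (eps / 2) ltac:(lra) N) as [n [Hn Hd]]. exists n.
    split; auto. unfold dprod in Hd. eapply Rle_lt_trans; [apply dR2_le |].
    pose proof (Rmax_l (Rabs (fst (u n) - fst l)) (Rabs (snd (u n) - snd l))).
    pose proof (Rmax_r (Rabs (fst (u n) - fst l)) (Rabs (snd (u n) - snd l))). lra. }
  exists l. split; auto. apply Rnot_lt_le. intro h.
  assert (C : contR dR2 (fun _ => True) (fun p => fst p ^ 2 + snd p ^ 2)).
  { contR_auto; auto using contR_fst, contR_snd. }
  destruct (contR_pos_nbhd _ _ _ l 1 C I h) as [r [Hr Fr]].
  destruct (N r Hr 0%nat) as [n [_ Hn]]. specialize (Fr (u n) I).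
  destruct dR2_metric as [_ [_ [M _]]]. rewrite M in Fr. specialize (Fr Hn).
  specialize (Hu n). unfold cdisc in Hu. lra.
Qed.

Lemma cdisc_log_trivial : log_trivial dR2 cdisc.
Proof.
  intros f g [Cf [Cg U]].
  set (sc := fun p : R * (R * R) => (fst p * fst (snd p), fst p * snd (snd p))).
  set (S := fun p : R * (R * R) => 0 <= fst p <= 1 /\ cdisc (snd p)).
  assert (E : forall z : R * R, sc (1, z) = z).
  { intros [a b]. unfold sc. simpl. f_equal; ring. }
  assert (Hsc : forall p, S p -> cdisc (sc p)).
  { intros [t [a b]] [Ht Hz]. unfold cdisc, sc in *. simpl in *. nra. }
  assert (Csc : cont_on (dprod dR2) dR2 S sc).
  { assert (C1 : contR (dprod dR2) S fst).
    { intros x _ e He. exists e. split; auto. intros y _ Hd.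
      eapply Rle_lt_trans; [apply Rmax_l | apply Hd]. }
    assert (C2 : cont_on (dprod dR2) dR2 S snd).
    { intros x _ e He. exists e. split; auto. intros y _ Hd.
      eapply Rle_lt_trans; [apply Rmax_r | apply Hd]. }
    apply cont_pair; contR_auto; auto using cont_fst, cont_snd. }
  pose proof (has_log_homotopy dR2 cdisc (fun p => f (sc p)) (fun p => g (sc p))
    dR2_metric cdisc_compact) as H.
  assert (H1 : has_log dR2 cdisc (fun z => f (sc (1, z))) (fun z => g (sc (1, z)))).
  { apply H.
    - split; [| split].
      + eapply cont_on_comp; eauto.
      + eapply cont_on_comp; eauto.
      + intros p Hp. apply U. auto.
    - apply has_log_const with (f (0, 0)) (g (0, 0)).
      + apply U. unfold cdisc; simpl; lra.
      + intros z _. unfold sc; simpl. rewrite !Rmult_0_l. auto. }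
  destruct H1 as [th [C1 C2]]. exists th. split; auto.
  intros z Hz. rewrite <- (E z) at 2 4. auto.
Qed.

(** [phi] takes values in the discrete set 2 pi Z, so on a connected set it cannot move. *)
Lemma connected_cos1 {T : Type} (d : T -> T -> R) (K : T -> Prop) phi a b :
  is_metric d -> connected_set d K -> contR d K phi ->
  (forall x, K x -> cos (phi x) = 1) -> K a -> K b -> phi a = phi b.
Proof.
  intros M HK C H.
  assert (Main : forall a b, K a -> K b -> ~ phi a < phi b).
  { clear a b. intros a b Ka Kb L.
    (* A shift small enough to stay below [phi b] and within the range (0, pi], where the cosine is
       strictly less than 1. *)
    set (e := Rmin PI ((phi b - phi a) / 2)).
    pose proof PI_RGT_0.
    assert (0 < e) by (apply Rmin_glb_lt; lra).
    assert (e <= PI) by apply Rmin_l. assert (e <= (phi b - phi a) / 2) by apply Rmin_r.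
    destruct (connected_ivt d K phi a b (phi a + e)) as [x [Kx Ex]]; auto; [lra |].
    pose proof (H x Kx) as E1. rewrite Ex, cos_plus, (H a Ka) in E1.
    assert (sin (phi a) = 0).
    { pose proof (sin2_cos2 (phi a)) as S. unfold Rsqr in S. rewrite (H a Ka) in S. nra. }
    rewrite H4 in E1. assert (cos e < cos 0) by (apply cos_decreasing_1; lra).
    rewrite cos_0 in H5. lra. }
  intros Ka Kb. destruct (Rtotal_order (phi a) (phi b)) as [h | [h | h]]; auto;
    exfalso; eapply Main; [| | apply h | | | apply h]; auto.
Qed.

Lemma circle_cos_sin t : circle (cos t, sin t).
Proof. unfold circle. simpl fst; simpl snd. apply cos_sin_2. Qed.

Lemma cont_cos_sin S : cont_on (fun x y : R => Rabs (x - y)) dR2 S (fun t => (cos t, sin t)).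
Proof. apply cont_pair; contR_auto; apply contR_id. Qed.

(** Along the parametrization, the logarithm minus the angle would be constant, yet after one turn
    the point, and hence the logarithm, has returned while the angle has grown by 2 pi. *)
Lemma circle_no_log : ~ has_log dR2 circle fst snd.
Proof.
  intros [th [C H]].
  assert (E : th (cos 0, sin 0) - 0 = th (cos (2 * PI), sin (2 * PI)) - 2 * PI).
  { pose proof PI_RGT_0.
    apply (connected_cos1 (fun x y : R => Rabs (x - y)) (fun t => 0 <= t <= 2 * PI)
      (fun t => th (cos t, sin t) - t)); try lra.
    - apply R_metric.
    - apply interval_connected.
    - apply contR_minus; [| apply contR_id].
      eapply cont_on_comp; [apply cont_cos_sin | apply C |]. intros; apply circle_cos_sin.
    - intros t _. destruct (H (cos t, sin t) (circle_cos_sin t)) as [A B]. simpl in A, B.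
      rewrite cos_minus, A, B. pose proof (cos_sin_2 t). lra. }
  rewrite cos_2PI, sin_2PI, cos_0, sin_0 in E. pose proof PI_RGT_0. lra.
Qed.

(** The no-retraction theorem in a flexible form: on the circle the map need not be the identity, it
    only has to avoid the antipode. The inner product condition is the one that later constructions
    can verify. *)
Lemma no_circle_map_cdisc f g :
  circle_map dR2 cdisc f g -> (forall z, circle z -> -1 < f z * fst z + g z * snd z) -> False.
Proof.
  intros H N. apply circle_no_log.
  assert (S : forall z, circle z -> cdisc z) by (intros z; unfold circle, cdisc; lra).
  apply has_log_close with f g.
  - split; [apply contR_fst | split; [apply contR_snd | auto]].
  - destruct H as [A [B C]]. split; [| split].
    + apply contR_sub with cdisc; auto.
    + apply contR_sub with cdisc; auto.
    + auto.
  - apply has_log_sub with cdisc; auto. apply cdisc_log_trivial; auto.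
  - intros z Hz. specialize (N z Hz). lra.
Qed.

(** * The metric of the Hilbert cube and logarithms on cell-like sets *)

Lemma cube_ex_series x y : hilbert_cube x -> hilbert_cube y ->
  ex_series (fun n => Rabs (x n - y n) / 2 ^ S n).
Proof.
  intros Hx Hy. apply (ex_series_le (V := R_CompleteNormedModule)) with (fun n => (1 / 2) ^ n).
  - intros n. unfold norm; simpl. unfold abs; simpl.
    specialize (Hx n). specialize (Hy n).
    assert (P : 0 < 2 ^ n) by (apply pow_lt; lra).
    assert (A : Rabs (x n - y n) <= 1) by (apply Rabs_le; lra).
    pose proof (Rabs_pos (x n - y n)).
    assert (P2 : 0 < / 2 ^ n) by (apply Rinv_0_lt_compat; auto).
    replace (Rabs (x n - y n) / (2 * 2 ^ n)) with (Rabs (x n - y n) * / 2 ^ n / 2)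
      by (field; lra).
    rewrite Rabs_pos_eq; [| nra].
    replace ((1 / 2) ^ n) with (/ 2 ^ n); [nra |].
    unfold Rdiv. rewrite Rmult_1_l, pow_inv. reflexivity.
  - apply ex_series_geom. rewrite Rabs_pos_eq; lra.
Qed.

Lemma Series_ge_term (a : nat -> R) n : (forall k, 0 <= a k) -> ex_series a -> a n <= Series a.
Proof.
  intros P E.
  replace (a n) with (Series (fun k => if Nat.eqb k n then a n else 0)).
  - apply Series_le; auto. intros k. pose proof (P n). pose proof (P k).
    destruct (Nat.eqb_spec k n); subst; lra.
  - apply is_series_unique. clear E P.
    change (is_lim_seq (sum_n (fun k => if Nat.eqb k n then a n else 0)) (a n)).
    apply (is_lim_seq_ext_loc (fun _ => a n)).
    + exists n. intros m Hm. symmetry. unfold sum_n.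
      assert (X : forall m, sum_n_m (fun k => if Nat.eqb k n then a n else 0) 0 m =
                  if Nat.leb n m then a n else 0).
      { induction m0 as [| m0 IH].
        - rewrite sum_n_n. destruct n; reflexivity.
        - rewrite sum_n_Sm by lia. rewrite IH.
          destruct (Nat.leb_spec n m0), (Nat.eqb_spec (S m0) n), (Nat.leb_spec n (S m0));
            try lia; unfold plus; simpl; ring. }
      rewrite X. destruct (Nat.leb_spec n m); auto; lia.
    + apply is_lim_seq_const.
Qed.

Lemma dQ_metric_on : metric_on dQ hilbert_cube.
Proof.
  assert (P : forall x y n, 0 <= Rabs (x n - y n) / 2 ^ S n).
  { intros. apply Rdiv_le_0_compat; [apply Rabs_pos | apply pow_lt; lra]. }
  assert (Z : forall x y, hilbert_cube x -> hilbert_cube y -> forall n,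
            Rabs (x n - y n) / 2 ^ S n <= dQ x y).
  { intros x y Hx Hy n. apply (Series_ge_term (fun n => Rabs (x n - y n) / 2 ^ S n));
      auto using cube_ex_series. }
  split; [| split; [| split]].
  - intros x y Hx Hy. eapply Rle_trans; [apply (P x y 0%nat) | apply Z; auto].
  - intros x y Hx Hy. split.
    + intros H. apply functional_extensionality. intros n.
      pose proof (Z x y Hx Hy n) as L. rewrite H in L.
      assert (P2 : 0 < 2 ^ S n) by (apply pow_lt; lra).
      apply Rle_div_l in L; auto. rewrite Rmult_0_l in L.
      pose proof (Rabs_pos (x n - y n)).
      destruct (Req_dec (x n - y n) 0); [lra |].
      pose proof (Rabs_pos_lt _ H1). lra.
    + intros ->. unfold dQ. apply is_series_unique.
      change (is_lim_seq (sum_n (fun n => Rabs (y n - y n) / 2 ^ S n)) 0).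
      apply (is_lim_seq_ext (fun _ => 0)).
      * intros n. transitivity (sum_n (fun _ => 0) n).
        -- rewrite sum_n_const. ring.
        -- apply sum_n_ext. intros k. rewrite Rminus_diag, Rabs_R0. unfold Rdiv.
           rewrite Rmult_0_l. reflexivity.
      * apply is_lim_seq_const.
  - intros x y Hx Hy. unfold dQ. apply Series_ext. intros n. rewrite Rabs_minus_sym. auto.
  - intros x y z Hx Hy Hz. unfold dQ. rewrite <- Series_plus by auto using cube_ex_series.
    apply Series_le.
    + intros n. split; auto. unfold Rdiv. rewrite <- Rmult_plus_distr_r.
      apply Rmult_le_compat_r; [left; apply Rinv_0_lt_compat, pow_lt; lra |].
      replace (x n - z n) with ((x n - y n) + (y n - z n)) by ring. apply Rabs_triang.
    + apply (ex_series_plus (V := R_CompleteNormedModule)); auto using cube_ex_series.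
Qed.

Lemma cluster_compact_image {T1 T2 : Type} (d1 : T1 -> T1 -> R) (d2 : T2 -> T2 -> R)
    (Y : T2 -> Prop) (K : T1 -> Prop) (f : T1 -> T2) :
  is_metric d1 -> metric_on d2 Y -> (forall x, K x -> Y (f x)) ->
  cluster_compact d1 K -> cont_on d1 d2 K f ->
  cluster_compact d2 (fun y => exists x, K x /\ f x = y).
Proof.
  intros [_ [_ [M2 _]]] [_ [_ [N2 _]]] KY HK Cf u Hu.
  set (p := fun n => proj1_sig (constructive_indefinite_description _ (Hu n))).
  assert (Hp : forall n, K (p n) /\ f (p n) = u n).
  { intros n. unfold p. destruct (constructive_indefinite_description _ (Hu n)); auto. }
  destruct (HK p) as [l [Kl Hl]]; [intros; apply Hp |].
  exists (f l). split; [eauto |]. intros eps He N.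
  destruct (Cf l Kl eps He) as [r [Hr Fr]]. destruct (Hl r Hr N) as [n [Hn Hd]].
  exists n. split; auto. destruct (Hp n) as [Kp <-]. rewrite N2; auto. apply Fr; auto.
  rewrite M2; auto.
Qed.

(** Tietze extends both coordinates of a circle map from the embedded copy of [K] to the cube. The
    extension is nonzero near that copy, where it can be normalized, and composing with a
    contraction inside this neighbourhood gives a homotopy from the map to a constant. *)
Lemma cell_like_log_trivial {T : Type} (d : T -> T -> R) (K : T -> Prop) :
  is_metric d -> cell_like d K -> log_trivial d K.
Proof.
  intros Md [HK [e [He [Ecube Hnull]]]] f g [Cf [Cg U]].
  apply compact_set_cluster in HK.
  destruct (classic (exists x, K x)) as [Kne | Kem].
  2: { exists (fun _ => 0). split; [apply contR_const |]. intros x Kx. exfalso; eauto. }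
  destruct (homeo_inverse _ _ _ _ _ He Kne) as [inv [Hinv [Hie Cinv]]].
  destruct He as [_ [_ [_ [E4 _]]]]. destruct Kne as [k0 K0].
  pose proof dQ_metric_on as MQ.
  set (eK := fun z => exists x, K x /\ e x = z) in *.
  assert (eKY : forall z, eK z -> hilbert_cube z).
  { intros z [x [Kx <-]]. auto. }
  assert (CeK : cluster_compact dQ eK).
  { apply (cluster_compact_image d dQ hilbert_cube); auto. }
  assert (Ext : forall f, contR d K f ->
     exists F, contR dQ hilbert_cube F /\ forall x, K x -> F (e x) = f x).
  { clear f g Cf Cg U. intros f Cf.
    destruct (tietze dQ hilbert_cube eK (fun z => f (inv z)) MQ eKY CeK) as [F [CF EF]].
    - apply (cont_on_comp _ d _ _ K); auto. intros; apply Hinv; auto.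
    - exists F. split; auto. intros x Kx. rewrite EF; [| exists x; auto].
      rewrite Hie; auto. }
  destruct (Ext f Cf) as [F [CF EF]]. destruct (Ext g Cg) as [G [CG EG]].
  set (Q := fun z => F z ^ 2 + G z ^ 2).
  assert (CQ : contR dQ hilbert_cube Q) by (unfold Q; contR_auto).
  (* The neighbourhood where the extended pair does not vanish and so can be divided by its norm. *)
  destruct (Hnull (fun z => hilbert_cube z /\ 0 < Q z)) as [H [c [CH [H0 [H1 HU]]]]].
  - split; [tauto |]. intros x [Hx Qx].
    destruct (contR_pos_nbhd _ _ _ x 0 CQ Hx Qx) as [r [Hr Fr]]. exists r. auto.
  - intros x Kx. split; auto. unfold Q. rewrite EF, EG, U; auto; lra.
  (* Time is reversed because [has_log_homotopy] carries logarithms from time 0 to time 1, and the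
     constant end, which has one, is at time 1 of [H]. *)
  - set (rev := fun p : R * T => H (1 - fst p, snd p)).
    set (S := fun p : R * T => 0 <= fst p <= 1 /\ K (snd p)) in *.
    assert (Crev : cont_on (dprod d) dQ S rev).
    { intros [t x] [Ht Kx] eps He. simpl in Ht, Kx.
      destruct (CH (1 - t, x)) with (eps := eps) as [r [Hr Fr]]; auto.
      { split; simpl; auto; lra. }
      exists r. split; auto. intros [s y] [Hs Ky] Hd. simpl in Hs, Ky.
      apply Fr; [split; simpl; auto; lra |].
      unfold dprod in *. simpl in *.
      replace (1 - t - (1 - s)) with (- (t - s)) by ring. rewrite Rabs_Ropp. auto. }
    assert (Hrev : forall p, S p -> hilbert_cube (rev p) /\ 0 < Q (rev p)).
    { intros [t x] [Ht Kx]. apply HU; simpl in *; auto. lra. }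
    assert (CR : forall F, contR dQ hilbert_cube F -> contR (dprod d) S (fun p => F (rev p))).
    { intros F' CF'. apply (cont_on_comp _ dQ _ _ hilbert_cube); auto.
      intros p Hp; apply Hrev; auto. }
    assert (L : has_log d K (fun x => F (rev (1, x)) / sqrt (Q (rev (1, x))))
                            (fun x => G (rev (1, x)) / sqrt (Q (rev (1, x))))).
    { apply (has_log_homotopy d K (fun p => F (rev p) / sqrt (Q (rev p)))
                                  (fun p => G (rev p) / sqrt (Q (rev p)))); auto.
      - assert (NZ : forall p, S p -> sqrt (Q (rev p)) <> 0).
        { intros p Hp. pose proof (sqrt_lt_R0 _ (proj2 (Hrev p Hp))). lra. }
        split; [| split].
        + apply contR_div; auto. apply (contR_sqrt _ _ (fun p => Q (rev p))); auto.
        + apply contR_div; auto. apply (contR_sqrt _ _ (fun p => Q (rev p))); auto.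
        + intros p Hp. specialize (NZ p Hp). destruct (Hrev p Hp) as [_ Qp].
          replace ((F (rev p) / sqrt (Q (rev p))) ^ 2 + (G (rev p) / sqrt (Q (rev p))) ^ 2)
            with (Q (rev p) / (sqrt (Q (rev p)) * sqrt (Q (rev p)))).
          * rewrite sqrt_sqrt; [field; lra | lra].
          * unfold Q at 1. field. auto.
      - apply has_log_const with (F c / sqrt (Q c)) (G c / sqrt (Q c)).
        + destruct (HU 1 k0) as [_ Qc]; auto; [lra |]. rewrite H1 in Qc; auto.
          assert (sqrt (Q c) <> 0) by (pose proof (sqrt_lt_R0 _ Qc); lra).
          replace ((F c / sqrt (Q c)) ^ 2 + (G c / sqrt (Q c)) ^ 2)
            with (Q c / (sqrt (Q c) * sqrt (Q c))) by (unfold Q at 1; field; auto).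
          rewrite sqrt_sqrt; [field; lra | lra].
        + intros x Kx. unfold rev. simpl. rewrite Rminus_0_r, H1; auto. }
    destruct L as [th [Cth Hth]]. exists th. split; auto. intros x Kx.
    destruct (Hth x Kx) as [A B]. rewrite A, B. unfold rev. simpl.
    replace (1 - 1) with 0 by ring. rewrite H0 by auto.
    assert (QE : Q (e x) = 1) by (unfold Q; rewrite EF, EG, U; auto).
    rewrite QE, sqrt_1, EF, EG; auto. split; field.
Qed.

(** * Compact sets with log-trivial components, crossing arcs *)

Inductive eps_chain {T : Type} (d : T -> T -> R) (A : T -> Prop) (eps : R) (x : T) : T -> Prop :=
| eps_chain_refl : A x -> eps_chain d A eps x x
| eps_chain_step y z : eps_chain d A eps x y -> A z -> d y z < eps -> eps_chain d A eps x z.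

Lemma eps_chain_in {T : Type} (d : T -> T -> R) A eps x y : eps_chain d A eps x y -> A x /\ A y.
Proof. induction 1; tauto. Qed.

Lemma eps_chain_trans {T : Type} (d : T -> T -> R) A eps x y z :
  eps_chain d A eps x y -> eps_chain d A eps y z -> eps_chain d A eps x z.
Proof. intros H1 H2. induction H2; auto. eapply eps_chain_step; eauto. Qed.

Lemma eps_chain_sym {T : Type} (d : T -> T -> R) A eps x y :
  is_metric d -> eps_chain d A eps x y -> eps_chain d A eps y x.
Proof.
  intros [_ [_ [M _]]] H. induction H as [| y z H IH Hz Hd]; [constructor; auto |].
  apply eps_chain_trans with y; auto. eapply eps_chain_step; [apply eps_chain_refl | |]; auto.
  - apply (eps_chain_in _ _ _ _ _ H).
  - rewrite M. auto.
Qed.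

Lemma eps_chain_cross {T : Type} (d : T -> T -> R) A eps (U : T -> Prop) x y :
  eps_chain d A eps x y -> U x -> ~ U y ->
  exists a b, A a /\ A b /\ d a b < eps /\ U a /\ ~ U b.
Proof.
  induction 1 as [| y z H IH Hz Hd]; intros Ux NU; [tauto |].
  destruct (classic (U y)) as [Uy | NUy]; auto.
  exists y, z. repeat split; auto. apply (eps_chain_in _ _ _ _ _ H).
Qed.

(** Distinct chain classes are at distance at least [eps], so logarithms chosen independently on
    them form one continuous function. *)
Lemma has_log_eps_class {T : Type} (d : T -> T -> R) (A : T -> Prop) eps f g :
  is_metric d -> 0 < eps ->
  (forall x, A x -> has_log d (eps_chain d A eps x) f g) -> has_log d A f g.
Proof.
  intros Md He H.
  (* The choice depends on the class as a predicate, so that, by extensionality, all points of a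
     class receive the same logarithm. *)
  set (th := fun P : T -> Prop => epsilon (inhabits (fun _ : T => 0))
    (fun th => contR d P th /\ forall x, P x -> cos (th x) = f x /\ sin (th x) = g x)).
  assert (Hth : forall x, A x -> contR d (eps_chain d A eps x) (th (eps_chain d A eps x)) /\
    forall y, eps_chain d A eps x y -> cos (th (eps_chain d A eps x) y) = f y /\
                                       sin (th (eps_chain d A eps x) y) = g y).
  { intros x Ax. apply (epsilon_spec (inhabits (fun _ : T => 0)) (fun th =>
      contR d (eps_chain d A eps x) th /\ forall y, eps_chain d A eps x y ->
        cos (th y) = f y /\ sin (th y) = g y)). apply H; auto. }
  exists (fun x => th (eps_chain d A eps x) x). split.
  - intros x Ax e Hpe. destruct (Hth x Ax) as [C _].
    destruct (C x (eps_chain_refl d A eps x Ax) e Hpe) as [r [Hr Fr]].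
    exists (Rmin r eps). split; [apply Rmin_glb_lt; auto |]. intros y Ay dy.
    pose proof (Rmin_l r eps). pose proof (Rmin_r r eps).
    assert (Exy : eps_chain d A eps x y).
    { eapply eps_chain_step; [apply eps_chain_refl; auto | auto | lra]. }
    replace (eps_chain d A eps y) with (eps_chain d A eps x).
    + apply Fr; auto. lra.
    + apply functional_extensionality. intros z. apply propositional_extensionality.
      split; intros; eapply eps_chain_trans; eauto using eps_chain_sym.
  - intros x Ax. apply Hth; auto. apply eps_chain_refl; auto.
Qed.

Definition bad_class {T : Type} (d : T -> T -> R) f g (A : T -> Prop) eps (x : T) : Prop :=
  A x /\ ~ has_log d (eps_chain d A eps x) f g.

(** A nested sequence in which stage [S m] is a chain class of stage [m], at scale 1/(m+1), on which
    the map has no logarithm. The choice by [epsilon] is meaningful as long as such a class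
    exists. *)
Fixpoint bad_stage {T : Type} (d : T -> T -> R) f g (i : inhabited T) (K : T -> Prop) (n : nat) :
    T -> Prop :=
  match n with
  | O => K
  | S m => eps_chain d (bad_stage d f g i K m) (/ INR (S m))
             (epsilon i (bad_class d f g (bad_stage d f g i K m) (/ INR (S m))))
  end.

(** If a map has no logarithm on [K], some chain class has none, inside it some finer class has
    none, and so on. The intersection [W] of these stages is connected, being chained at every
    scale, and still has no logarithm; neither has the component containing it. *)
Lemma log_trivial_components {T : Type} (d : T -> T -> R) (K : T -> Prop) :
  is_metric d -> cluster_compact d K ->
  (forall C, component_of d K C -> log_trivial d C) -> log_trivial d K.
Proof.
  intros Md HK HC f g Hfg. apply NNPP. intro NL.
  destruct (classic (exists x, K x)) as [[k0 K0] | Kem].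
  2: { apply NL. exists (fun _ => 0). split; [apply contR_const |].
       intros x Kx. exfalso; eauto. }
  pose proof Md as [M0 [M1 [M2 M3]]].
  set (A := bad_stage d f g (inhabits k0) K).
  set (x0 := fun m => epsilon (inhabits k0) (bad_class d f g (A m) (/ INR (S m)))).
  assert (AS : forall m, A (S m) = eps_chain d (A m) (/ INR (S m)) (x0 m)) by reflexivity.
  assert (IP : forall m, 0 < / INR (S m)).
  { intros. apply Rinv_0_lt_compat, lt_0_INR. lia. }
  assert (BS : forall m, ~ has_log d (A m) f g ->
     bad_class d f g (A m) (/ INR (S m)) (x0 m)).
  { intros m Hm. apply epsilon_spec. apply NNPP. intro N. apply Hm.
    apply has_log_eps_class with (/ INR (S m)); auto.
    intros x Ax. apply NNPP. intro. apply N. exists x. split; auto. }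
  assert (ANL : forall m, ~ has_log d (A m) f g).
  { induction m; auto. rewrite AS. apply (BS m IHm). }
  assert (Asub : forall m x, A (S m) x -> A m x).
  { intros m x Hx. rewrite AS in Hx. apply (eps_chain_in _ _ _ _ _ Hx). }
  assert (Adec : forall m n x, (m <= n)%nat -> A n x -> A m x).
  { intros m n x Hmn. induction Hmn; auto. }
  assert (Acl : forall m, closed_in d (fun _ => True) (A m)).
  { induction m.
    - apply compact_closed; auto. apply is_metric_on; auto.
    - intros x _ Hx. assert (Ax : A m x).
      { apply IHm; auto. intros e He. destruct (Hx e He) as [a [Ha1 Ha2]]. eauto. }
      rewrite AS in *. destruct (Hx _ (IP m)) as [a [Ha1 Ha2]].
      eapply eps_chain_step; [apply Ha1 | auto |]. rewrite M2. auto. }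
  set (W := fun x => forall m, A m x).
  assert (WK : forall x, W x -> K x) by (intros x Hx; apply (Hx 0%nat)).
  assert (Wcl : closed_in d K W).
  { intros x Kx Hx m. apply Acl; auto. intros e He.
    destruct (Hx e He) as [a [Ha1 Ha2]]. exists a. auto. }
  assert (WC : cluster_compact d W) by (apply closed_in_compact with K; auto).
  assert (Out : forall l, ~ W l -> exists eps N, 0 < eps /\
     forall n x, (N <= n)%nat -> d x l < eps -> ~ A n x).
  { intros l NW. apply not_all_ex_not in NW. destruct NW as [N NA].
    destruct (not_closed_in d (fun _ => True) (A N) l (Acl N) I NA) as [r [Hr Fr]].
    exists r, N. split; auto. intros n x Hn Hd An.
    specialize (Fr x (Adec _ _ _ Hn An)). rewrite M2 in Fr. lra. }
  (* Tietze would extend a logarithm on [W] to a function whose exponential is not antipodal to the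
     map near [W]. By compactness late stages lie there, and would have a logarithm. *)
  assert (WNL : ~ has_log d W f g).
  { intros [th [Cth Hth]].
    destruct (tietze d (fun _ => True) W th (is_metric_on _ _ Md) (fun _ _ => I) WC Cth)
      as [Th [CT ET]].
    destruct Hfg as [Cf [Cg U]].
    destruct (compact_uniform d K (fun n x => A n x ->
       -1 < f x * cos (Th x) + g x * sin (Th x)) HK) as [n Hn].
    - intros l Kl. destruct (classic (W l)) as [Wl | NW].
      + assert (CQ : contR d K (fun x => f x * cos (Th x) + g x * sin (Th x))).
        { assert (contR d K Th) by (apply contR_sub with (fun _ => True); auto). contR_auto. }
        destruct (contR_pos_nbhd d K _ l (-1) CQ Kl) as [r [Hr Fr]].
        { rewrite ET by auto. destruct (Hth l Wl) as [E1 E2]. rewrite E1, E2.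
          specialize (U l Kl). lra. }
        exists r, 0%nat. split; auto. intros n x _ Kx Hd _. apply Fr; auto. rewrite M2; auto.
      + destruct (Out l NW) as [e [N [He HN]]]. exists e, N. split; auto.
        intros n x Hn Kx Hd An. exfalso. eapply HN; eauto.
    - apply (ANL n).
      assert (AK : forall x, A n x -> K x) by (intros x; apply (Adec 0%nat n x); lia).
      assert (contR d (A n) Th) by (apply contR_sub with (fun _ => True); auto).
      apply has_log_close with (fun x => cos (Th x)) (fun x => sin (Th x)).
      + split; [| split]; auto; apply contR_sub with K; auto.
      + split; [| split]; try (contR_auto; fail). intros; apply cos_sin_2.
      + exists Th. auto.
      + intros x Ax. apply Hn; auto. }
  (* Chains joining the two sides of a separation have to jump out of [U] by steps tending to 0. The
     jumps cannot accumulate at a point of [W], which is interior to [U] or to [V], nor elsewhere,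
     where late stages are absent. *)
  assert (WCon : connected_set d W).
  { intro Sep.
    destruct (connected_disjoint d W Md (fun F => F Sep))
      as [U [V [OU [OV [Cov [[a [Wa Ua]] [[b [Wb Vb]] Dis]]]]]]].
    destruct (compact_uniform d K (fun n y => ~ (A n y /\ U y /\
      exists z, A n z /\ ~ U z /\ d y z < / INR (S n))) HK) as [n Hn].
    - intros l Kl. destruct (classic (W l)) as [Wl | NW].
      + destruct (Cov l Wl) as [Ul | Vl].
        * destruct (OU l Ul) as [r [Hr Fr]]. destruct (inv_INR_lt (r / 2)) as [N HN]; [lra |].
          exists (r / 2), N. split; [lra |]. intros n y Hn Ky Hd [_ [_ [z [_ [NU Hz]]]]].
          apply NU, Fr. specialize (HN n Hn). pose proof (M3 l y z). rewrite (M2 l y) in H.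
          lra.
        * destruct (OV l Vl) as [r [Hr Fr]]. exists r, 0%nat. split; auto.
          intros n y Hn Ky Hd [_ [Uy _]]. apply (Dis y); auto. apply Fr. rewrite M2; auto.
      + destruct (Out l NW) as [e [N [He HN]]]. exists e, N. split; auto.
        intros n x Hn Kx Hd [An _]. eapply HN; eauto.
    - assert (E : eps_chain d (A n) (/ INR (S n)) a b).
      { pose proof (Wa (S n)) as Ha. pose proof (Wb (S n)) as Hb. rewrite AS in Ha, Hb.
        eapply eps_chain_trans; [apply eps_chain_sym |]; eauto. }
      destruct (eps_chain_cross d _ _ U a b E Ua) as [y [z [Ay [Az [Hd [Uy NUz]]]]]].
      { intro Ub. eauto. }
      apply (Hn y); [apply (Adec 0%nat n); auto; lia |]. split; auto. split; auto.
      exists z. auto. }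
  assert (Wne : exists x, W x).
  { apply NNPP. intro N. apply WNL. exists (fun _ => 0). split; [apply contR_const |].
    intros x Wx. exfalso; eauto. }
  destruct Wne as [w Ww].
  (* The component of [K] containing [W], as the union of all connected sets between them. *)
  set (C := fun x => exists B, connected_set d B /\ (forall y, W y -> B y) /\
                     (forall y, B y -> K y) /\ B x).
  assert (WC' : forall x, W x -> C x) by (intros x Wx; exists W; auto).
  assert (CK : forall x, C x -> K x) by (intros x [B [_ [_ [H1 H2]]]]; auto).
  assert (Comp : component_of d K C).
  { split; [exists w; auto |]. split; auto. split.
    - apply connected_star with w. intros x [B [B1 [B2 [B3 B4]]]]. exists B.
      repeat split; auto. intros y By. exists B. auto.
    - intros B B1 B2 B3 x Bx. exists B. auto. }
  apply WNL. apply has_log_sub with C; auto. apply (HC C Comp).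
  apply circle_map_sub with K; auto.
Qed.

(** * Crossing of two arcs with interlaced endpoints *)

Definition clamp01 (u : R) : R := Rmax 0 (Rmin 1 u).

Lemma clamp01_range u : 0 <= clamp01 u <= 1.
Proof. unfold clamp01, Rmax, Rmin. repeat destruct Rle_dec; lra. Qed.

Lemma clamp01_le0 u : u <= 0 -> clamp01 u = 0.
Proof. intros. unfold clamp01, Rmax, Rmin. repeat destruct Rle_dec; lra. Qed.

Lemma clamp01_ge1 u : 1 <= u -> clamp01 u = 1.
Proof. intros. unfold clamp01, Rmax, Rmin. repeat destruct Rle_dec; lra. Qed.

Lemma contR_clamp01 {T : Type} (d : T -> T -> R) S f :
  contR d S f -> contR d S (fun x => clamp01 (f x)).
Proof.
  intros H x Sx e He. destruct (H x Sx e He) as [r [Hr Fr]]. exists r. split; auto.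
  intros y Sy dy. eapply Rle_lt_trans; [| apply (Fr y Sy dy)].
  unfold clamp01, Rmax, Rmin. repeat destruct Rle_dec; unfold Rabs; repeat destruct Rcase_abs; lra.
Qed.

(** Equality in the Cauchy-Schwarz inequality: the squared norm of (f,g) + s(a,b) is at most 0. *)
Lemma antiparallel f g a b s : a ^ 2 + b ^ 2 = 1 -> f ^ 2 + g ^ 2 = s ^ 2 -> 0 < s ->
  f * a + g * b <= - s -> f = - s * a /\ g = - s * b.
Proof.
  intros H1 H2 Hs H.
  assert (E : (f + s * a) ^ 2 + (g + s * b) ^ 2 = s ^ 2 + 2 * s * (f * a + g * b) + s ^ 2).
  { transitivity (f ^ 2 + g ^ 2 + 2 * s * (f * a + g * b) + s ^ 2 * (a ^ 2 + b ^ 2)); [ring |].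
    rewrite H1, H2. ring. }
  assert (s * (f * a + g * b) <= s * - s) by (apply Rmult_le_compat_l; lra).
  pose proof (pow2_ge_0 (f + s * a)). pose proof (pow2_ge_0 (g + s * b)).
  split.
  - assert (f + s * a = 0); [| lra]. apply Rsqr_0_uniq. unfold Rsqr. lra.
  - assert (g + s * b = 0); [| lra]. apply Rsqr_0_uniq. unfold Rsqr. lra.
Qed.

(* For points [z] of the disc, [fst z / (1 - k * snd z)] is the coordinate along the pencil of
   lines through the pole of the chord from [(-dl,k)] to [(dl,k)]; it is extremal at the two ends. *)
Lemma arcs_cross dl k (ga al : R -> R * R) :
  0 < dl -> dl ^ 2 + k ^ 2 = 1 ->
  cont_on (fun x y : R => Rabs (x - y)) dR2 (fun t => 0 <= t <= 1) ga ->
  cont_on (fun x y : R => Rabs (x - y)) dR2 (fun t => 0 <= t <= 1) al ->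
  (forall t, 0 <= t <= 1 -> cdisc (ga t)) -> (forall t, 0 <= t <= 1 -> cdisc (al t)) ->
  ga 0 = (- dl, k) -> ga 1 = (dl, k) -> al 0 = (0, 1) -> al 1 = (0, -1) ->
  exists s t, 0 <= s <= 1 /\ 0 <= t <= 1 /\ ga s = al t.
Proof.
  intros Hdl Hk Cga Cal Dga Dal G0 G1 A0 A1. apply NNPP. intro N.
  (* The two coordinates of a disc point run through the two arcs. With the shift by 1/2 and the
     clamping, one of the arcs is at an endpoint whenever a coordinate is at least 1/2 in absolute
     value, which happens at every point of the circle. If the arcs do not meet, the difference
     (f,g), with [f] cross-multiplied to avoid a quotient, is nowhere zero and gives a circle map on
     the disc. *)
  set (G := fun p : R * R => ga (clamp01 (fst p + 1 / 2))).
  set (A := fun p : R * R => al (clamp01 (snd p + 1 / 2))).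
  assert (DG : forall p, cdisc (G p)) by (intros; apply Dga, clamp01_range).
  assert (DA : forall p, cdisc (A p)) by (intros; apply Dal, clamp01_range).
  set (f := fun p => fst (G p) * (1 - k * snd (A p)) - fst (A p) * (1 - k * snd (G p))).
  set (g := fun p => snd (G p) - snd (A p)).
  set (n := fun p => sqrt (f p ^ 2 + g p ^ 2)).
  assert (CG : cont_on dR2 dR2 cdisc G).
  { apply (cont_on_comp dR2 (fun x y : R => Rabs (x - y)) dR2 cdisc (fun t => 0 <= t <= 1)
      (fun p => clamp01 (fst p + 1 / 2)) ga); auto.
    - apply (contR_clamp01 dR2 cdisc (fun p => fst p + 1 / 2)). contR_auto. apply contR_fst.
    - intros; apply clamp01_range. }
  assert (CA : cont_on dR2 dR2 cdisc A).
  { apply (cont_on_comp dR2 (fun x y : R => Rabs (x - y)) dR2 cdisc (fun t => 0 <= t <= 1)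
      (fun p => clamp01 (snd p + 1 / 2)) al); auto.
    - apply (contR_clamp01 dR2 cdisc (fun p => snd p + 1 / 2)). contR_auto. apply contR_snd.
    - intros; apply clamp01_range. }
  assert (Cf : contR dR2 cdisc f) by (unfold f; contR_auto; auto using cont_fst, cont_snd).
  assert (Cg : contR dR2 cdisc g) by (unfold g; contR_auto; auto using cont_fst, cont_snd).
  assert (Hpos : forall p, 0 < f p ^ 2 + g p ^ 2).
  { intros p. destruct (Rlt_le_dec 0 (f p ^ 2 + g p ^ 2)) as [h | h]; auto. exfalso.
    pose proof (pow2_ge_0 (f p)). pose proof (pow2_ge_0 (g p)).
    assert (F0 : f p = 0) by (apply Rsqr_0_uniq; unfold Rsqr; lra).
    assert (E0 : g p = 0) by (apply Rsqr_0_uniq; unfold Rsqr; lra).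
    apply N. exists (clamp01 (fst p + 1 / 2)), (clamp01 (snd p + 1 / 2)).
    split; [apply clamp01_range | split; [apply clamp01_range |]].
    fold (G p) (A p). unfold f, g in F0, E0. pose proof (DG p) as D1.
    destruct (G p) as [x y], (A p) as [x' y']. unfold cdisc in D1. simpl in *.
    assert (y = y') by lra. subst y'. f_equal.
    assert (P : 0 < 1 - k * y) by nra.
    apply Rmult_eq_reg_r with (1 - k * y); lra. }
  assert (Hn : forall p, 0 < n p) by (intros; apply sqrt_lt_R0; auto).
  assert (Hn2 : forall p, f p ^ 2 + g p ^ 2 = n p ^ 2).
  { intros p. unfold n. rewrite pow2_sqrt; auto. left; auto. }
  assert (Cn : contR dR2 cdisc n) by (unfold n; contR_auto).
  apply (no_circle_map_cdisc (fun p => f p / n p) (fun p => g p / n p)).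
  - split; [| split].
    + contR_auto. intros p _. specialize (Hn p). lra.
    + contR_auto. intros p _. specialize (Hn p). lra.
    + intros p _. specialize (Hn p).
      replace ((f p / n p) ^ 2 + (g p / n p) ^ 2) with ((f p ^ 2 + g p ^ 2) / n p ^ 2)
        by (field; lra).
      rewrite Hn2. field. lra.
  - intros p Hp. specialize (Hn p). apply Rnot_le_lt. intro L.
    assert (L' : f p * fst p + g p * snd p <= - n p).
    { replace (f p / n p * fst p + g p / n p * snd p)
        with ((f p * fst p + g p * snd p) / n p) in L by (field; lra).
      apply Rle_div_l in L; lra. }
    destruct (antiparallel (f p) (g p) (fst p) (snd p) (n p)) as [F1 F2]; auto.
    pose proof (DG p) as D1. pose proof (DA p) as D2.
    destruct p as [s t]. unfold circle in Hp. simpl fst in *; simpl snd in *.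
    assert (Hst : s <= - (1 / 2) \/ 1 / 2 <= s \/ t <= - (1 / 2) \/ 1 / 2 <= t).
    { destruct (Rle_lt_dec s (- (1 / 2))); auto. destruct (Rle_lt_dec (1 / 2) s); auto.
      destruct (Rle_lt_dec t (- (1 / 2))); auto. destruct (Rle_lt_dec (1 / 2) t); auto.
      exfalso. nra. }
    set (q := n (s, t)) in *.
    (* On each side of the square the component of (f,g) belonging to that side has weakly the same
       sign as the coordinate, by extremality of the endpoint; an antipodal vector would have the
       opposite strict sign. *)
    destruct Hst as [h | [h | [h | h]]].
    + assert (E : G (s, t) = (- dl, k)).
      { unfold G; simpl fst. rewrite clamp01_le0; auto. lra. }
      assert (0 < f (s, t)) by (rewrite F1; nra).
      unfold f in H. rewrite E in H. destruct (A (s, t)) as [x y]. unfold cdisc in D2. simpl in *.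
      pose proof (pow2_ge_0 (dl + x)). pose proof (pow2_ge_0 (k - y)).
      assert (0 <= dl * (1 - k * y + dl * x)) by (apply Rmult_le_pos; lra).
      replace (1 - k * k) with (dl * dl) in H by lra. lra.
    + assert (E : G (s, t) = (dl, k)).
      { unfold G; simpl fst. rewrite clamp01_ge1; auto. lra. }
      assert (f (s, t) < 0) by (rewrite F1; nra).
      unfold f in H. rewrite E in H. destruct (A (s, t)) as [x y]. unfold cdisc in D2. simpl in *.
      pose proof (pow2_ge_0 (dl - x)). pose proof (pow2_ge_0 (k - y)).
      assert (0 <= dl * (1 - k * y - dl * x)) by (apply Rmult_le_pos; lra).
      replace (1 - k * k) with (dl * dl) in H by lra. lra.
    + assert (E : A (s, t) = (0, 1)).
      { unfold A; simpl snd. rewrite clamp01_le0; auto. lra. }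
      assert (0 < g (s, t)) by (rewrite F2; nra).
      unfold g in H. rewrite E in H. destruct (G (s, t)) as [x y]. unfold cdisc in D1. simpl in *.
      nra.
    + assert (E : A (s, t) = (0, -1)).
      { unfold A; simpl snd. rewrite clamp01_ge1; auto. lra. }
      assert (g (s, t) < 0) by (rewrite F2; nra).
      unfold g in H. rewrite E in H. destruct (G (s, t)) as [x y]. unfold cdisc in D1. simpl in *.
      nra.
Qed.

(** * BiLipschitz arcs *)

(** Iterated midpoints, placed at time k/2^n between [x] and [y]. At level 0 every index past the
    end gives [y], which frees the Lipschitz estimates from range conditions on [k]. *)
Fixpoint dyadic {T : Type} (mid : T -> T -> T) (x y : T) (n k : nat) : T :=
  match n with
  | O => match k with O => x | S _ => y end
  | S m => if Nat.even k then dyadic mid x y m (Nat.div2 k)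
           else mid (dyadic mid x y m (Nat.div2 k)) (dyadic mid x y m (S (Nat.div2 k)))
  end.

Lemma dyadic_double {T : Type} (mid : T -> T -> T) x y n k :
  dyadic mid x y (S n) (2 * k) = dyadic mid x y n k.
Proof.
  cbn [dyadic]. rewrite Nat.div2_double.
  replace (Nat.even (2 * k)) with true; auto. symmetry. apply Nat.even_spec. exists k. auto.
Qed.

Lemma dyadic_odd {T : Type} (mid : T -> T -> T) x y n k :
  dyadic mid x y (S n) (S (2 * k)) = mid (dyadic mid x y n k) (dyadic mid x y n (S k)).
Proof.
  cbn [dyadic]. rewrite Nat.div2_succ_double.
  replace (Nat.even (S (2 * k))) with false; auto. symmetry.
  rewrite Nat.even_succ. rewrite <- Nat.negb_even.
  replace (Nat.even (2 * k)) with true; auto. symmetry. apply Nat.even_spec. exists k. auto.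
Qed.

Lemma dyadic_scale {T : Type} (mid : T -> T -> T) x y n i k :
  dyadic mid x y (i + n) (2 ^ i * k) = dyadic mid x y n k.
Proof.
  induction i as [| i IH].
  - simpl. f_equal. lia.
  - replace (2 ^ S i * k)%nat with (2 * (2 ^ i * k))%nat by (simpl; lia).
    rewrite Nat.add_succ_l, dyadic_double. auto.
Qed.

Lemma dyadic_step {T : Type} (d : T -> T -> R) (mid : T -> T -> T) x y n k :
  is_metric d ->
  (forall a b, d a (mid a b) <= d a b / 2 /\ d (mid a b) b <= d a b / 2) ->
  d (dyadic mid x y n k) (dyadic mid x y n (S k)) <= d x y / 2 ^ n.
Proof.
  intros [M0 [M1 [M2 M3]]] Hm. revert k. induction n as [| n IH]; intros k.
  - simpl. unfold Rdiv. rewrite Rinv_1, Rmult_1_r. destruct k; [lra |].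
    rewrite (proj2 (M1 y y) eq_refl). apply M0.
  - assert (E : d x y / 2 ^ S n = d x y / 2 ^ n / 2).
    { assert (2 ^ n <> 0) by (apply pow_nonzero; lra). simpl. field. auto. }
    rewrite E. destruct (Nat.Even_or_Odd k) as [[j ->] | [j ->]].
    + rewrite dyadic_double, dyadic_odd. specialize (IH j).
      destruct (Hm (dyadic mid x y n j) (dyadic mid x y n (S j))). lra.
    + rewrite Nat.add_1_r, dyadic_odd. replace (S (S (2 * j))) with (2 * S j)%nat by lia.
      rewrite dyadic_double. specialize (IH j).
      destruct (Hm (dyadic mid x y n j) (dyadic mid x y n (S j))). lra.
Qed.

Lemma dyadic_lipschitz {T : Type} (d : T -> T -> R) (mid : T -> T -> T) x y n j m k :
  is_metric d ->
  (forall a b, d a (mid a b) <= d a b / 2 /\ d (mid a b) b <= d a b / 2) ->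
  d (dyadic mid x y n j) (dyadic mid x y m k) <= d x y * Rabs (INR j / 2 ^ n - INR k / 2 ^ m).
Proof.
  intros Md Hm. pose proof Md as [M0 [M1 [M2 M3]]].
  assert (L : forall n j i, d (dyadic mid x y n j) (dyadic mid x y n (i + j))
                            <= INR i * (d x y / 2 ^ n)).
  { intros n0 j0 i. induction i as [| i IH].
    - simpl. rewrite (proj2 (M1 _ _) eq_refl). lra.
    - rewrite S_INR. pose proof (dyadic_step d mid x y n0 (i + j0) Md Hm).
      pose proof (M3 (dyadic mid x y n0 j0) (dyadic mid x y n0 (i + j0))
                     (dyadic mid x y n0 (S (i + j0)))).
      change (S i + j0)%nat with (S (i + j0)). lra. }
  assert (P : forall n, 0 < 2 ^ n) by (intros; apply pow_lt; lra).
  assert (Main : forall n j k, (j <= k)%nat ->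
     d (dyadic mid x y n j) (dyadic mid x y n k) <= d x y * ((INR k - INR j) / 2 ^ n)).
  { intros n0 j0 k0 H. specialize (L n0 j0 (k0 - j0)%nat).
    replace (k0 - j0 + j0)%nat with k0 in L by lia. rewrite minus_INR in L by auto.
    unfold Rdiv in *. rewrite <- Rmult_assoc, (Rmult_comm (d x y)), Rmult_assoc. exact L. }
  rewrite <- (dyadic_scale mid x y n m j), <- (dyadic_scale mid x y m n k), (Nat.add_comm m n).
  set (j' := (2 ^ m * j)%nat). set (k' := (2 ^ n * k)%nat).
  assert (E : INR j / 2 ^ n - INR k / 2 ^ m = (INR j' - INR k') / 2 ^ (n + m)).
  { unfold j', k'. rewrite !mult_INR, !pow_INR, pow_add. simpl (INR 2).
    pose proof (P n). pose proof (P m). replace (1 + 1) with 2 by ring. field. lra. }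
  rewrite E. unfold Rdiv. rewrite Rabs_mult.
  rewrite (Rabs_pos_eq (/ 2 ^ (n + m))) by (left; apply Rinv_0_lt_compat; auto).
  destruct (Nat.le_ge_cases j' k') as [h | h]; pose proof (le_INR _ _ h).
  - rewrite Rabs_minus_sym, Rabs_pos_eq by lra. apply Main; auto.
  - rewrite M2, Rabs_pos_eq by lra. apply Main; auto.
Qed.

Lemma half_pow_small D eps : 0 <= D -> 0 < eps ->
  exists N, forall n, (N <= n)%nat -> D / 2 ^ n < eps.
Proof.
  intros HD He.
  destruct (pow_lt_1_zero (1 / 2) ltac:(rewrite Rabs_pos_eq; lra) (eps / (D + 1))) as [N HN].
  { apply Rdiv_lt_0_compat; lra. }
  exists N. intros n Hn. specialize (HN n ltac:(lia)).
  assert (P : 0 < 2 ^ n) by (apply pow_lt; lra).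
  replace ((1 / 2) ^ n) with (/ 2 ^ n) in HN
    by (unfold Rdiv; rewrite Rmult_1_l, pow_inv; reflexivity).
  assert (0 < / 2 ^ n) by (apply Rinv_0_lt_compat; auto).
  rewrite Rabs_pos_eq in HN by lra. apply Rlt_div_r in HN; [| lra]. unfold Rdiv. nra.
Qed.

(** Iterated midpoints give a Lipschitz map on dyadic times with constant [d x y]; compactness
    extends it to real times, and a curve with that constant between points at that distance loses
    no length. *)
Lemma midpoints_geodesic {T : Type} (d : T -> T -> R) :
  is_metric d -> cluster_compact d (fun _ => True) ->
  (forall x y, exists z, d x z <= d x y / 2 /\ d z y <= d x y / 2) -> geodesic d.
Proof.
  intros Md HK Hmid x y. pose proof Md as [M0 [M1 [M2 M3]]].
  set (mid := fun a b => proj1_sig (constructive_indefinite_description _ (Hmid a b))).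
  assert (Hm : forall a b, d a (mid a b) <= d a b / 2 /\ d (mid a b) b <= d a b / 2).
  { intros a b. unfold mid. destruct (constructive_indefinite_description _ _); auto. }
  set (D := d x y). assert (HD : 0 <= D) by apply M0.
  assert (P2 : forall n, 0 < 2 ^ n) by (intros; apply pow_lt; lra).
  (* The value at [t] is described by its distances to all dyadic points. A cluster point of the
     values at dyadic times tending to [t] satisfies these bounds, and no convergence has to be
     shown. *)
  assert (G : forall t, 0 <= t -> exists z, forall m k,
     d (dyadic mid x y m k) z <= D * Rabs (INR k / 2 ^ m - t)).
  { intros t Ht.
    set (kap := fun n => proj1_sig (nfloor_ex (t * 2 ^ n)
                  (Rmult_le_pos _ _ Ht (Rlt_le _ _ (P2 n))))).
    assert (Hk : forall n, Rabs (INR (kap n) / 2 ^ n - t) <= 1 / 2 ^ n).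
    { intros n. unfold kap. destruct (nfloor_ex _ _) as [k [K1 K2]]. cbv [proj1_sig].
      pose proof (P2 n). apply Rabs_le. split.
      - assert (t <= (INR k + 1) / 2 ^ n) by (apply Rle_div_r; lra).
        unfold Rdiv in *. lra.
      - assert (INR k / 2 ^ n <= t) by (apply Rle_div_l; lra).
        assert (0 < 1 / 2 ^ n) by (apply Rdiv_lt_0_compat; lra). lra. }
    destruct (HK (fun n => dyadic mid x y n (kap n)) (fun _ => I)) as [z [_ Hz]].
    exists z. intros m k. apply le_epsilon. intros eps He.
    destruct (half_pow_small D (eps / 2) HD) as [N HN]; [lra |].
    destruct (Hz (eps / 2) ltac:(lra) N) as [n [Hn Hd]]. specialize (HN n Hn).
    pose proof (dyadic_lipschitz d mid x y m k n (kap n) Md Hm) as L. fold D in L.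
    pose proof (M3 (dyadic mid x y m k) (dyadic mid x y n (kap n)) z).
    assert (Rabs (INR k / 2 ^ m - INR (kap n) / 2 ^ n) <= Rabs (INR k / 2 ^ m - t) + 1 / 2 ^ n).
    { replace (INR k / 2 ^ m - INR (kap n) / 2 ^ n)
        with ((INR k / 2 ^ m - t) + - (INR (kap n) / 2 ^ n - t)) by ring.
      eapply Rle_trans; [apply Rabs_triang |]. rewrite Rabs_Ropp. specialize (Hk n). lra. }
    apply Rmult_le_compat_l with (r := D) in H0; auto.
    replace (D * (Rabs (INR k / 2 ^ m - t) + 1 / 2 ^ n))
      with (D * Rabs (INR k / 2 ^ m - t) + D / 2 ^ n) in H0 by (unfold Rdiv; ring). lra. }
  set (g := fun t => epsilon (inhabits x) (fun z => forall m k,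
     d (dyadic mid x y m k) z <= D * Rabs (INR k / 2 ^ m - t))).
  assert (Hg : forall t, 0 <= t -> forall m k,
     d (dyadic mid x y m k) (g t) <= D * Rabs (INR k / 2 ^ m - t)).
  { intros t Ht. apply (epsilon_spec (inhabits x) (fun z => forall m k,
     d (dyadic mid x y m k) z <= D * Rabs (INR k / 2 ^ m - t))). auto. }
  assert (Gx : forall t, 0 <= t -> d x (g t) <= D * t).
  { intros t Ht. specialize (Hg t Ht 0%nat 0%nat). simpl in Hg.
    replace (0 / 1 - t) with (- t) in Hg by field. rewrite Rabs_Ropp, Rabs_pos_eq in Hg; auto. }
  assert (Gy : forall t, 0 <= t <= 1 -> d (g t) y <= D * (1 - t)).
  { intros t [Ht Ht1]. specialize (Hg t Ht 0%nat 1%nat). simpl in Hg.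
    replace (1 / 1 - t) with (1 - t) in Hg by field. rewrite Rabs_pos_eq, M2 in Hg; auto; lra. }
  assert (Gl : forall s t, 0 <= s <= t -> d (g s) (g t) <= D * (t - s)).
  { intros s t Hst. apply le_epsilon. intros eps He.
    destruct (half_pow_small D (eps / 2) HD) as [N HN]; [lra |]. specialize (HN N (le_n N)).
    destruct (nfloor_ex (s * 2 ^ N)) as [k [K1 K2]].
    { apply Rmult_le_pos; [lra | left; auto]. }
    pose proof (P2 N).
    assert (A1 : s <= (INR k + 1) / 2 ^ N) by (apply Rle_div_r; lra).
    assert (A2 : INR k / 2 ^ N <= s) by (apply Rle_div_l; lra).
    pose proof (Hg s ltac:(lra) N k) as B1. pose proof (Hg t ltac:(lra) N k) as B2.
    rewrite Rabs_minus_sym, Rabs_pos_eq in B1, B2 by lra.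
    pose proof (M3 (g s) (dyadic mid x y N k) (g t)) as B3.
    rewrite (M2 (g s) (dyadic mid x y N k)) in B3.
    assert (E : (INR k + 1) / 2 ^ N = INR k / 2 ^ N + 1 / 2 ^ N) by (unfold Rdiv; ring).
    assert (D * (s - INR k / 2 ^ N) <= D * (1 / 2 ^ N)) by (apply Rmult_le_compat_l; lra).
    replace (D * (1 / 2 ^ N)) with (D / 2 ^ N) in H0 by (unfold Rdiv; ring). lra. }
  (* The three upper bounds for the pieces before [s], between, and after [t] sum to [D], which is
     the distance of the ends; so the middle bound is attained. *)
  assert (Ge : forall s t, 0 <= s <= t -> t <= 1 -> d (g s) (g t) = D * (t - s)).
  { intros s t Hs Ht. apply Rle_antisym; auto.
    pose proof (Gx s ltac:(lra)). pose proof (Gy t ltac:(lra)).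
    pose proof (M3 x (g s) y) as A1. pose proof (M3 (g s) (g t) y) as A2. fold D in A1. nra. }
  (* The rescaling by [s / D] below requires [D] to be nonzero. *)
  destruct (Req_dec D 0) as [D0 | D0].
  { exists (fun _ => x). fold D. split; auto. split; [apply M1; auto |].
    intros s t Hs Ht. rewrite (proj2 (M1 _ _) eq_refl). replace (s - t) with 0 by lra.
    rewrite Rabs_R0. auto. }
  assert (DP : 0 < D) by lra.
  exists (fun s => g (s / D)). fold D. split; [| split].
  - symmetry. apply M1. apply Rle_antisym; auto. unfold Rdiv. rewrite Rmult_0_l.
    eapply Rle_trans; [apply Gx |]; lra.
  - apply M1. apply Rle_antisym; auto. replace (D / D) with 1 by (field; auto).
    eapply Rle_trans; [apply Gy |]; lra.
  - assert (Main : forall s t, 0 <= s <= D -> 0 <= t <= D -> s <= t ->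
      d (g (s / D)) (g (t / D)) = Rabs (s - t)).
    { intros s t Hs Ht Hst. rewrite Ge.
      - rewrite Rabs_minus_sym, Rabs_pos_eq by lra. field; auto.
      - split; [apply Rdiv_le_0_compat; lra |].
        apply Rmult_le_compat_r; [left; apply Rinv_0_lt_compat |]; auto.
      - apply Rle_div_l; lra. }
    intros s t Hs Ht. destruct (Rle_lt_dec s t) as [h | h]; [auto |].
    rewrite M2, Rabs_minus_sym. apply Main; auto; lra.
Qed.

(* The factor [M] makes it expensive to leave [K], so a cheap chain between points of [K] stays
   close to [K]; the induced metric lies between [d] and [M * d], so its geodesics are
   biLipschitz. *)
Definition weighted_step {X : Type} (d : X -> X -> R) (K : X -> Prop) (M : R) (x w : X) (c : R) :
    Prop :=
  exists (g : R -> X) (m L : R),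
    (m = M \/ (m = 1 /\ forall s, 0 <= s <= L -> K (g s))) /\ 0 <= L /\ c = m * L /\
    g 0 = x /\ g L = w /\
    forall s t, 0 <= s <= L -> 0 <= t <= L -> d (g s) (g t) = Rabs (s - t).

Inductive weighted_chain {X : Type} (d : X -> X -> R) (K : X -> Prop) (M : R) :
    X -> X -> R -> Prop :=
| weighted_nil x : weighted_chain d K M x x 0
| weighted_cons x w y c C : weighted_step d K M x w c -> weighted_chain d K M w y C ->
    weighted_chain d K M x y (c + C).

Lemma weighted_step_sym {X : Type} (d : X -> X -> R) K M x w c :
  weighted_step d K M x w c -> weighted_step d K M w x c.
Proof.
  intros [g [m [L [H1 [H2 [H3 [H4 [H5 H6]]]]]]]].
  exists (fun s => g (L - s)), m, L. split; [| split; [| split; [| split; [| split]]]]; auto.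
  - destruct H1 as [H1 | [H1 H1']]; auto. right. split; auto. intros. apply H1'. lra.
  - rewrite Rminus_0_r. auto.
  - rewrite Rminus_diag. auto.
  - intros s t Hs Ht. rewrite H6 by lra. rewrite <- Rabs_Ropp. f_equal. ring.
Qed.

Lemma weighted_step_split {X : Type} (d : X -> X -> R) K M x w c lam :
  1 <= M -> weighted_step d K M x w c -> 0 <= lam <= c ->
  exists z, weighted_step d K M x z lam /\ weighted_step d K M z w (c - lam).
Proof.
  intros HM [g [m [L [H1 [H2 [H3 [H4 [H5 H6]]]]]]]] Hl.
  assert (Hm : 0 < m) by (destruct H1 as [-> | [-> _]]; lra).
  assert (E : m * (lam / m) = lam) by (field; lra).
  assert (0 <= lam / m) by (apply Rdiv_le_0_compat; lra).
  assert (lam / m <= L) by (apply Rle_div_l; lra).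
  set (a := lam / m) in *.
  exists (g a). split.
  - exists g, m, a. split; [| split; [| split; [| split; [| split]]]]; auto.
    + destruct H1 as [H1 | [H1 H1']]; auto. right. split; auto. intros. apply H1'. lra.
    + intros. apply H6; lra.
  - exists (fun s => g (s + a)), m, (L - a). split; [| split; [| split; [| split; [| split]]]].
    + destruct H1 as [H1 | [H1 H1']]; auto. right. split; auto. intros. apply H1'. lra.
    + lra.
    + rewrite H3. lra.
    + f_equal. ring.
    + rewrite <- H5. f_equal. ring.
    + intros. rewrite H6 by lra. f_equal. ring.
Qed.

Lemma weighted_step_ge {X : Type} (d : X -> X -> R) K M x w c :
  1 <= M -> weighted_step d K M x w c -> d x w <= c /\ 0 <= c.
Proof.
  intros HM [g [m [L [H1 [H2 [H3 [H4 [H5 H6]]]]]]]].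
  rewrite <- H4, <- H5, H6 by lra. rewrite Rminus_0_l, Rabs_Ropp, Rabs_pos_eq by lra.
  destruct H1 as [-> | [-> _]]; nra.
Qed.

Lemma weighted_chain_ge {X : Type} (d : X -> X -> R) K M x w c :
  is_metric d -> 1 <= M -> weighted_chain d K M x w c -> d x w <= c /\ 0 <= c.
Proof.
  intros [M0 [M1 [M2 M3]]] HM H. induction H as [x | x w y c C H1 H2 IH].
  - rewrite (proj2 (M1 _ _) eq_refl). lra.
  - destruct (weighted_step_ge _ _ _ _ _ _ HM H1). pose proof (M3 x w y). lra.
Qed.

Lemma weighted_chain_one {X : Type} (d : X -> X -> R) K M x w c :
  weighted_step d K M x w c -> weighted_chain d K M x w c.
Proof. intros. rewrite <- (Rplus_0_r c). econstructor; eauto. constructor. Qed.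

Lemma weighted_chain_app {X : Type} (d : X -> X -> R) K M x w y c C :
  weighted_chain d K M x w c -> weighted_chain d K M w y C -> weighted_chain d K M x y (c + C).
Proof.
  induction 1; intros; [rewrite Rplus_0_l; auto |]. rewrite Rplus_assoc. econstructor; eauto.
Qed.

Lemma weighted_chain_sym {X : Type} (d : X -> X -> R) K M x w c :
  weighted_chain d K M x w c -> weighted_chain d K M w x c.
Proof.
  induction 1 as [| x w y c C H1 H2 IH]; [constructor |]. rewrite Rplus_comm.
  eapply weighted_chain_app; eauto. apply weighted_chain_one, weighted_step_sym. auto.
Qed.

(** Cutting a nearly optimal chain at half its cost supplies the approximate midpoints of the
    induced metric. *)
Lemma weighted_chain_split {X : Type} (d : X -> X -> R) K M x y C lam :
  1 <= M -> weighted_chain d K M x y C -> 0 <= lam <= C ->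
  exists z, weighted_chain d K M x z lam /\ weighted_chain d K M z y (C - lam).
Proof.
  intros HM H. revert lam. induction H as [x | x w y c C H1 H2 IH]; intros lam Hl.
  - exists x. replace lam with 0 by lra. rewrite Rminus_0_r. split; constructor.
  - destruct (Rle_lt_dec lam c) as [h | h].
    + destruct (weighted_step_split d K M x w c lam HM H1) as [z [Z1 Z2]]; [lra |].
      exists z. split; [apply weighted_chain_one; auto |].
      replace (c + C - lam) with (c - lam + C) by ring. econstructor; eauto.
    + destruct (IH (lam - c)) as [z [Z1 Z2]]; [lra |]. exists z. split.
      * replace lam with (c + (lam - c)) by ring. econstructor; eauto.
      * replace (c + C - lam) with (C - (lam - c)) by ring. auto.
Qed.

(** Until its first step of weight 1, which starts in [K], a chain pays [M] times its length; if
    there is no such step, it pays so all the way to [x]. *)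
Lemma weighted_chain_confined {X : Type} (d : X -> X -> R) (K : X -> Prop) M z x C :
  is_metric d -> 1 <= M -> weighted_chain d K M z x C -> K x -> exists k, K k /\ M * d z k <= C.
Proof.
  intros Md HM H Kx. pose proof Md as [M0 [M1 [M2 M3]]].
  induction H as [z | z w y c C H1 H2 IH].
  - exists z. rewrite (proj2 (M1 _ _) eq_refl). split; [auto | lra].
  - pose proof (weighted_step_ge _ _ _ _ _ _ HM H1).
    pose proof (weighted_chain_ge _ _ _ _ _ _ Md HM H2).
    destruct H1 as [g [m [L [G1 [G2 [G3 [G4 [G5 G6]]]]]]]].
    destruct G1 as [-> | [-> Hin]].
    + destruct (IH Kx) as [k [Kk Hk]]. exists k. split; auto.
      assert (d z w = L).
      { rewrite <- G4, <- G5, G6 by lra. rewrite Rminus_0_l, Rabs_Ropp, Rabs_pos_eq; lra. }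
      pose proof (M3 z w k). rewrite G3, <- H1. nra.
    + exists z. split; [rewrite <- G4; apply Hin; lra |].
      rewrite (proj2 (M1 _ _) eq_refl). lra.
Qed.

Definition weighted_dist {X : Type} (d : X -> X -> R) (K : X -> Prop) M (x y : X) : R :=
  infK (fun c => weighted_chain d K M x y c) (fun c => c).

(** [K] is the neighbourhood of [C] of radius [eta / 2]. The endpoints are joined inside [K] at a
    cost [l] that does not involve the penalty, and [M] is chosen afterwards so large that leaving
    [K] by [eta / 2] would cost more than [l]. *)
Lemma bilip_arc_near {X : Type} (d : X -> X -> R) (C : X -> Prop) eta x y :
  is_metric d -> geodesic d -> cluster_compact d (fun _ => True) ->
  connected_set d C -> 0 < eta -> C x -> C y -> x <> y ->
  exists (b L : R) (g : R -> X), 0 < b /\ 0 < L /\ g 0 = x /\ g b = y /\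
    (forall s, 0 <= s <= b -> exists c, C c /\ d c (g s) < eta) /\
    forall s t, 0 <= s <= b -> 0 <= t <= b ->
      Rabs (s - t) / L <= d (g s) (g t) /\ d (g s) (g t) <= L * Rabs (s - t).
Proof.
  intros Md Hgeo HX HC Heta Cx Cy Hxy. pose proof Md as [M0 [M1 [M2 M3]]].
  set (K := fun z => exists c, C c /\ d c z < eta / 2).
  assert (CK : forall z, C z -> K z).
  { intros z Cz. exists z. rewrite (proj2 (M1 _ _) eq_refl). split; auto. lra. }
  (* The points of [C] reachable from [x] at a cost independent of [M] form a clopen part of [C],
     since a geodesic of length below [eta / 2] starting in [C] stays in [K] and has weight 1. *)
  assert (Short : exists l, forall M, weighted_chain d K M x y l).
  { apply NNPP. intro N. apply HC.
    set (reach := fun z => exists l, forall M, weighted_chain d K M x z l).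
    assert (E : forall a b, C a -> d a b < eta / 2 -> forall M, weighted_chain d K M a b (d a b)).
    { intros a b Ca Hab M. apply weighted_chain_one.
      destruct (Hgeo a b) as [g [G1 [G2 G3]]]. exists g, 1, (d a b).
      split; [| split; [| split; [| split; [| split]]]]; auto; [| lra].
      right. split; auto. intros s Hs. exists a. split; auto.
      assert (E : d (g 0) (g s) = Rabs (0 - s)) by (apply G3; lra).
      rewrite G1, Rminus_0_l, Rabs_Ropp, Rabs_pos_eq in E; lra. }
    exists (fun z => exists c, C c /\ reach c /\ d c z < eta / 4),
           (fun z => exists c, C c /\ ~ reach c /\ d c z < eta / 4).
    assert (O : forall P : X -> Prop, is_open d (fun z => exists c, C c /\ P c /\ d c z < eta / 4)).
    { intros P z [c [Cc [Pc Hz]]]. exists (eta / 4 - d c z). split; [lra |].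
      intros w Hw. exists c. repeat split; auto. pose proof (M3 c z w). lra. }
    assert (Self : forall z, d z z < eta / 4).
    { intros z. rewrite (proj2 (M1 _ _) eq_refl). lra. }
    split; [apply O | split; [apply O |]]. split; [| split; [| split]].
    - intros z Cz. destruct (classic (reach z)); [left | right]; exists z; auto.
    - exists x. split; auto. exists x. repeat split; auto. exists 0. intros; constructor.
    - exists y. split; auto. exists y. repeat split; auto.
    - intros z Cz [a [Ca [[l Hl] Ha]]] [b [Cb [NRb Hb]]]. apply NRb.
      exists (l + d a b). intros M. eapply weighted_chain_app; eauto. apply E; auto.
      pose proof (M3 a z b). rewrite (M2 z b) in H. lra. }
  destruct Short as [l Hl].
  (* With this choice [M * (eta / 2)] equals [eta / 2 + Rabs l + 1], which exceeds [l]. *)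
  set (M := 1 + 2 * (Rabs l + 1) / eta).
  assert (HMp : 0 < 2 * (Rabs l + 1) / eta).
  { apply Rdiv_lt_0_compat; auto. pose proof (Rabs_pos l). lra. }
  assert (HM : 1 <= M) by (unfold M; lra).
  assert (HMl : l < M * (eta / 2)).
  { unfold M. replace ((1 + 2 * (Rabs l + 1) / eta) * (eta / 2))
      with (eta / 2 + (Rabs l + 1)) by (field; lra). pose proof (Rle_abs l). lra. }
  clearbody M. specialize (Hl M).
  set (D := weighted_dist d K M).
  assert (Big : forall a b, weighted_chain d K M a b (M * d a b)).
  { intros a b. apply weighted_chain_one. destruct (Hgeo a b) as [g [G1 [G2 G3]]].
    exists g, M, (d a b). repeat split; auto. }
  assert (SD : forall a b, (forall c, weighted_chain d K M a b c -> D a b <= c) /\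
     (forall m, (forall c, weighted_chain d K M a b c -> m <= c) -> m <= D a b)).
  { intros a b. apply (infK_spec (fun c => weighted_chain d K M a b c) (fun c => c)).
    - exists (M * d a b). auto.
    - intros c Hc. apply (weighted_chain_ge d K M a b); auto. }
  assert (Dge : forall a b, d a b <= D a b).
  { intros a b. apply SD. intros c Hc. apply (weighted_chain_ge d K M a b); auto. }
  assert (Dle : forall a b, D a b <= M * d a b) by (intros a b; apply SD; auto).
  assert (Near : forall a b eps, 0 < eps -> exists c, weighted_chain d K M a b c /\ c < D a b + eps).
  { intros a b eps He. apply NNPP. intro N.
    assert (D a b + eps <= D a b); [| lra]. apply SD. intros c Hc.
    apply Rnot_lt_le. intro. apply N. eauto. }
  assert (D3 : forall a b c, D a c <= D a b + D b c).
  { intros a b c. apply le_epsilon. intros eps He.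
    destruct (Near a b (eps / 2)) as [c1 [H1 H1']]; [lra |].
    destruct (Near b c (eps / 2)) as [c2 [H2 H2']]; [lra |].
    pose proof (proj1 (SD a c) _ (weighted_chain_app _ _ _ _ _ _ _ _ H1 H2)). lra. }
  assert (DM : is_metric D).
  { split; [| split; [| split]]; auto.
    - intros a b. apply Rle_trans with (d a b); auto.
    - intros a b. split.
      + intros H. apply M1. apply Rle_antisym; auto. rewrite <- H. auto.
      + intros ->. apply Rle_antisym.
        * apply SD. constructor.
        * apply Rle_trans with (d b b); auto.
    - intros a b. apply Rle_antisym; apply SD; intros c Hc; apply SD;
        apply weighted_chain_sym; auto. }
  assert (DK : cluster_compact D (fun _ => True)).
  { intros u _. destruct (HX u (fun _ => I)) as [z [_ Hz]]. exists z. split; auto.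
    intros eps He N. destruct (Hz (eps / M)) with (N := N) as [n [Hn Hd]].
    - apply Rdiv_lt_0_compat; lra.
    - exists n. split; auto. eapply Rle_lt_trans; [apply Dle |].
      apply Rlt_div_r in Hd; lra. }
  pose proof DM as [D0 [D1 [D2 _]]].
  (* The infimum over chains gives midpoints only up to 1/(n+1); a cluster point of them is an exact
     one. *)
  assert (Dgeo : geodesic D).
  { apply midpoints_geodesic; auto. intros a b.
    assert (Z : forall n : nat, exists z, D a z <= D a b / 2 + / INR (S n) /\
                                          D z b <= D a b / 2 + / INR (S n)).
    { intros n. assert (P : 0 < / INR (S n)) by (apply Rinv_0_lt_compat, lt_0_INR; lia).
      destruct (Near a b _ P) as [c [Hc Hc']].
      pose proof (weighted_chain_ge _ _ _ _ _ _ Md HM Hc).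
      destruct (weighted_chain_split d K M a b c (c / 2) HM Hc) as [z [Z1 Z2]]; [lra |].
      exists z. pose proof (proj1 (SD _ _) _ Z1). pose proof (proj1 (SD _ _) _ Z2). lra. }
    set (z := fun n => proj1_sig (constructive_indefinite_description _ (Z n))).
    assert (Hz : forall n, D a (z n) <= D a b / 2 + / INR (S n) /\
                           D (z n) b <= D a b / 2 + / INR (S n)).
    { intros n. unfold z. destruct (constructive_indefinite_description _ (Z n)); auto. }
    destruct (DK z (fun _ => I)) as [p [_ Hp]]. exists p.
    split; apply le_epsilon; intros eps He;
      destruct (inv_INR_lt (eps / 2) ltac:(lra)) as [N HN];
      destruct (Hp (eps / 2) ltac:(lra) N) as [n [Hn Hd]];
      specialize (HN n Hn); destruct (Hz n) as [Z1 Z2].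
    - pose proof (D3 a (z n) p). lra.
    - pose proof (D3 p (z n) b). rewrite (D2 p (z n)) in H. lra. }
  destruct (Dgeo x y) as [g [G1 [G2 G3]]].
  assert (Dpos : 0 < D x y).
  { destruct (Rle_lt_or_eq_dec 0 (D x y) (D0 x y)); auto. exfalso. apply Hxy, D1; auto. }
  exists (D x y), M, g. split; auto. split; [lra |]. split; auto. split; auto. split.
  (* The point [g s] is at [D]-distance at most [l] from [x], so some chain to [x] costs less than
     [M * (eta / 2)]. Confinement puts [g s] within [eta / 2] of [K], hence within [eta] of [C]. *)
  - intros s Hs.
    assert (Dsx : D (g s) x <= l).
    { rewrite <- G1, G3 by lra. rewrite Rminus_0_r, Rabs_pos_eq by lra.
      apply Rle_trans with (D x y); [lra | apply SD; auto]. }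
    destruct (Near (g s) x (M * (eta / 2) - l)) as [c [Hc Hc']]; [lra |].
    destruct (weighted_chain_confined d K M (g s) x c Md HM Hc (CK x Cx)) as [k [[q [Cq Hq]] Hk]].
    exists q. split; auto. pose proof (M3 q k (g s)). rewrite (M2 k) in H.
    assert (d (g s) k < eta / 2); [| lra].
    apply Rmult_lt_reg_l with M; lra.
  - intros s t Hs Ht. specialize (G3 s t Hs Ht). rewrite <- G3.
    pose proof (Dge (g s) (g t)). pose proof (Dle (g s) (g t)). split.
    + apply Rle_div_l; lra.
    + pose proof (D0 (g s) (g t)). nra.
Qed.

(** * Limits of circle homeomorphisms *)

Lemma circle_angle a b : a ^ 2 + b ^ 2 = 1 ->
  exists t, - PI <= t <= PI /\ a = cos t /\ b = sin t.
Proof.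
  intros H. pose proof PI_RGT_0. destruct (Req_dec a (-1)) as [-> | h].
  - exists PI. rewrite cos_PI, sin_PI. split; [lra | split; nra].
  - destruct (half_angle a b) as [A B]; auto; [nra |].
    pose proof (atan_bound (b / (1 + a))).
    exists (2 * atan (b / (1 + a))). rewrite A, B. split; lra.
Qed.

Lemma circle_angle_from y z : circle y -> circle z ->
  exists u, - PI <= u <= PI /\
    z = (fst y * cos u - snd y * sin u, fst y * sin u + snd y * cos u).
Proof.
  destruct y as [y1 y2], z as [z1 z2]. unfold circle; cbn [fst snd]. intros Hy Hz.
  destruct (circle_angle (y1 * z1 + y2 * z2) (y1 * z2 - y2 * z1)) as [u [Hu [A B]]].
  - transitivity ((y1 ^ 2 + y2 ^ 2) * (z1 ^ 2 + z2 ^ 2)); [ring |]. rewrite Hy, Hz. ring.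
  - exists u. split; auto. rewrite <- A, <- B. f_equal.
    + transitivity (z1 * (y1 ^ 2 + y2 ^ 2)); [rewrite Hy |]; ring.
    + transitivity (z2 * (y1 ^ 2 + y2 ^ 2)); [rewrite Hy |]; ring.
Qed.

Lemma cos_gt u h : Rabs u < h -> h <= PI -> cos h < cos u.
Proof.
  intros H1 H2. unfold Rabs in H1. destruct (Rcase_abs u).
  - rewrite <- (cos_neg u). apply cos_decreasing_1; lra.
  - apply cos_decreasing_1; lra.
Qed.

Lemma cos_ge u h : Rabs u <= h -> h <= PI -> cos h <= cos u.
Proof.
  intros [H | <-] H2; [left; apply cos_gt; auto |].
  unfold Rabs. destruct (Rcase_abs u); [rewrite cos_neg |]; lra.
Qed.

Lemma circle_limit_fiber (c : R * R -> R * R) (cn : nat -> R * R -> R * R) y :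
  (forall p, circle p -> circle (c p)) -> cont_on dR2 dR2 circle c ->
  (forall n, homeo_onto dR2 dR2 circle circle (cn n)) ->
  (forall eps, 0 < eps -> exists N, forall n, (N <= n)%nat ->
     forall p, circle p -> dR2 (cn n p) (c p) < eps) ->
  circle y -> connected_set dR2 (fun p => circle p /\ c p = y).
Proof.
  intros Hc Cc Hcn Lim Hy Sep. pose proof dR2_metric as [M0 [M1 [M2 M3]]].
  set (e := fun t => (cos t, sin t)).
  assert (He : forall t, circle (e t)) by apply circle_cos_sin.
  assert (Gap : forall (U V : R * R -> Prop) s t, is_open dR2 U -> is_open dR2 V ->
    (forall p, circle p /\ c p = y -> U p \/ V p) -> (forall p, U p -> V p -> False) ->
    s < t -> c (e s) = y -> c (e t) = y -> U (e s) -> V (e t) ->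
    exists u, s < u < t /\ c (e u) <> y).
  { intros U V s t OU OV Cov Dis Hst Es Et Us Vt. apply NNPP. intro N.
    assert (F : forall u, s <= u <= t -> c (e u) = y).
    { intros u Hu. destruct (Req_dec u s) as [-> | h1]; auto.
      destruct (Req_dec u t) as [-> | h2]; auto.
      apply NNPP. intro. apply N. exists u. split; auto. lra. }
    apply (connected_image _ dR2 _ e R_metric dR2_metric (interval_connected s t)).
    { apply cont_cos_sin. }
    exists U, V. repeat split; auto.
    - intros p [u [Hu <-]]. apply Cov. auto.
    - exists (e s). split; auto. exists s. split; auto. lra.
    - exists (e t). split; auto. exists t. split; auto. lra.
    - intros p _. apply Dis. }
  assert (Main : forall (U V : R * R -> Prop) ta tb, is_open dR2 U -> is_open dR2 V ->
    (forall p, circle p /\ c p = y -> U p \/ V p) -> (forall p, U p -> V p -> False) ->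
    ta < tb < ta + 2 * PI -> c (e ta) = y -> c (e tb) = y -> U (e ta) -> V (e tb) -> False).
  { intros U V ta tb OU OV Cov Dis Ht Ea Eb Ua Vb.
    destruct (Gap U V ta tb) as [t1 [Ht1 N1]]; auto; [lra |].
    assert (Eper : e (ta + 2 * PI) = e ta).
    { unfold e. rewrite cos_plus, sin_plus, cos_2PI, sin_2PI. f_equal; ring. }
    destruct (Gap V U tb (ta + 2 * PI)) as [t2 [Ht2 N2]]; auto.
    { intros p Hp. destruct (Cov p Hp); auto. }
    { intros p; eauto. }
    { lra. }
    { rewrite Eper; auto. }
    { rewrite Eper; auto. }
    set (del := Rmin (dR2 (c (e t1)) y) (dR2 (c (e t2)) y)).
    assert (Hdel : 0 < del).
    { apply Rmin_glb_lt;
        [destruct (M0 (c (e t1)) y) as [h | h] | destruct (M0 (c (e t2)) y) as [h | h]];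
        auto; exfalso; symmetry in h; apply M1 in h; auto. }
    pose proof (Rmin_l (dR2 (c (e t1)) y) (dR2 (c (e t2)) y)) as D1.
    pose proof (Rmin_r (dR2 (c (e t1)) y) (dR2 (c (e t2)) y)) as D2. fold del in D1, D2.
    destruct (Lim (del / 2) ltac:(lra)) as [n Hn]. specialize (Hn n (le_n n)).
    destruct (homeo_inverse _ _ _ _ _ (Hcn n)) as [g [Hg [Hgf Cg]]]; [exists (e 0); auto |].
    pose proof (proj1 (Hcn n)) as Hmap.
    assert (Far1 : del / 2 < dR2 (cn n (e t1)) y).
    { pose proof (M3 (c (e t1)) (cn n (e t1)) y). rewrite (M2 (c (e t1)) (cn n (e t1))) in H.
      specialize (Hn (e t1) (He t1)). lra. }
    assert (Far2 : del / 2 < dR2 (cn n (e t2)) y).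
    { pose proof (M3 (c (e t2)) (cn n (e t2)) y). rewrite (M2 (c (e t2)) (cn n (e t2))) in H.
      specialize (Hn (e t2) (He t2)). lra. }
    assert (Na : dR2 (cn n (e ta)) y < del / 2) by (rewrite <- Ea; apply Hn; auto).
    assert (Nb : dR2 (cn n (e tb)) y < del / 2) by (rewrite <- Eb; apply Hn; auto).
    destruct (circle_angle_from y (cn n (e ta)) Hy (Hmap _ (He ta))) as [ua [Hua Eua]].
    destruct (circle_angle_from y (cn n (e tb)) Hy (Hmap _ (He tb))) as [ub [Hub Eub]].
    set (q := fun u => (fst y * cos u - snd y * sin u, fst y * sin u + snd y * cos u)).
    assert (Hq : forall u, circle (q u)).
    { intros u. unfold circle, q; cbn [fst snd].
      transitivity ((fst y ^ 2 + snd y ^ 2) * (cos u ^ 2 + sin u ^ 2)); [ring |].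
      rewrite Hy, cos_sin_2. ring. }
    assert (Dq : forall u, dR2 (q u) y ^ 2 = 2 - 2 * cos u).
    { intros u. rewrite dR2_sq. unfold q; cbn [fst snd].
      transitivity ((fst y ^ 2 + snd y ^ 2) * (cos u ^ 2 + sin u ^ 2 + 1 - 2 * cos u)); [ring |].
      rewrite Hy, cos_sin_2. ring. }
    (* Interpolation of the angles measured from [y]. The squared distance to [y] is
       [2 - 2 * cos u], which grows with the absolute value of the angle up to pi, so the path is
       never farther from [y] than its worse endpoint. *)
    set (path := fun s => q ((1 - s) * ua + s * ub)).
    assert (Close : forall s, 0 <= s <= 1 -> dR2 (path s) y < del / 2).
    { intros s Hs. unfold path.
      assert (Z : exists w, (w = ua \/ w = ub) /\ Rabs ((1 - s) * ua + s * ub) <= Rabs w).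
      { destruct (Rle_lt_dec (Rabs ua) (Rabs ub)); [exists ub | exists ua]; split; auto;
        (eapply Rle_trans; [apply Rabs_triang |]); rewrite !Rabs_mult;
        rewrite (Rabs_pos_eq (1 - s)), (Rabs_pos_eq s) by lra; nra. }
      destruct Z as [w [Hw Lw]].
      assert (dR2 (q w) y < del / 2).
      { destruct Hw as [-> | ->]; unfold q; [rewrite <- Eua | rewrite <- Eub]; auto. }
      assert (cos (Rabs w) <= cos ((1 - s) * ua + s * ub)).
      { apply cos_ge; auto. apply Rabs_le. destruct Hw as [-> | ->]; lra. }
      assert (Ecos : cos (Rabs w) = cos w).
      { unfold Rabs. destruct (Rcase_abs w); [apply cos_neg | auto]. }
      rewrite Ecos in H0.
      pose proof (Dq w). pose proof (Dq ((1 - s) * ua + s * ub)).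
      pose proof (M0 (q w) y). pose proof (M0 (q ((1 - s) * ua + s * ub)) y).
      apply Rle_lt_trans with (dR2 (q w) y); auto.
      apply Rsqr_incr_0; auto. unfold Rsqr. lra. }
    assert (Cpath : cont_on (fun x y : R => Rabs (x - y)) dR2 (fun s => 0 <= s <= 1) path).
    { unfold path, q. apply cont_pair; contR_auto; apply contR_id. }
    (* The line through [e t1] and [e t2] is the level [cos hf] of the functional with direction
       [(cos m, sin m)]. It separates [e ta] from [e tb], and meets the circle in these two points
       only. *)
    set (m := (t1 + t2) / 2). set (hf := (t2 - t1) / 2).
    assert (Hhf : 0 < hf < PI) by (unfold hf; lra).
    set (phi := fun s => cos m * fst (g (path s)) + sin m * snd (g (path s))).
    assert (Cphi : contR (fun x y : R => Rabs (x - y)) (fun s => 0 <= s <= 1) phi).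
    { assert (cont_on (fun x y : R => Rabs (x - y)) dR2 (fun s => 0 <= s <= 1)
                (fun s => g (path s))).
      { apply (cont_on_comp _ dR2 _ _ circle); auto. intros; apply Hq. }
      unfold phi. contR_auto; auto using cont_fst, cont_snd. }
    assert (P0 : path 0 = cn n (e ta)).
    { rewrite Eua. unfold path, q. replace ((1 - 0) * ua + 0 * ub) with ua by ring. auto. }
    assert (P1 : path 1 = cn n (e tb)).
    { rewrite Eub. unfold path, q. replace ((1 - 1) * ua + 1 * ub) with ub by ring. auto. }
    assert (Edot : forall t, cos m * fst (e t) + sin m * snd (e t) = cos (t - m)).
    { intros t. unfold e; cbn [fst snd]. rewrite cos_minus. ring. }
    destruct (connected_ivt _ _ phi 0 1 (cos hf) R_metric (interval_connected 0 1) Cphi)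
      as [s [Hs Es]]; try lra.
    { unfold phi. rewrite P0, P1, !Hgf, !Edot by auto. split.
      - rewrite <- cos_neg. destruct (Rle_lt_dec (- (ta - m)) PI) as [h | h].
        + apply cos_decreasing_1; unfold hf, m in *; lra.
        + replace (cos (- (ta - m))) with (cos (2 * PI + (ta - m))).
          * apply cos_decreasing_1; unfold hf, m in *; lra.
          * rewrite cos_neg, cos_plus, cos_2PI, sin_2PI. ring.
      - apply cos_gt; [| lra]. apply Rabs_def1; unfold hf, m; lra. }
    destruct (Hg (path s)) as [G1 G2]; [apply Hq |].
    specialize (Close s Hs).
    set (p := g (path s)) in *. unfold phi in Es. fold p in Es.
    set (S := cos m * snd p - sin m * fst p).
    assert (ES : S ^ 2 = sin hf ^ 2).
    { assert (cos hf ^ 2 + S ^ 2 = 1).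
      { rewrite <- Es. unfold S.
        transitivity ((cos m ^ 2 + sin m ^ 2) * (fst p ^ 2 + snd p ^ 2)); [ring |].
        rewrite cos_sin_2. unfold circle in G1. rewrite G1. ring. }
      pose proof (cos_sin_2 hf). lra. }
    assert (Ep : p = (cos m * cos hf - sin m * S, sin m * cos hf + cos m * S)).
    { rewrite <- Es. unfold S. destruct p as [p1 p2]. cbn [fst snd].
      pose proof (cos_sin_2 m) as E. f_equal.
      - transitivity (p1 * (cos m ^ 2 + sin m ^ 2)); [rewrite E |]; ring.
      - transitivity (p2 * (cos m ^ 2 + sin m ^ 2)); [rewrite E |]; ring. }
    assert (SS : S = sin hf \/ S = - sin hf).
    { assert (E : (S - sin hf) * (S + sin hf) = 0) by (ring_simplify; lra).
      apply Rmult_integral in E. destruct E; [left | right]; lra. }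
    destruct SS as [E | E]; rewrite E in Ep.
    - assert (p = e t2).
      { rewrite Ep. unfold e. replace t2 with (m + hf) by (unfold m, hf; field).
        rewrite cos_plus, sin_plus. f_equal; ring. }
      rewrite H in G2. rewrite <- G2 in Close. lra.
    - assert (p = e t1).
      { rewrite Ep. unfold e. replace t1 with (m - hf) by (unfold m, hf; field).
        rewrite cos_minus, sin_minus. f_equal; ring. }
      rewrite H in G2. rewrite <- G2 in Close. lra. }
  destruct (connected_disjoint _ _ dR2_metric (fun F => F Sep))
    as [U [V [OU [OV [Cov [[a [[Ca Ea] Ua]] [[b [[Cb Eb] Vb]] Dis]]]]]]].
  destruct a as [a1 a2], b as [b1 b2].
  destruct (circle_angle a1 a2 Ca) as [ta [Hta [-> ->]]].
  destruct (circle_angle b1 b2 Cb) as [tb [Htb [-> ->]]].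
  (* The angles -pi and pi name the same point; excluding this case gives the strict bound by a full
     turn that [Main] demands. *)
  assert (Per : forall s t, - PI <= s <= PI -> - PI <= t <= PI -> ~ t < s + 2 * PI ->
            (cos s, sin s) = (cos t, sin t)).
  { intros s t Hs Htt N. assert (s = - PI) by lra. assert (t = PI) by lra. subst.
    rewrite cos_neg, sin_neg, cos_PI, sin_PI. f_equal. ring. }
  destruct (Rtotal_order ta tb) as [h | [h | h]].
  - apply (Main U V ta tb); auto. split; auto. apply NNPP. intro N.
    apply (Dis (cos ta, sin ta)); auto. rewrite (Per ta tb); auto.
  - subst tb. eauto.
  - apply (Main V U tb ta); auto.
    + intros p Hp. destruct (Cov p Hp); auto.
    + intros p; eauto.
    + split; auto. apply NNPP. intro N.
      apply (Dis (cos ta, sin ta)); auto. rewrite <- (Per tb ta); auto.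
Qed.

(** * Cuts of the disc *)

Definition is_path (ga : R -> R * R) : Prop :=
  cont_on (fun x y : R => Rabs (x - y)) dR2 (fun t => 0 <= t <= 1) ga /\
  forall t, 0 <= t <= 1 -> cdisc (ga t).

Definition trace (ga : R -> R * R) (z : R * R) : Prop := exists t, 0 <= t <= 1 /\ ga t = z.

Definition preim (w : R * R -> R * R) (A : R * R -> Prop) (p : R * R) : Prop :=
  cdisc p /\ A (w p).

(** What the planar argument retains of the map read in the chart. The biLipschitz condition has no
    meaning there, so the last field keeps only its consequence: near any connected set there are
    arcs with log-trivial preimage. *)
Record disc_map (w : R * R -> R * R) : Prop := {
  disc_map_in : forall p, cdisc p -> cdisc (w p);
  disc_map_cont : cont_on dR2 dR2 cdisc w;
  disc_map_circle : forall p, circle p -> circle (w p);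
  disc_map_monotone : forall e, circle e -> connected_set dR2 (fun p => circle p /\ w p = e);
  disc_map_arcs : forall (C : R * R -> Prop) eta x y,
    (forall z, C z -> cdisc z) -> connected_set dR2 C -> 0 < eta -> C x -> C y -> x <> y ->
    exists ga, is_path ga /\ ga 0 = x /\ ga 1 = y /\
      (forall t, 0 <= t <= 1 -> exists c, C c /\ dR2 c (ga t) < eta) /\
      log_trivial dR2 (preim w (trace ga)) }.

Definition seg (z z' : R * R) (s : R) : R * R :=
  ((1 - s) * fst z + s * fst z', (1 - s) * snd z + s * snd z').

Lemma seg_0 z z' : seg z z' 0 = z.
Proof. destruct z, z'. unfold seg; simpl. f_equal; ring. Qed.

Lemma seg_1 z z' : seg z z' 1 = z'.
Proof. destruct z, z'. unfold seg; simpl. f_equal; ring. Qed.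

Lemma cont_seg z z' S : cont_on (fun x y : R => Rabs (x - y)) dR2 S (seg z z').
Proof. unfold seg. apply cont_pair; contR_auto; apply contR_id. Qed.

Lemma cdisc_seg z z' s : cdisc z -> cdisc z' -> 0 <= s <= 1 -> cdisc (seg z z' s).
Proof.
  destruct z as [a b], z' as [a' b']. unfold cdisc, seg; cbn [fst snd]. intros H H' Hs.
  assert (((1 - s) * a + s * a') ^ 2 + ((1 - s) * b + s * b') ^ 2 =
    (1 - s) * (a ^ 2 + b ^ 2) + s * (a' ^ 2 + b' ^ 2)
    - s * (1 - s) * ((a - a') ^ 2 + (b - b') ^ 2)) as -> by ring.
  assert (0 <= s * (1 - s) * ((a - a') ^ 2 + (b - b') ^ 2)).
  { apply Rmult_le_pos; [apply Rmult_le_pos; lra |].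
    apply Rplus_le_le_0_compat; apply pow2_ge_0. }
  nra.
Qed.

Lemma seg_path z z' : cdisc z -> cdisc z' -> is_path (seg z z').
Proof. intros. split; [apply cont_seg | intros; apply cdisc_seg; auto]. Qed.

Lemma trace_connected ga : is_path ga -> connected_set dR2 (trace ga).
Proof.
  intros [C _]. apply (connected_image _ _ _ ga R_metric dR2_metric); auto.
  apply interval_connected.
Qed.

Lemma connected_segs (K : R * R -> Prop) x0 :
  (forall x, K x -> cdisc x) -> K x0 ->
  (forall x, K x -> forall s, 0 <= s <= 1 -> K (seg x0 x s)) -> connected_set dR2 K.
Proof.
  intros HK K0 H. apply connected_star with x0. intros x Kx. exists (trace (seg x0 x)).
  split; [apply trace_connected, seg_path; auto |]. split; [| split].
  - intros y [s [Hs <-]]. auto.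
  - exists 1. split; [lra | apply seg_1].
  - exists 0. split; [lra | apply seg_0].
Qed.

Lemma connected_ext {T : Type} (d : T -> T -> R) (A B : T -> Prop) :
  (forall x, A x <-> B x) -> connected_set d A -> connected_set d B.
Proof.
  intros E HA [U [V [OU [OV [Cov [[a [Ba Ua]] [[b [Bb Vb]] Dis]]]]]]]. apply HA.
  exists U, V. repeat split; auto.
  - intros x Ax. apply Cov, E; auto.
  - exists a. split; auto. apply E; auto.
  - exists b. split; auto. apply E; auto.
  - intros x Ax. apply Dis, E; auto.
Qed.

Lemma log_trivial_ext {T : Type} (d : T -> T -> R) (A B : T -> Prop) :
  (forall x, A x <-> B x) -> log_trivial d A -> log_trivial d B.
Proof.
  intros E H f g Hfg.
  apply has_log_sub with A; [intros; apply E; auto |].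
  apply H, circle_map_sub with B; auto. intros; apply E; auto.
Qed.

Lemma trace_closed ga : is_path ga -> closed_in dR2 cdisc (trace ga).
Proof.
  intros [C D]. apply compact_closed.
  - apply is_metric_on, dR2_metric.
  - intros z [t [Ht <-]]. auto.
  - apply (cluster_compact_image (fun x y : R => Rabs (x - y)) dR2 cdisc (fun t => 0 <= t <= 1) ga);
      auto using R_metric, interval_compact. apply is_metric_on, dR2_metric.
Qed.

(** * Paths in the complement of an arc, and the regions that it cuts off *)

Definition joined (T : R * R -> Prop) (z z' : R * R) : Prop :=
  exists al, is_path al /\ al 0 = z /\ al 1 = z' /\ forall t, 0 <= t <= 1 -> ~ T (al t).

Lemma joined_mono (T T' : R * R -> Prop) z z' :
  (forall x, cdisc x -> T x -> T' x) -> joined T' z z' -> joined T z z'.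
Proof.
  intros H [al [A1 [A2 [A3 A4]]]]. exists al. split; auto. split; auto. split; auto.
  intros t Ht Hx. apply (A4 t Ht). apply H; auto. apply A1; auto.
Qed.

Lemma joined_seg (T : R * R -> Prop) z z' :
  cdisc z -> cdisc z' -> (forall s, 0 <= s <= 1 -> ~ T (seg z z' s)) -> joined T z z'.
Proof.
  intros. exists (seg z z'). split; [apply seg_path; auto |].
  split; [apply seg_0 | split; [apply seg_1 | auto]].
Qed.

Lemma joined_sym T z z' : joined T z z' -> joined T z' z.
Proof.
  intros [al [[A1 A1'] [A2 [A3 A4]]]]. exists (fun t => al (1 - t)).
  split; [split |].
  - apply (cont_on_comp _ (fun x y : R => Rabs (x - y)) _ _ (fun t => 0 <= t <= 1)
      (fun t => 1 - t)); auto.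
    + apply (contR_minus _ _ (fun _ => 1) (fun t => t)); [apply contR_const | apply contR_id].
    + intros; lra.
  - intros. apply A1'. lra.
  - rewrite Rminus_0_r, Rminus_diag. split; auto. split; auto. intros. apply A4. lra.
Qed.

Lemma joined_trans T x y z : joined T x y -> joined T y z -> joined T x z.
Proof.
  intros [al [[A1 A1'] [A2 [A3 A4]]]] [be [[B1 B1'] [B2 [B3 B4]]]].
  assert (E : forall t, 0 <= t <= 1 ->
     (t <= 1 / 2 -> 0 <= 2 * t <= 1) /\ (1 / 2 <= t -> 0 <= 2 * t - 1 <= 1)) by (intros; lra).
  exists (fun t => if Rle_dec t (1 / 2) then al (2 * t) else be (2 * t - 1)).
  split; [split |].
  - intros t Ht e He.
    assert (Ca : t <= 1 / 2 -> exists r, 0 < r /\ forall u, 0 <= u <= 1 -> u <= 1 / 2 ->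
       Rabs (t - u) < r -> dR2 (al (2 * t)) (al (2 * u)) < e).
    { intros h. destruct (A1 (2 * t)) with (eps := e) as [r [Hr Fr]]; auto; [lra |].
      exists (r / 2). split; [lra |]. intros u Hu h' Hd. apply Fr; [lra |].
      replace (2 * t - 2 * u) with (2 * (t - u)) by ring.
      rewrite Rabs_mult, (Rabs_pos_eq 2); lra. }
    assert (Cb : 1 / 2 <= t -> exists r, 0 < r /\ forall u, 0 <= u <= 1 -> 1 / 2 <= u ->
       Rabs (t - u) < r -> dR2 (be (2 * t - 1)) (be (2 * u - 1)) < e).
    { intros h. destruct (B1 (2 * t - 1)) with (eps := e) as [r [Hr Fr]]; auto; [lra |].
      exists (r / 2). split; [lra |]. intros u Hu h' Hd. apply Fr; [lra |].
      replace (2 * t - 1 - (2 * u - 1)) with (2 * (t - u)) by ring.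
      rewrite Rabs_mult, (Rabs_pos_eq 2); lra. }
    destruct (Rtotal_order t (1 / 2)) as [h | [h | h]].
    + destruct Ca as [r [Hr Fr]]; [lra |]. exists (Rmin r (1 / 2 - t)).
      split; [apply Rmin_glb_lt; lra |]. intros u Hu Hd.
      pose proof (Rmin_l r (1 / 2 - t)). pose proof (Rmin_r r (1 / 2 - t)).
      assert (Hd' : Rabs (t - u) < 1 / 2 - t) by lra. apply Rabs_def2 in Hd'.
      destruct (Rle_dec t (1 / 2)); [| lra]. destruct (Rle_dec u (1 / 2)); [| lra].
      apply Fr; auto; lra.
    + destruct Ca as [r [Hr Fr]]; [lra |]. destruct Cb as [r' [Hr' Fr']]; [lra |].
      exists (Rmin r r'). split; [apply Rmin_glb_lt; lra |]. intros u Hu Hd.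
      pose proof (Rmin_l r r'). pose proof (Rmin_r r r').
      destruct (Rle_dec t (1 / 2)); [| lra]. destruct (Rle_dec u (1 / 2)).
      * apply Fr; auto; lra.
      * replace (al (2 * t)) with (be (2 * t - 1)); [apply Fr'; lra |].
        replace (2 * t - 1) with 0 by lra. replace (2 * t) with 1 by lra. congruence.
    + destruct Cb as [r [Hr Fr]]; [lra |]. exists (Rmin r (t - 1 / 2)).
      split; [apply Rmin_glb_lt; lra |]. intros u Hu Hd.
      pose proof (Rmin_l r (t - 1 / 2)). pose proof (Rmin_r r (t - 1 / 2)).
      assert (Hd' : Rabs (t - u) < t - 1 / 2) by lra. apply Rabs_def2 in Hd'.
      destruct (Rle_dec t (1 / 2)); [lra |]. destruct (Rle_dec u (1 / 2)); [lra |].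
      apply Fr; lra.
  - intros t Ht. destruct (Rle_dec t (1 / 2)); [apply A1' | apply B1']; lra.
  - split; [| split].
    + destruct (Rle_dec 0 (1 / 2)); [| lra]. rewrite Rmult_0_r. auto.
    + destruct (Rle_dec 1 (1 / 2)); [lra |]. replace (2 * 1 - 1) with 1 by ring. auto.
    + intros t Ht. destruct (Rle_dec t (1 / 2)); [apply A4 | apply B4]; lra.
Qed.

Lemma joined_near (T : R * R -> Prop) z : closed_in dR2 cdisc T -> cdisc z -> ~ T z ->
  exists r, 0 < r /\ forall z', cdisc z' -> dR2 z z' < r -> joined T z z'.
Proof.
  intros CT Dz NT. destruct (not_closed_in _ _ _ z CT Dz NT) as [r [Hr Fr]].
  exists r. split; auto. intros z' Dz' Hd. apply joined_seg; auto.
  intros s Hs Ht. specialize (Fr _ Ht).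
  assert (E : dR2 z (seg z z' s) ^ 2 = s ^ 2 * dR2 z z' ^ 2).
  { rewrite !dR2_sq. unfold seg; cbn [fst snd]. ring. }
  pose proof (proj1 dR2_metric z z'). pose proof (proj1 dR2_metric z (seg z z' s)).
  assert (dR2 z (seg z z' s) ^ 2 <= dR2 z z' ^ 2).
  { rewrite E. pose proof (pow2_ge_0 (dR2 z z')). assert (s ^ 2 <= 1) by nra.
    rewrite <- (Rmult_1_l (dR2 z z' ^ 2)) at 2. apply Rmult_le_compat_r; auto. }
  assert (dR2 z (seg z z' s) <= dR2 z z'); [| lra].
  apply Rsqr_incr_0; auto. unfold Rsqr. lra.
Qed.

(** [T] together with all that it separates from the bottom point of the disc. Using paths, openness
    off [T] follows from short segments and separation from [arcs_cross]. *)
Definition region (T : R * R -> Prop) (z : R * R) : Prop := cdisc z /\ ~ joined T (0, -1) z.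

(** A closed [S] that is relatively open off [T], so that its frontier in the disc lies in [T];
    logarithms over [T] can then be extended across either side. *)
Definition cut (w : R * R -> R * R) (S T : R * R -> Prop) : Prop :=
  (forall z, S z -> cdisc z) /\ closed_in dR2 cdisc S /\ closed_in dR2 cdisc T /\
  (forall z, T z -> S z) /\
  (forall z, S z -> ~ T z -> exists r, 0 < r /\ forall z', cdisc z' -> dR2 z z' < r -> S z') /\
  log_trivial dR2 (preim w T).

Lemma region_cut w ga : is_path ga -> log_trivial dR2 (preim w (trace ga)) ->
  cut w (region (trace ga)) (trace ga).
Proof.
  intros P L. pose proof (trace_closed ga P) as CT.
  split; [intros z [H _]; auto |]. split; [| split; [| split; [| split]]]; auto.
  - intros z Dz Hz. split; auto. intros J.
    assert (NT : ~ trace ga z).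
    { destruct J as [al [_ [_ [<- A]]]]. apply A. lra. }
    destruct (joined_near _ z CT Dz NT) as [r [Hr Fr]].
    destruct (Hz r Hr) as [a [[Da Ja] Hd]]. apply Ja. eapply joined_trans; eauto.
  - intros z Hz. split.
    + destruct Hz as [t [Ht <-]]. apply P; auto.
    + intros [al [_ [_ [A1 A2]]]]. apply (A2 1); [lra |]. rewrite A1. auto.
  - intros z [Dz Jz] NT. destruct (joined_near _ z CT Dz NT) as [r [Hr Fr]].
    exists r. split; auto. intros z' Dz' Hd. split; auto. intro J. apply Jz.
    eapply joined_trans; [apply J |]. apply joined_sym. auto.
Qed.

(** An arc near [C] joining its two boundary points crosses every path from the top to the bottom of
    the disc. [E] hangs on the top point by segments far from [C], hence is cut off from the bottom;
    [Q] reaches the bottom without coming near [C], hence is not. *)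
Lemma separating_cut w (C E Q : R * R -> Prop) eta dl k :
  disc_map w -> (forall z, C z -> cdisc z) -> connected_set dR2 C -> 0 < eta ->
  0 < dl -> dl ^ 2 + k ^ 2 = 1 -> C (- dl, k) -> C (dl, k) ->
  (forall z, E z -> cdisc z /\ forall s, 0 <= s <= 1 -> E (seg (0, 1) z s)) ->
  (forall z c, E z -> C c -> eta <= dR2 c z) ->
  (forall z, Q z -> joined (fun z => exists c, C c /\ dR2 c z < eta) (0, -1) z) ->
  exists S T, cut w S T /\ (forall z, T z -> cdisc z /\ exists c, C c /\ dR2 c z < eta) /\
    (forall z, E z -> S z) /\ (forall z, S z -> ~ Q z).
Proof.
  intros W CD CC Heta Hdl Hk C1 C2 HE Efar HQ.
  destruct (disc_map_arcs w W C eta (- dl, k) (dl, k)) as [ga [P [G0 [G1 [Gn L]]]]]; auto.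
  { intros H. injection H. lra. }
  exists (region (trace ga)), (trace ga). split; [apply region_cut; auto |].
  split; [| split].
  - intros z [t [Ht <-]]. split; [apply P; auto | auto].
  - intros z Ez. destruct (HE z Ez) as [Dz Hz]. split; auto. intro J.
    assert (J1 : joined (trace ga) (0, 1) z).
    { apply joined_seg; auto; [unfold cdisc; simpl; lra |].
      intros s Hs [t [Ht Et]]. destruct (Gn t Ht) as [c [Cc Hc]]. rewrite Et in Hc.
      specialize (Efar _ c (Hz s Hs) Cc). lra. }
    destruct (joined_trans _ _ _ _ J1 (joined_sym _ _ _ J)) as [al [[A1 A1'] [A2 [A3 A4]]]].
    destruct P as [P1 P2].
    destruct (arcs_cross dl k ga al) as [s [t [Hs [Ht Est]]]]; auto.
    apply (A4 t Ht). exists s. auto.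
  - intros z [Dz NJ] Qz. apply NJ. eapply joined_mono; [| apply HQ; auto].
    intros x _ [t [Ht <-]]. auto.
Qed.

Lemma cont_preim_closed w (A : R * R -> Prop) :
  (forall p, cdisc p -> cdisc (w p)) -> cont_on dR2 dR2 cdisc w ->
  closed_in dR2 cdisc A -> closed_in dR2 cdisc (preim w A).
Proof.
  intros Dw Cw CA p Dp Hp. split; auto. apply CA; auto.
  intros eps He. destruct (Cw p Dp eps He) as [r [Hr Fr]].
  destruct (Hp r Hr) as [a [[Da Aa] Hd]]. exists (w a). auto.
Qed.

Lemma preim_closed w (A : R * R -> Prop) :
  disc_map w -> closed_in dR2 cdisc A -> closed_in dR2 cdisc (preim w A).
Proof.
  intros W. apply cont_preim_closed; [apply disc_map_in | apply disc_map_cont]; auto.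
Qed.

Lemma preim_compact w (A : R * R -> Prop) :
  closed_in dR2 cdisc (preim w A) -> cluster_compact dR2 (preim w A).
Proof.
  intros CA. apply closed_in_compact with cdisc; auto using dR2_metric, cdisc_compact.
  intros x [H _]; auto.
Qed.

Lemma cut_open w S T p : disc_map w -> cut w S T -> cdisc p -> S (w p) -> ~ T (w p) ->
  exists r, 0 < r /\ forall p', cdisc p' -> dR2 p p' < r -> S (w p') /\ ~ T (w p').
Proof.
  intros W [_ [CS [CT [_ [OS _]]]]] Dp Sp NT.
  destruct (OS _ Sp NT) as [r [Hr Fr]].
  destruct (not_closed_in _ _ _ _ CT (disc_map_in w W p Dp) NT) as [s [Hs Fs]].
  destruct (disc_map_cont w W p Dp (Rmin r s)) as [q [Hq Fq]]; [apply Rmin_glb_lt; auto |].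
  exists q. split; auto. intros p' Dp' Hd. specialize (Fq p' Dp' Hd).
  pose proof (Rmin_l r s). pose proof (Rmin_r r s). split.
  - apply Fr; [apply disc_map_in; auto | lra].
  - intro Tp. specialize (Fs _ Tp). lra.
Qed.

(* A logarithm over the boundary part [T] extends the map to the rest of the disc. *)
Lemma cut_log_trivial w S T : disc_map w -> cut w S T -> log_trivial dR2 (preim w S).
Proof.
  intros W HC f g [Cf [Cg U]]. pose proof HC as [SD [CS [CT [TS [OS L]]]]].
  assert (Sub : forall p, preim w T p -> preim w S p) by (intros p [H1 H2]; split; auto).
  destruct (L f g) as [th [Cth Hth]].
  { apply circle_map_sub with (preim w S); auto. split; auto. }
  destruct (tietze dR2 cdisc (preim w T) th) as [Th [CTh ETh]]; auto.
  { apply is_metric_on, dR2_metric. }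
  { intros p [H _]; auto. }
  { apply preim_compact, preim_closed; auto. }
  set (N := fun p => ~ S (w p)).
  assert (Glue : forall (e : R -> R) F, contR dR2 cdisc (fun p => e (Th p)) ->
     contR dR2 (preim w S) F -> (forall p, preim w T p -> e (th p) = F p) ->
     contR dR2 cdisc (fun p => if excluded_middle_informative (N p) then e (Th p) else F p)).
  { intros e F Ce CF EF. apply (contR_glue dR2 cdisc N (fun p => e (Th p)) F); auto.
    - intros p Dp Np.
      destruct (not_closed_in _ _ _ p (preim_closed w S W CS) Dp) as [r [Hr Fr]].
      { intros [_ H]; auto. }
      exists r. split; auto. intros y Dy Hd Sy. assert (H : preim w S y) by (split; auto).
      specialize (Fr y H). lra.
    - apply contR_sub with (preim w S); auto. intros p [Dp NN]. split; auto.
      apply NNPP; auto.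
    - intros p Dp NN. apply NNPP in NN. destruct (classic (T (w p))) as [Tp | NT].
      + left. assert (H : preim w T p) by (split; auto). rewrite ETh; auto.
      + right. destruct (cut_open w S T p W HC Dp NN NT) as [r [Hr Fr]]. exists r. split; auto.
        intros y Dy Hd Ny. apply Ny. apply Fr; auto. }
  set (F := fun p => if excluded_middle_informative (N p) then cos (Th p) else f p).
  set (G := fun p => if excluded_middle_informative (N p) then sin (Th p) else g p).
  destruct (cdisc_log_trivial F G) as [ph [Cph Hph]].
  { split; [| split].
    - apply Glue; auto; [contR_auto | apply Hth].
    - apply Glue; auto; [contR_auto | apply Hth].
    - intros p Dp. unfold F, G. destruct (excluded_middle_informative (N p)) as [n | n].
      + apply cos_sin_2.
      + apply U. split; auto. apply NNPP; auto. }
  exists ph. split; [apply contR_sub with cdisc; auto; intros p [H _]; auto |].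
  intros p [Dp Sp]. destruct (Hph p Dp) as [A B]. unfold F, G in A, B.
  destruct (excluded_middle_informative (N p)) as [n | n]; [exfalso; apply n; auto | auto].
Qed.

(* If [x0] lay in the part [O] of [V] off [T], the direction map from [x0] would extend over [O],
   contradicting the no-retraction theorem. *)
Lemma cut_component w S T (U V : R * R -> Prop) :
  disc_map w -> cut w S T -> is_open dR2 U -> is_open dR2 V ->
  (forall p, U p -> V p -> False) ->
  (forall p, cdisc p -> S (w p) -> U p \/ V p) ->
  (forall p, circle p -> S (w p) -> ~ V p) ->
  forall p, cdisc p -> S (w p) -> V p -> T (w p).
Proof.
  intros W HC OU OV Dis Cov NC x0 D0 S0 V0. apply NNPP. intro NT0.
  pose proof HC as [SD [CS [CT [TS [OS L]]]]]. pose proof dR2_metric as [M0 [M1 [M2 M3]]].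
  set (n := fun z : R * R => dR2 z x0).
  set (f := fun z : R * R => (fst z - fst x0) / n z).
  set (g := fun z : R * R => (snd z - snd x0) / n z).
  assert (Cn : forall K, contR dR2 K n).
  { intros K. unfold n, dR2. contR_auto; auto using contR_fst, contR_snd. }
  assert (Np : forall z, z <> x0 -> 0 < n z).
  { intros z Hz. destruct (M0 z x0) as [h | h]; auto. exfalso. apply Hz, M1. auto. }
  assert (Cf : forall K : R * R -> Prop, (forall z, K z -> z <> x0) -> contR dR2 K f).
  { intros K HK. apply contR_div; [| apply Cn |].
    - contR_auto. apply contR_fst.
    - intros z Kz. apply Rgt_not_eq, Np; auto. }
  assert (Cg : forall K : R * R -> Prop, (forall z, K z -> z <> x0) -> contR dR2 K g).
  { intros K HK. apply contR_div; [| apply Cn |].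
    - contR_auto. apply contR_snd.
    - intros z Kz. apply Rgt_not_eq, Np; auto. }
  assert (Ufg : forall z, z <> x0 -> f z ^ 2 + g z ^ 2 = 1).
  { intros z Hz. specialize (Np z Hz). unfold f, g.
    transitivity (((fst z - fst x0) ^ 2 + (snd z - snd x0) ^ 2) / n z ^ 2); [field; lra |].
    rewrite <- dR2_sq. unfold n in *. field. lra. }
  assert (NTx : forall z, preim w T z -> z <> x0).
  { intros z [_ Hz] ->. auto. }
  destruct (L f g) as [th [Cth Hth]]; [split; auto; split; auto |].
  destruct (tietze dR2 cdisc (preim w T) th) as [Th [CTh ETh]]; auto.
  { apply is_metric_on, dR2_metric. }
  { intros p [H _]; auto. }
  { apply preim_compact, preim_closed; auto. }
  set (O := fun p => S (w p) /\ V p /\ ~ T (w p)).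
  assert (O0 : O x0) by (unfold O; auto).
  assert (Glue : forall (e : R -> R) F, contR dR2 cdisc (fun p => e (Th p)) ->
     contR dR2 (fun p => cdisc p /\ ~ O p) F -> (forall p, preim w T p -> e (th p) = F p) ->
     contR dR2 cdisc (fun p => if excluded_middle_informative (O p) then e (Th p) else F p)).
  { intros e F Ce CF EF. apply (contR_glue dR2 cdisc O (fun p => e (Th p)) F); auto.
    - intros p Dp [Sp [Vp NT]].
      destruct (cut_open w S T p W HC Dp Sp NT) as [r [Hr Fr]].
      destruct (OV p Vp) as [s [Hs Fs]]. exists (Rmin r s).
      split; [apply Rmin_glb_lt; auto |]. intros y Dy Hd.
      pose proof (Rmin_l r s). pose proof (Rmin_r r s).
      destruct (Fr y Dy ltac:(lra)). split; auto. split; auto. apply Fs. lra.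
    - intros p Dp NO. destruct (classic (T (w p))) as [Tp | NT].
      + left. assert (H : preim w T p) by (split; auto). rewrite ETh; auto.
      + right. destruct (classic (S (w p))) as [Sp | NS].
        * destruct (Cov p Dp Sp) as [Up | Vp].
          -- destruct (OU p Up) as [r [Hr Fr]]. exists r. split; auto.
             intros y Dy Hd [_ [Vy _]]. apply (Dis y); auto.
          -- exfalso. apply NO. split; auto.
        * destruct (not_closed_in _ _ _ p (preim_closed w S W CS) Dp) as [r [Hr Fr]].
          { intros [_ H]; auto. }
          exists r. split; auto. intros y Dy Hd [Sy _].
          assert (H : preim w S y) by (split; auto). specialize (Fr y H). lra. }
  assert (NOx : forall z, cdisc z /\ ~ O z -> z <> x0) by (intros z [_ H] ->; auto).
  apply (no_circle_map_cdisc
    (fun p => if excluded_middle_informative (O p) then cos (Th p) else f p)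
    (fun p => if excluded_middle_informative (O p) then sin (Th p) else g p)).
  - split; [| split].
    + apply Glue; auto; [contR_auto | apply Hth].
    + apply Glue; auto; [contR_auto | apply Hth].
    + intros p Dp. destruct (excluded_middle_informative (O p)) as [o | o].
      * apply cos_sin_2.
      * apply Ufg. intros ->. auto.
  - intros z Hz. destruct (excluded_middle_informative (O z)) as [[Sz [Vz _]] | o].
    { exfalso. eapply NC; eauto. }
    assert (Hzx : z <> x0) by (intros ->; auto). specialize (Np z Hzx).
    (* Points of [V] over [S] are off the circle, so [x0] is interior. Seen from it, the direction
       of a circle point [z] has nonnegative inner product with [z], so it is not antipodal. *)
    assert (In : fst x0 ^ 2 + snd x0 ^ 2 < 1).
    { destruct D0 as [h | h]; auto. exfalso. apply (NC x0); auto. }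
    unfold f, g.
    replace ((fst z - fst x0) / n z * fst z + (snd z - snd x0) / n z * snd z)
      with (((fst z - fst x0) * fst z + (snd z - snd x0) * snd z) / n z) by (field; lra).
    apply Rlt_le_trans with 0; [lra |]. apply Rdiv_le_0_compat; auto.
    unfold circle in Hz. pose proof (pow2_ge_0 (fst z - fst x0)).
    pose proof (pow2_ge_0 (snd z - snd x0)). lra.
Qed.

Lemma log_trivial_disjoint (A B : R * R -> Prop) :
  closed_in dR2 cdisc A -> closed_in dR2 cdisc B ->
  (forall x, A x -> cdisc x) -> (forall x, B x -> cdisc x) -> (forall x, A x -> ~ B x) ->
  log_trivial dR2 A -> log_trivial dR2 B -> log_trivial dR2 (fun x => A x \/ B x).
Proof.
  intros CA CB AD BD Dis LA LB f g Hfg.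
  destruct (LA f g) as [ta [Ca Ha]].
  { apply circle_map_sub with (fun x => A x \/ B x); auto. }
  destruct (LB f g) as [tb [Cb Hb]].
  { apply circle_map_sub with (fun x => A x \/ B x); auto. }
  destruct (tietze dR2 cdisc A ta) as [Ta [CTa ETa]]; auto.
  { apply is_metric_on, dR2_metric. }
  { apply closed_in_compact with cdisc; auto using dR2_metric, cdisc_compact. }
  exists (fun x => if excluded_middle_informative (A x) then Ta x else tb x). split.
  - apply (contR_glue dR2 _ A Ta tb).
    + intros x _ Ax.
      destruct (not_closed_in _ _ _ x CB (AD x Ax) (Dis x Ax)) as [r [Hr Fr]].
      exists r. split; auto. intros y [Ay | By] Hd; auto. specialize (Fr y By). lra.
    + apply contR_sub with cdisc; auto. intros x [Ax | Bx]; auto.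
    + apply contR_sub with B; auto. intros x [[Ax | Bx] NA]; auto. contradiction.
    + intros x [Ax | Bx] NA; [contradiction |]. right.
      destruct (not_closed_in _ _ _ x CA (BD x Bx) NA) as [r [Hr Fr]].
      exists r. split; auto. intros y _ Hd Ay. specialize (Fr y Ay). lra.
  - intros x Hx. destruct (excluded_middle_informative (A x)) as [Ax | NA].
    + rewrite ETa; auto.
    + destruct Hx; [contradiction | auto].
Qed.

(* Mayer-Vietoris: a separation of the intersection would give a map of degree one on the union. *)
Lemma inter_connected (A B : R * R -> Prop) :
  closed_in dR2 cdisc A -> closed_in dR2 cdisc B ->
  (forall x, A x -> cdisc x) -> (forall x, B x -> cdisc x) ->
  connected_set dR2 A -> connected_set dR2 B ->
  log_trivial dR2 (fun x => A x \/ B x) -> connected_set dR2 (fun x => A x /\ B x).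
Proof.
  intros CA CB AD BD HA HB L Sep.
  destruct (connected_disjoint _ _ dR2_metric (fun F => F Sep))
    as [U [V [OU [OV [Cov [[a [[Aa Ba] Ua]] [[b [[Ab Bb] Vb]] Dis]]]]]]].
  (* Its exponential is identically 1, so the exponential of the extension [u] on [B] and the
     constant 1 on [A] fit together. A logarithm of the result is constant on [A] and differs from
     [u] by a constant on [B], whereas [u] rises by 2 pi from [a] to [b]. *)
  set (chi := fun x => if excluded_middle_informative (U x) then 0 else 2 * PI).
  destruct (tietze dR2 cdisc (fun x => A x /\ B x) chi) as [u [Cu Eu]].
  - apply is_metric_on, dR2_metric.
  - intros x [Ax _]; auto.
  - apply closed_in_compact with cdisc; auto using dR2_metric, cdisc_compact.
    + intros x [Ax _]; auto.
    + intros x Dx Hx. split; [apply CA | apply CB]; auto; intros e He;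
        destruct (Hx e He) as [y [[? ?] ?]]; eauto.
  - unfold chi. apply (contR_glue dR2 _ U (fun _ => 0) (fun _ => 2 * PI)); try apply contR_const.
    + intros x _ Ux. destruct (OU x Ux) as [r [Hr Fr]]. exists r. auto.
    + intros x Hx NU. right. destruct (Cov x Hx) as [h | Vx]; [contradiction |].
      destruct (OV x Vx) as [r [Hr Fr]]. exists r. split; auto. intros y _ Hd Uy.
      apply (Dis y); auto.
  - assert (Cchi : forall x, cos (chi x) = 1 /\ sin (chi x) = 0).
    { intros x. unfold chi. destruct (excluded_middle_informative (U x)).
      - rewrite cos_0, sin_0; auto.
      - rewrite cos_2PI, sin_2PI; auto. }
    assert (G : forall (e : R -> R) c, (forall x, e (chi x) = c) ->
       contR dR2 cdisc (fun x => e (u x)) ->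
       contR dR2 (fun x => A x \/ B x)
         (fun x => if excluded_middle_informative (~ A x) then e (u x) else c)).
    { intros e c Ee Ce.
      apply (contR_glue dR2 _ (fun x => ~ A x) (fun x => e (u x)) (fun _ => c)).
      - intros x Hx NA. assert (Dx : cdisc x) by (destruct Hx; auto).
        destruct (not_closed_in _ _ _ x CA Dx NA) as [r [Hr Fr]].
        exists r. split; auto. intros y _ Hd Ay. specialize (Fr y Ay). lra.
      - apply contR_sub with cdisc; auto. intros x [Ax | Bx]; auto.
      - apply contR_const.
      - intros x Hx NN. apply NNPP in NN. destruct (classic (B x)) as [Bx | NB].
        + left. rewrite Eu; auto.
        + right. destruct (not_closed_in _ _ _ x CB (AD x NN) NB) as [r [Hr Fr]].
          exists r. split; auto. intros y [Ay | By] Hd NA; [contradiction |].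
          specialize (Fr y By). lra. }
    destruct (L (fun x => if excluded_middle_informative (~ A x) then cos (u x) else 1)
                (fun x => if excluded_middle_informative (~ A x) then sin (u x) else 0))
      as [ph [Cph Hph]].
    { split; [| split].
      - apply G; [apply Cchi | contR_auto].
      - apply G; [apply Cchi | contR_auto].
      - intros x _. destruct (excluded_middle_informative (~ A x)); [apply cos_sin_2 | ring]. }
    assert (E1 : ph a = ph b).
    { apply (connected_cos1 dR2 A ph a b dR2_metric HA); auto.
      - apply contR_sub with (fun x => A x \/ B x); auto.
      - intros x Ax. destruct (Hph x (or_introl Ax)) as [P _].
        destruct (excluded_middle_informative (~ A x)); [contradiction | auto]. }
    assert (E2 : ph a - u a = ph b - u b).
    { apply (connected_cos1 dR2 B (fun x => ph x - u x) a b dR2_metric HB); auto.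
      - apply contR_minus; [apply contR_sub with (fun x => A x \/ B x)
                           | apply contR_sub with cdisc]; auto.
      - intros x Bx. destruct (Hph x (or_intror Bx)) as [P Q]. rewrite cos_minus, P, Q.
        destruct (excluded_middle_informative (~ A x)) as [NA | NN].
        + pose proof (cos_sin_2 (u x)). lra.
        + apply NNPP in NN. rewrite Eu by auto. destruct (Cchi x) as [-> ->]. ring. }
    rewrite !Eu in E2 by auto. unfold chi in E2.
    destruct (excluded_middle_informative (U a)); [| contradiction].
    destruct (excluded_middle_informative (U b)); [exfalso; eauto |].
    pose proof PI_RGT_0. lra.
Qed.

Lemma closed_in_and {T : Type} (d : T -> T -> R) (Y A B : T -> Prop) :
  closed_in d Y A -> closed_in d Y B -> closed_in d Y (fun x => A x /\ B x).
Proof.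
  intros CA CB x Yx Hx. split; [apply CA | apply CB]; auto; intros e He;
    destruct (Hx e He) as [y [[? ?] ?]]; eauto.
Qed.

(** * Connectedness of fibers *)

(* [sg = 1] is a rotation, [sg = -1] a reflection. *)
Definition orth (c s sg : R) (z : R * R) : R * R :=
  (c * fst z - sg * (s * snd z), s * fst z + sg * (c * snd z)).

Definition orth_inv (c s sg : R) (z : R * R) : R * R :=
  (c * fst z + s * snd z, sg * (c * snd z - s * fst z)).

Lemma orth_orth_inv c s sg z : c ^ 2 + s ^ 2 = 1 -> sg ^ 2 = 1 ->
  orth c s sg (orth_inv c s sg z) = z.
Proof.
  intros H H'. destruct z as [x y]. unfold orth, orth_inv; cbn [fst snd]. f_equal.
  - transitivity (x * (c ^ 2 + sg ^ 2 * s ^ 2) + y * c * s * (1 - sg ^ 2)); [ring |].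
    rewrite H'. replace (c ^ 2 + 1 * s ^ 2) with 1 by lra. ring.
  - transitivity (y * (s ^ 2 + sg ^ 2 * c ^ 2) + x * c * s * (1 - sg ^ 2)); [ring |].
    rewrite H'. replace (s ^ 2 + 1 * c ^ 2) with 1 by lra. ring.
Qed.

Lemma orth_inv_orth c s sg z : c ^ 2 + s ^ 2 = 1 -> sg ^ 2 = 1 ->
  orth_inv c s sg (orth c s sg z) = z.
Proof.
  intros H H'. destruct z as [x y]. unfold orth, orth_inv; cbn [fst snd]. f_equal.
  - transitivity (x * (c ^ 2 + s ^ 2)); [ring |]. rewrite H. ring.
  - transitivity (sg ^ 2 * y * (c ^ 2 + s ^ 2)); [ring |]. rewrite H, H'. ring.
Qed.

Lemma orth_sq c s sg z : c ^ 2 + s ^ 2 = 1 -> sg ^ 2 = 1 ->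
  fst (orth c s sg z) ^ 2 + snd (orth c s sg z) ^ 2 = fst z ^ 2 + snd z ^ 2.
Proof.
  intros H H'. unfold orth; cbn [fst snd].
  transitivity ((c ^ 2 + s ^ 2) * (fst z ^ 2 + sg ^ 2 * snd z ^ 2)); [ring |].
  rewrite H, H'. ring.
Qed.

Lemma dR2_orth c s sg z z' : c ^ 2 + s ^ 2 = 1 -> sg ^ 2 = 1 ->
  dR2 (orth c s sg z) (orth c s sg z') = dR2 z z'.
Proof.
  intros H H'. unfold dR2. f_equal. unfold orth; cbn [fst snd].
  transitivity ((c ^ 2 + s ^ 2) * ((fst z - fst z') ^ 2 + sg ^ 2 * (snd z - snd z') ^ 2)); [ring |].
  rewrite H, H'. ring.
Qed.

Lemma disc_map_orth w c s sg : c ^ 2 + s ^ 2 = 1 -> sg ^ 2 = 1 ->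
  disc_map w -> disc_map (fun p => orth c s sg (w p)).
Proof.
  intros H H' W. set (o := orth c s sg). set (oi := orth_inv c s sg).
  assert (Eo : forall z, o (oi z) = z) by (intros; apply orth_orth_inv; auto).
  assert (Ei : forall z, oi (o z) = z) by (intros; apply orth_inv_orth; auto).
  assert (Ed : forall z z', dR2 (o z) (o z') = dR2 z z') by (intros; apply dR2_orth; auto).
  assert (Edi : forall z z', dR2 (oi z) (oi z') = dR2 z z').
  { intros. rewrite <- Ed, !Eo. auto. }
  assert (Es : forall z, fst (o z) ^ 2 + snd (o z) ^ 2 = fst z ^ 2 + snd z ^ 2)
    by (intros; apply orth_sq; auto).
  assert (Esi : forall z, fst (oi z) ^ 2 + snd (oi z) ^ 2 = fst z ^ 2 + snd z ^ 2).
  { intros. rewrite <- Es, Eo. auto. }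
  assert (Co : forall (T : Type) (d : T -> T -> R) S f,
     cont_on d dR2 S f -> cont_on d dR2 S (fun x => o (f x))).
  { intros T d S f Cf x Sx e He. destruct (Cf x Sx e He) as [r [Hr Fr]]. exists r.
    split; auto. intros. rewrite Ed. auto. }
  constructor.
  - intros p Dp. unfold cdisc. rewrite Es. apply (disc_map_in w W p Dp).
  - apply Co, disc_map_cont; auto.
  - intros p Cp. unfold circle. rewrite Es. apply (disc_map_circle w W p Cp).
  - intros e Ce. apply connected_ext with (fun p => circle p /\ w p = oi e).
    + intros p. split; intros [A B]; split; auto; [rewrite B; auto | rewrite <- B; auto].
    + apply (disc_map_monotone w W). unfold circle. rewrite Esi. auto.
  - intros C eta x y CD CC Heta Cx Cy Hxy.
    destruct (disc_map_arcs w W (fun z => exists u, C u /\ oi u = z) eta (oi x) (oi y))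
      as [ga [[P1 P2] [G0 [G1 [Gn L]]]]]; eauto.
    + intros z [u [Cu <-]]. unfold cdisc. rewrite Esi. apply CD; auto.
    + apply (connected_image _ dR2 C oi dR2_metric dR2_metric CC).
      intros z _ e He. exists e. split; auto. intros. rewrite Edi. auto.
    + intros E. apply Hxy. rewrite <- (Eo x), E, Eo. auto.
    + exists (fun t => o (ga t)). split; [split; [apply Co; auto |] |].
      * intros t Ht. unfold cdisc. rewrite Es. apply P2; auto.
      * rewrite G0, G1, !Eo. split; auto. split; auto. split.
        -- intros t Ht. destruct (Gn t Ht) as [z [[u [Cu <-]] Hz]]. exists u. split; auto.
           rewrite <- Ed, Eo in Hz. auto.
        -- apply log_trivial_ext with (preim w (trace ga)); auto.
           intros p. split; intros [Dp [t [Ht E]]]; split; auto; exists t; split; auto.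
           ++ rewrite E. auto.
           ++ rewrite <- (Ei (ga t)), E, Ei. auto.
Qed.


(** The arc follows the horizontal chord at height [- del]. Its half-length and its height are the
    [dl] and [k] of [separating_cut]; the tolerance [del / 2] keeps the arc strictly below the
    axis. *)
Lemma strip_cut w del : disc_map w -> 0 < del <= 1 / 4 ->
  exists S T, cut w S T /\ (forall z, T z -> cdisc z /\ - 2 * del < snd z < 0) /\
    (forall z, cdisc z -> 0 <= snd z -> S z) /\ (forall z, S z -> - 2 * del < snd z).
Proof.
  intros W Hd.
  assert (Hk : 0 < 1 - del ^ 2) by nra.
  assert (Hs : sqrt (1 - del ^ 2) ^ 2 + (- del) ^ 2 = 1) by (rewrite pow2_sqrt; lra).
  pose proof (sqrt_lt_R0 _ Hk) as Hs0. set (k := sqrt (1 - del ^ 2)) in *.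
  destruct (separating_cut w (fun z => cdisc z /\ snd z = - del)
    (fun z => cdisc z /\ 0 <= snd z) (fun z => cdisc z /\ snd z <= - 2 * del) (del / 2) k (- del))
    as [S [T [HC [HT [HE HQ]]]]]; auto.
  - tauto.
  - apply connected_segs with (0, - del).
    + tauto.
    + unfold cdisc; cbn [fst snd]. split; auto. nra.
    + intros z [Dz Ez] s Hs'. split.
      * apply cdisc_seg; auto. unfold cdisc; cbn [fst snd]. nra.
      * unfold seg; cbn [fst snd]. rewrite Ez. ring.
  - lra.
  - split; auto. unfold cdisc; cbn [fst snd]. lra.
  - split; auto. unfold cdisc; cbn [fst snd]. lra.
  - intros z [Dz Ez]. split; [auto |]. intros s Hs'. split.
    + apply cdisc_seg; auto. unfold cdisc; cbn [fst snd]. lra.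
    + unfold seg; cbn [fst snd]. nra.
  - intros z c [Dz Ez] [Dc Ec]. pose proof (dR2_snd c z). rewrite Ec in H.
    rewrite <- Rabs_Ropp, Rabs_pos_eq in H; lra.
  - intros z [Dz Ez]. apply joined_seg; auto; [unfold cdisc; cbn [fst snd]; lra |].
    intros s Hs' [c [[Dc Ec] Hc]]. pose proof (dR2_snd c (seg (0, -1) z s)). rewrite Ec in H.
    unfold seg in H at 1; cbn [fst snd] in H.
    assert (H1 : Rabs (- del - ((1 - s) * -1 + s * snd z)) < del) by lra.
    apply Rabs_def2 in H1. nra.
  - exists S, T. split; auto. split; [| split].
    + intros z Tz. destruct (HT z Tz) as [Dz [c [[Dc Ec] Hc]]]. split; auto.
      pose proof (dR2_snd c z). rewrite Ec in H.
      assert (H1 : Rabs (- del - snd z) < del / 2) by lra. apply Rabs_def2 in H1. lra.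
    + intros z Dz Hz. apply HE; auto.
    + intros z Sz. apply Rnot_le_lt. intro h. apply (HQ z Sz). split; auto.
      destruct HC as [SD _]. auto.
Qed.

(** The chord itself is not biLipschitz. A circle map on its preimage extends without zeros to the
    preimage of a thin strip, and a strip between an arc below and an arc above is a cut, so the
    normalized extension has a logarithm. *)
Lemma chord_preim_log_trivial w : disc_map w -> log_trivial dR2 (preim w (fun z => snd z = 0)).
Proof.
  intros W f g [Cf [Cg U]]. pose proof dR2_metric as [M0 [M1 [M2 M3]]].
  assert (Csw : contR dR2 cdisc (fun p => snd (w p))) by (apply cont_snd, disc_map_cont; auto).
  assert (Cmp : cluster_compact dR2 (preim w (fun z => snd z = 0))).
  { apply preim_compact, preim_closed; auto. intros z Dz Hz.
    apply cond_eq. intros e He. destruct (Hz e He) as [a [Ha Hd]].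
    pose proof (dR2_snd z a). rewrite Ha in H. lra. }
  assert (Sub : forall p, preim w (fun z => snd z = 0) p -> cdisc p) by (intros p [H _]; auto).
  destruct (tietze dR2 cdisc _ f (is_metric_on _ _ dR2_metric) Sub Cmp Cf) as [F [CF EF]].
  destruct (tietze dR2 cdisc _ g (is_metric_on _ _ dR2_metric) Sub Cmp Cg) as [G [CG EG]].
  set (q := fun p => F p ^ 2 + G p ^ 2).
  assert (Cq : contR dR2 cdisc q) by (unfold q; contR_auto).
  (* The factor 2 matches the bound [2 * del] on the width of the strip in [strip_cut]. *)
  destruct (compact_uniform dR2 cdisc (fun n p => Rabs (snd (w p)) < 2 * / INR (S n) -> 0 < q p)
    cdisc_compact) as [n Hn].
  { intros l Dl. destruct (Req_dec (snd (w l)) 0) as [E | NE].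
    - destruct (contR_pos_nbhd dR2 cdisc q l 0 Cq Dl) as [r [Hr Fr]].
      { assert (preim w (fun z => snd z = 0) l) by (split; auto).
        unfold q. rewrite EF, EG, U; auto. lra. }
      exists r, 0%nat. split; auto. intros n p _ Dp Hd _. apply Fr; auto. rewrite M2; auto.
    - set (m := Rabs (snd (w l))). assert (Hm : 0 < m) by (apply Rabs_pos_lt; auto).
      destruct (Csw l Dl (m / 2)) as [r [Hr Fr]]; [lra |].
      destruct (inv_INR_lt (m / 4)) as [N HN]; [lra |].
      exists r, N. split; auto. intros n p Hn Dp Hd Hp. exfalso.
      rewrite M2 in Hd. specialize (Fr p Dp Hd). specialize (HN n Hn).
      pose proof (Rabs_triang_inv (snd (w l)) (snd (w p))). fold m in H. lra. }
  assert (Pn : 0 < / INR (S n)) by (apply Rinv_0_lt_compat, lt_0_INR; lia).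
  set (del := Rmin (/ INR (S n)) (1 / 4)).
  assert (Hdel : 0 < del <= 1 / 4).
  { split; [apply Rmin_glb_lt; lra | apply Rmin_r]. }
  assert (Hdel' : del <= / INR (S n)) by apply Rmin_l.
  set (o := orth 1 0 (-1)).
  assert (Eo : forall z, fst (o z) = fst z /\ snd (o z) = - snd z).
  { intros z. unfold o, orth; cbn [fst snd]. split; ring. }
  assert (Ho : disc_map (fun p => o (w p))) by (apply disc_map_orth; auto; ring).
  assert (Eoo : forall z, o (o z) = z).
  { intros [x y]. unfold o, orth; cbn [fst snd]. f_equal; ring. }
  assert (Do : forall z, cdisc z -> cdisc (o z)).
  { intros z Dz. unfold cdisc. destruct (Eo z) as [-> ->]. unfold cdisc in Dz. lra. }
  assert (do : forall z z', dR2 (o z) (o z') = dR2 z z') by (intros; apply dR2_orth; ring).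
  destruct (strip_cut w del W Hdel) as [S1 [T1 [C1 [HT1 [E1 L1]]]]].
  destruct (strip_cut _ del Ho Hdel) as [S2 [T2 [C2 [HT2 [E2 L2]]]]].
  (* The strip is the region above the lower arc intersected with the reflected copy of such a
     region. The two arcs lie on opposite sides of the axis, so their preimages are disjoint and the
     union is log-trivial. *)
  assert (HC : cut w (fun z => S1 z /\ S2 (o z)) (fun z => T1 z \/ T2 (o z))).
  { destruct C1 as [A1 [A2 [A3 [A4 [A5 A6]]]]]. destruct C2 as [B1 [B2 [B3 [B4 [B5 B6]]]]].
    assert (Tr : forall K, closed_in dR2 cdisc K -> closed_in dR2 cdisc (fun z => K (o z))).
    { intros K CK z Dz Hz. apply CK; auto. intros e He. destruct (Hz e He) as [a [Ka Hd]].
      exists (o a). rewrite do. auto. }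
    split; [| split; [| split; [| split; [| split]]]].
    - intros z [H _]; auto.
    - apply closed_in_and; auto.
    - intros z Dz Hz. apply NNPP. intro N.
      destruct (not_closed_in _ _ _ z A3 Dz) as [r [Hr Fr]]; [tauto |].
      destruct (not_closed_in _ _ _ z (Tr T2 B3) Dz) as [s [Hs Fs]]; [tauto |].
      destruct (Hz (Rmin r s)) as [a [[Ta | Ta] Hd]]; [apply Rmin_glb_lt; auto | |].
      + specialize (Fr a Ta). pose proof (Rmin_l r s). lra.
      + specialize (Fs a Ta). pose proof (Rmin_r r s). lra.
    - intros z [Tz | Tz].
      + split; auto. destruct (HT1 z Tz) as [Dz Hz]. apply E2; auto.
        destruct (Eo z) as [_ ->]. lra.
      + split; auto. destruct (HT2 _ Tz) as [Dz Hz]. apply E1.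
        * rewrite <- (Eoo z). auto.
        * destruct (Eo z) as [_ H]. rewrite H in Hz. lra.
    - intros z [H1 H2] NT. destruct (A5 z H1) as [r [Hr Fr]]; [tauto |].
      destruct (B5 (o z) H2) as [s [Hs Fs]]; [tauto |].
      exists (Rmin r s). split; [apply Rmin_glb_lt; auto |]. intros z' Dz' Hd.
      pose proof (Rmin_l r s). pose proof (Rmin_r r s). split.
      + apply Fr; auto. lra.
      + apply Fs; auto. rewrite do. lra.
    - apply log_trivial_ext with (fun p => preim w T1 p \/ preim (fun p => o (w p)) T2 p).
      { unfold preim. intros p. tauto. }
      apply log_trivial_disjoint; auto.
      + apply preim_closed; auto.
      + apply preim_closed; auto.
      + intros p [H _]; auto.
      + intros p [H _]; auto.
      + intros p [_ H1] [_ H2]. destruct (HT1 _ H1) as [_ H3]. destruct (HT2 _ H2) as [_ H4].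
        destruct (Eo (w p)) as [_ E]. rewrite E in H4. lra. }
  set (P := preim w (fun z => S1 z /\ S2 (o z))).
  assert (Pos : forall p, P p -> 0 < q p).
  { intros p [Dp [H1 H2]]. apply Hn; auto. specialize (L1 _ H1). specialize (L2 _ H2).
    destruct (Eo (w p)) as [_ E]. rewrite E in L2. apply Rabs_def1; lra. }
  assert (PD : forall p, P p -> cdisc p) by (intros p [H _]; auto).
  destruct (cut_log_trivial w _ _ W HC (fun p => F p / sqrt (q p)) (fun p => G p / sqrt (q p)))
    as [th [Cth Hth]].
  { fold P.
    assert (Nz : forall p, P p -> sqrt (q p) <> 0).
    { intros p Pp. apply Rgt_not_eq, sqrt_lt_R0; auto. }
    assert (CFP : contR dR2 P F) by (apply contR_sub with cdisc; auto).
    assert (CGP : contR dR2 P G) by (apply contR_sub with cdisc; auto).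
    assert (CqP : contR dR2 P (fun p => sqrt (q p))).
    { apply contR_sqrt. apply contR_sub with cdisc; auto. }
    split; [| split].
    - apply contR_div; auto.
    - apply contR_div; auto.
    - intros p Pp. specialize (Nz p Pp). specialize (Pos p Pp).
      replace ((F p / sqrt (q p)) ^ 2 + (G p / sqrt (q p)) ^ 2)
        with (q p / (sqrt (q p) * sqrt (q p))).
      + rewrite sqrt_sqrt by lra. field. lra.
      + unfold q at 1. field. auto. }
  assert (LP : forall p, preim w (fun z => snd z = 0) p -> P p).
  { intros p [Dp Ep]. split; auto. pose proof (disc_map_in w W p Dp). split.
    - apply E1; auto. lra.
    - apply E2; auto. destruct (Eo (w p)) as [_ ->]. lra. }
  exists th. split; [apply contR_sub with P; auto |]. intros p Lp.
  destruct (Hth p (LP p Lp)) as [A B]. rewrite A, B.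
  unfold q. rewrite EF, EG, U by auto. rewrite sqrt_1. split; field.
Qed.

(** The arc follows a U-shaped set around the ray: two vertical sides at distance [del], and a base
    at height [r - del]. The sides stay off the axis, so the arc can meet it only near the base,
    below [r]. The bound on [8 * del] keeps the corners in the disc and leaves room below the
    base. *)
Lemma ray_cut w r del : disc_map w -> r <= 1 -> 0 < del -> 8 * del <= 1 + r ->
  exists S T, cut w S T /\
    (forall z, T z -> fst z = 0 -> snd z < r) /\
    (forall z, cdisc z -> fst z = 0 -> r <= snd z -> S z) /\
    (forall z, S z -> Rabs (fst z) < 2 * del /\ r - 2 * del < snd z).
Proof.
  intros W Hr Hd Hdr.
  assert (Hk : 0 < 1 - del ^ 2) by nra.
  set (k := sqrt (1 - del ^ 2)).
  assert (Hs : del ^ 2 + k ^ 2 = 1) by (unfold k; rewrite pow2_sqrt; lra).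
  assert (Cor : del ^ 2 + (r - del) ^ 2 <= 1) by nra.
  assert (Hkr : r - del <= k).
  { destruct (Rle_lt_dec (r - del) 0) as [h | h].
    - apply Rle_trans with 0; auto. apply sqrt_pos.
    - unfold k. rewrite <- (sqrt_pow2 (r - del)) by lra. apply sqrt_le_1_alt. lra. }
  assert (Dm : cdisc (- del, r - del)) by (unfold cdisc; cbn [fst snd]; lra).
  assert (Dp : cdisc (del, r - del)) by (unfold cdisc; cbn [fst snd]; lra).
  set (C := fun z => cdisc z /\ ((Rabs (fst z) = del /\ r - del <= snd z) \/
                                 (Rabs (fst z) <= del /\ snd z = r - del))).
  assert (Cfar : forall z c, C c -> dR2 c z < del / 2 ->
     Rabs (fst z) < 2 * del /\ r - 2 * del < snd z).
  { intros z c [_ Hc] Hcz. pose proof (dR2_fst c z). pose proof (dR2_snd c z).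
    assert (A : Rabs (fst c) <= del) by lra. assert (B : r - del <= snd c) by lra.
    assert (H1 : Rabs (fst c - fst z) < del / 2) by lra.
    assert (H2 : Rabs (snd c - snd z) < del / 2) by lra.
    apply Rabs_def2 in H1, H2. apply Rabs_le_between in A. split; [apply Rabs_def1 |]; lra. }
  assert (Cray : forall z c, C c -> fst z = 0 -> r <= snd z -> del / 2 <= dR2 c z).
  { intros z c [_ Hc] Hz1 Hz2. pose proof (dR2_fst c z). pose proof (dR2_snd c z).
    rewrite Hz1, Rminus_0_r in H. destruct Hc as [[A B] | [A B]]; [lra |].
    rewrite B in H0. rewrite Rabs_minus_sym, Rabs_pos_eq in H0; lra. }
  destruct (separating_cut w C (fun z => cdisc z /\ fst z = 0 /\ r <= snd z)
    (fun z => cdisc z /\ (2 * del <= Rabs (fst z) \/ snd z <= r - 2 * del)) (del / 2) del k)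
    as [S [T [HC [HT [HE HQ]]]]]; auto.
  - intros z [H _]; auto.
  - apply connected_star with (del, r - del).
    assert (Seg : forall x z s, cdisc x -> cdisc z -> 0 <= s <= 1 ->
       Rabs (fst x) <= del -> snd x = r - del ->
       (fst x = fst z /\ Rabs (fst z) = del /\ r - del <= snd z) \/
         (Rabs (fst z) <= del /\ snd z = r - del) -> C (seg x z s)).
    { intros x z s Dx Dz Hs' Hx1 Hx2 Hz. split; [apply cdisc_seg; auto |].
      unfold seg; cbn [fst snd]. destruct Hz as [[E [A B]] | [A B]].
      - left. rewrite E. replace ((1 - s) * fst z + s * fst z) with (fst z) by ring.
        split; auto. rewrite Hx2. nra.
      - right. rewrite Hx2, B. split; [| ring].
        apply Rabs_le_between in Hx1, A. apply Rabs_le. split; nra. }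
    assert (Pc : C (del, r - del)).
    { split; auto. right; cbn [fst snd]. rewrite Rabs_pos_eq; lra. }
    intros z [Dz Hz].
    (* Each point of the U is linked to its right corner by two segments meeting at [x]: the foot of
       the side for a point on a side, the corner itself for a point of the base. *)
    assert (Base : exists x, cdisc x /\ Rabs (fst x) <= del /\ snd x = r - del /\
       ((fst x = fst z /\ Rabs (fst z) = del /\ r - del <= snd z) \/
         (Rabs (fst z) <= del /\ snd z = r - del))).
    { destruct Hz as [[A B] | [A B]].
      - exists (fst z, r - del). cbn [fst snd]. split; [| split; [lra | split; auto]].
        unfold cdisc; cbn [fst snd]. rewrite <- (pow2_abs (fst z)), A. auto.
      - exists (del, r - del). cbn [fst snd]. split; auto.
        split; [rewrite Rabs_pos_eq; lra | auto]. }
    destruct Base as [x [Dx [Hx1 [Hx2 Hxz]]]].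
    exists (fun y => trace (seg x (del, r - del)) y \/ trace (seg x z) y).
    assert (T0 : forall y, trace (seg x y) x) by (intros; exists 0; split; [lra | apply seg_0]).
    assert (T1 : forall y, trace (seg x y) y) by (intros; exists 1; split; [lra | apply seg_1]).
    split; [| split; [| split]]; auto.
    + apply connected_star with x. intros y [Hy | Hy].
      * exists (trace (seg x (del, r - del))). split; auto.
        apply trace_connected, seg_path; auto.
      * exists (trace (seg x z)). split; auto. apply trace_connected, seg_path; auto.
    + intros y [[s [Hs' <-]] | [s [Hs' <-]]]; apply Seg; auto.
      right. cbn [fst snd]. rewrite Rabs_pos_eq; lra.
  - lra.
  - split; [unfold cdisc; cbn [fst snd]; lra |]. left; cbn [fst snd].
    rewrite Rabs_Ropp, Rabs_pos_eq; lra.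
  - split; [unfold cdisc; cbn [fst snd]; lra |]. left; cbn [fst snd].
    rewrite Rabs_pos_eq; lra.
  - intros z [Dz [E1 E2]]. split; auto. intros s Hs'. split; [| split].
    + apply cdisc_seg; auto. unfold cdisc; cbn [fst snd]. lra.
    + unfold seg; cbn [fst snd]. rewrite E1. ring.
    + unfold seg; cbn [fst snd]. nra.
  - intros z c [Dz [E1 E2]] Cc. auto.
  - assert (D0 : cdisc (0, -1)) by (unfold cdisc; cbn [fst snd]; lra).
    set (NC := fun z => exists c, C c /\ dR2 c z < del / 2).
    assert (Bot : forall z, cdisc z -> snd z <= r - 2 * del -> joined NC (0, -1) z).
    { intros z Dz Hz. apply joined_seg; auto. intros s Hs' [c [Cc Hc]].
      destruct (Cfar _ c Cc Hc) as [_ H]. unfold seg in H; cbn [fst snd] in H. nra. }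
    intros z [Dz [Hz | Hz]]; [| apply Bot; auto].
    (* A point beside the U is reached from the bottom by way of [(b, -1 + 2 * del)], which lies on
       the same side, outside the U, and below its base. *)
    set (b := if Rle_dec 0 (fst z) then 2 * del else - (2 * del)).
    assert (Db : cdisc (b, -1 + 2 * del)).
    { unfold cdisc; cbn [fst snd]. replace (b ^ 2) with ((2 * del) ^ 2); [nra |].
      unfold b. destruct (Rle_dec 0 (fst z)); ring. }
    apply joined_trans with (b, -1 + 2 * del); [apply Bot; cbn [snd]; auto; lra |].
    apply joined_seg; auto. intros s Hs' [c [Cc Hc]].
    destruct (Cfar _ c Cc Hc) as [H _]. unfold seg, b in H; cbn [fst snd] in H.
    apply Rabs_def2 in H. destruct (Rle_dec 0 (fst z)) as [h | h].
    + rewrite Rabs_pos_eq in Hz by auto. nra.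
    + rewrite Rabs_left in Hz by lra. nra.
  - exists S, T. split; auto. split; [| split].
    + intros z Tz Ez. destruct (HT z Tz) as [Dz [c [Cc Hc]]]. apply Rnot_le_lt. intro h.
      pose proof (Cray z c Cc Ez h). lra.
    + intros z Dz E1 E2. apply HE; auto.
    + intros z Sz. pose proof (HQ z Sz) as N. destruct HC as [SD _]. specialize (SD z Sz).
      split; apply Rnot_le_lt; intro h; apply N; auto.
Qed.

(** In a separation, one part [V] misses the circle. For a cut close to the ray the separation
    persists over the whole region, so [cut_component] sends a point of [V] over the ray into the
    bounding arc, which on the axis lies strictly below [r]. *)
Lemma ray_preim_connected w r : disc_map w -> -1 < r <= 1 ->
  connected_set dR2 (preim w (fun z => fst z = 0 /\ r <= snd z)).
Proof.
  intros W Hr Sep. pose proof dR2_metric as [M0 [M1 [M2 M3]]].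
  set (A := preim w (fun z => fst z = 0 /\ r <= snd z)) in *.
  assert (Main : forall U V : R * R -> Prop, is_open dR2 U -> is_open dR2 V ->
    (forall x, A x -> U x \/ V x) -> (forall x, U x -> V x -> False) ->
    (exists x, A x /\ V x) -> (forall x, circle x -> A x -> U x) -> False).
  { clear Sep. intros U V OU OV Cov Dis [p0 [[D0 [F0 S0]] V0]] Circ.
    assert (Cf : contR dR2 cdisc (fun p => fst (w p))) by (apply cont_fst, disc_map_cont; auto).
    assert (Cs : contR dR2 cdisc (fun p => snd (w p))) by (apply cont_snd, disc_map_cont; auto).
    (* Both the covering by [U] and [V] and the absence of circle points from [V] extend to a
       neighbourhood of the ray, of the shape that [ray_cut] produces with [2 * del]. *)
    destruct (compact_uniform dR2 cdisc (fun n p =>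
       Rabs (fst (w p)) < 2 * / INR (S n) -> r - 2 * / INR (S n) < snd (w p) ->
       (U p \/ V p) /\ (circle p -> ~ V p)) cdisc_compact) as [n Hn].
    { intros l Dl. destruct (classic (A l)) as [Al | NA].
      - destruct (Cov l Al) as [Ul | Vl].
        + destruct (OU l Ul) as [e [He Fe]]. exists e, 0%nat. split; auto.
          intros n p _ Dp Hd _ _. rewrite M2 in Hd. split; auto. intros _ Vp.
          apply (Dis p); auto.
        + destruct (OV l Vl) as [e [He Fe]].
          assert (In : 0 < 1 - (fst l ^ 2 + snd l ^ 2)).
          { destruct Dl as [h | h]; [lra |]. exfalso. apply (Dis l); auto. }
          assert (Cn : contR dR2 cdisc (fun p => 1 - (fst p ^ 2 + snd p ^ 2))).
          { contR_auto; auto using contR_fst, contR_snd. }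
          destruct (contR_pos_nbhd dR2 cdisc _ l 0 Cn Dl In) as [s [Hs Fs]].
          exists (Rmin e s), 0%nat. split; [apply Rmin_glb_lt; auto |].
          intros n p _ Dp Hd _ _. rewrite M2 in Hd.
          pose proof (Rmin_l e s). pose proof (Rmin_r e s). split.
          * right. apply Fe. lra.
          * intros Cp. specialize (Fs p Dp ltac:(lra)). unfold circle in Cp. lra.
      - set (m := Rmax (Rabs (fst (w l))) (r - snd (w l))).
        assert (Hm : 0 < m).
        { apply Rnot_le_lt. intro h. apply NA.
          pose proof (Rmax_l (Rabs (fst (w l))) (r - snd (w l))).
          pose proof (Rmax_r (Rabs (fst (w l))) (r - snd (w l))). fold m in H, H0.
          split; auto. split; [| lra].
          destruct (Req_dec (fst (w l)) 0) as [E | NE]; auto.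
          pose proof (Rabs_pos_lt _ NE). lra. }
        destruct (Cf l Dl (m / 2)) as [e [He Fe]]; [lra |].
        destruct (Cs l Dl (m / 2)) as [s [Hs Fs]]; [lra |].
        destruct (inv_INR_lt (m / 4)) as [N HN]; [lra |].
        exists (Rmin e s), N. split; [apply Rmin_glb_lt; auto |].
        intros n p Hn Dp Hd H1 H2. exfalso. rewrite M2 in Hd.
        pose proof (Rmin_l e s). pose proof (Rmin_r e s).
        specialize (Fe p Dp ltac:(lra)). specialize (Fs p Dp ltac:(lra)). specialize (HN n Hn).
        assert (m < m); [| lra]. unfold m at 1. apply Rmax_lub_lt.
        + pose proof (Rabs_triang_inv (fst (w l)) (fst (w p))). lra.
        + apply Rabs_def2 in Fs. lra. }
    assert (Pn : 0 < / INR (S n)) by (apply Rinv_0_lt_compat, lt_0_INR; lia).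
    set (del := Rmin (/ INR (S n)) ((1 + r) / 8)).
    assert (Hdel : 0 < del) by (apply Rmin_glb_lt; lra).
    assert (Hdel1 : del <= / INR (S n)) by apply Rmin_l.
    assert (Hdel2 : del <= (1 + r) / 8) by apply Rmin_r.
    destruct (ray_cut w r del W) as [S [T [HC [HT [HE HS]]]]]; try lra.
    assert (Q : forall p, cdisc p -> S (w p) -> (U p \/ V p) /\ (circle p -> ~ V p)).
    { intros p Dp Sp. destruct (HS _ Sp). apply Hn; auto; lra. }
    assert (Tp : T (w p0)).
    { apply (cut_component w S T U V W HC OU OV Dis); auto.
      - intros p Dp Sp. apply Q; auto.
      - intros p Cp Sp. apply Q; auto. unfold cdisc. unfold circle in Cp. lra.
      - apply HE; auto. apply disc_map_in; auto. }
    specialize (HT _ Tp F0). lra. }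
  destruct (connected_disjoint _ _ dR2_metric (fun F => F Sep))
    as [U [V [OU [OV [Cov [NU [NV Dis]]]]]]].
  (* As [r] exceeds -1, the ray ends only at the top point, whose fiber on the circle is connected
     and therefore falls into one of the two parts. *)
  assert (Ac : forall p, circle p -> A p -> circle p /\ w p = (0, 1)).
  { intros p Cp [Dp [E1 E2]]. split; auto. pose proof (disc_map_circle w W p Cp) as C.
    destruct (w p) as [x y]. unfold circle in C; cbn [fst snd] in *. subst x.
    assert (H : (y - 1) * (y + 1) = 0) by lra. apply Rmult_integral in H. f_equal. lra. }
  assert (HC : connected_set dR2 (fun p => circle p /\ w p = (0, 1))).
  { apply (disc_map_monotone w W). unfold circle; cbn [fst snd]. ring. }
  assert (CA : forall p, circle p /\ w p = (0, 1) -> A p).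
  { intros p [Cp Ep]. split; [unfold cdisc; unfold circle in Cp; lra |].
    rewrite Ep. cbn [fst snd]. lra. }
  destruct (classic (exists p, (circle p /\ w p = (0, 1)) /\ V p)) as [HV | NV'].
  - apply (Main V U); auto.
    + intros x Ax. destruct (Cov x Ax); auto.
    + intros x ? ?; eauto.
    + intros x Cx Ax. destruct (Cov x Ax) as [Ux | Vx]; auto. exfalso. apply HC.
      exists U, V. split; auto. split; auto. split; [auto |]. split; [exists x; auto |].
      split; auto. intros y _ ? ?; eauto.
  - apply (Main U V); auto. intros x Cx Ax. destruct (Cov x Ax) as [Ux | Vx]; auto.
    exfalso. apply NV'. exists x. auto.
Qed.

(** After a rotation [q] is [(0, rho)] and the chord is the vertical diameter through it; its two
    rays from [q] intersect in [q] only, so [inter_connected] applies to their preimages. *)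
Lemma disc_map_fiber_connected w q : disc_map w -> cdisc q ->
  connected_set dR2 (fun p => cdisc p /\ w p = q).
Proof.
  intros W Dq.
  set (rho := sqrt (fst q ^ 2 + snd q ^ 2)).
  assert (Hq : 0 <= fst q ^ 2 + snd q ^ 2).
  { apply Rplus_le_le_0_compat; apply pow2_ge_0. }
  assert (Hrho2 : rho ^ 2 = fst q ^ 2 + snd q ^ 2) by (apply pow2_sqrt; auto).
  assert (Hrho0 : 0 <= rho) by apply sqrt_pos.
  assert (Hrho1 : rho <= 1).
  { unfold cdisc in Dq. apply Rnot_lt_le. intro. nra. }
  assert (Rot : exists c s, c ^ 2 + s ^ 2 = 1 /\ orth c s 1 q = (0, rho)).
  { destruct q as [x y]. unfold orth; cbn [fst snd] in *.
    destruct (Req_dec rho 0) as [E | NE].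
    - exists 1, 0. split; [ring |]. rewrite E in *.
      assert (x = 0) by nra. assert (y = 0) by nra. subst. f_equal; ring.
    - exists (y / rho), (x / rho). split.
      + transitivity ((x ^ 2 + y ^ 2) / rho ^ 2); [field; auto |]. rewrite <- Hrho2. field. auto.
      + f_equal; [field; auto |].
        transitivity ((x ^ 2 + y ^ 2) / rho); [field; auto |]. rewrite <- Hrho2. field. auto. }
  destruct Rot as [c [s [Hcs Eq]]].
  assert (H1 : (1 : R) ^ 2 = 1) by ring. assert (H2 : (-1) ^ 2 = 1) by ring.
  assert (H3 : 1 ^ 2 + 0 ^ 2 = 1) by ring. assert (H4 : 0 ^ 2 + 1 ^ 2 = 1) by ring.
  set (w1 := fun p => orth c s 1 (w p)).
  assert (W1 : disc_map w1) by (apply disc_map_orth; auto).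
  apply connected_ext with (fun p => cdisc p /\ w1 p = (0, rho)).
  { intros p. split; intros [Dp E]; split; auto.
    - rewrite <- (orth_inv_orth c s 1 (w p)), <- (orth_inv_orth c s 1 q) by auto.
      rewrite Eq. f_equal. exact E.
    - unfold w1. rewrite E. auto. }
  clearbody w1. clear W w Eq Hcs c s.
  assert (CR : connected_set dR2 (preim w1 (fun z => fst z = 0 /\ rho <= snd z))).
  { apply ray_preim_connected; auto. lra. }
  (* For a boundary point the upper ray is the point itself, while the lower one would be the full
     diameter, which [ray_preim_connected] does not admit. *)
  destruct (Req_dec rho 1) as [E | NE].
  - apply connected_ext with (2 := CR). rewrite E. intros p. split.
    + intros [Dp [A B]]. split; auto. pose proof (disc_map_in w1 W1 p Dp) as D.
      destruct (w1 p) as [x y]. unfold cdisc in D; cbn [fst snd] in *. subst. f_equal. nra.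
    + intros [Dp Ep]. split; auto. rewrite Ep; cbn [fst snd]. lra.
  (* The reflection [w2] turns the lower ray into an upper one, and the quarter turn [w3] turns the
     vertical diameter into the horizontal one. *)
  - set (w2 := fun p => orth 1 0 (-1) (w1 p)).
    assert (W2 : disc_map w2) by (apply disc_map_orth; auto).
    set (w3 := fun p => orth 0 1 1 (w1 p)).
    assert (W3 : disc_map w3) by (apply disc_map_orth; auto).
    assert (E2 : forall p, fst (w2 p) = fst (w1 p) /\ snd (w2 p) = - snd (w1 p)).
    { intros p. unfold w2, orth; cbn [fst snd]. split; ring. }
    assert (E3 : forall p, snd (w3 p) = fst (w1 p)).
    { intros p. unfold w3, orth; cbn [fst snd]. ring. }
    assert (CR2 : connected_set dR2 (preim w2 (fun z => fst z = 0 /\ - rho <= snd z))).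
    { apply ray_preim_connected; auto. lra. }
    pose proof (chord_preim_log_trivial w3 W3) as L.
    assert (Cl : forall a, closed_in dR2 cdisc (fun z => fst z = 0 /\ a <= snd z)).
    { intros a z Dz Hz. split.
      - apply cond_eq. intros e He. destruct (Hz e He) as [b [[Hb _] Hd]].
        pose proof (dR2_fst z b). rewrite Hb in H. lra.
      - apply Rnot_lt_le. intro h. destruct (Hz (a - snd z)) as [b [[_ Hb] Hd]]; [lra |].
        pose proof (dR2_snd z b). assert (H0 : Rabs (snd z - snd b) < a - snd z) by lra.
        apply Rabs_def2 in H0. lra. }
    apply connected_ext with (fun p => preim w1 (fun z => fst z = 0 /\ rho <= snd z) p /\
                                       preim w2 (fun z => fst z = 0 /\ - rho <= snd z) p).
    + intros p. unfold preim. destruct (E2 p) as [A B]. rewrite A, B.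
      destruct (w1 p) as [x y]; cbn [fst snd]. split.
      * intros [[Dp [X Y]] [_ [_ Y']]]. split; auto. f_equal; lra.
      * intros [Dp E]. injection E. intros. subst. repeat split; auto; lra.
    + apply inter_connected; auto.
      * apply preim_closed; auto.
      * apply preim_closed; auto.
      * intros p [H _]; auto.
      * intros p [H _]; auto.
      * apply log_trivial_ext with (2 := L). intros p. unfold preim.
        destruct (E2 p) as [A B]. rewrite A, B, E3. split.
        -- intros [Dp E]. destruct (Rle_lt_dec rho (snd (w1 p))); [left | right];
             repeat split; auto; lra.
        -- intros [[Dp [E _]] | [Dp [E _]]]; auto.
Qed.

(** * Passing to the disc chart of [X] *)

Lemma uniformly_continuous {T1 T2 : Type} (d1 : T1 -> T1 -> R) (d2 : T2 -> T2 -> R)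
    (K : T1 -> Prop) (f : T1 -> T2) eps :
  is_metric d1 -> is_metric d2 -> cluster_compact d1 K -> cont_on d1 d2 K f -> 0 < eps ->
  exists del, 0 < del /\ forall x y, K x -> K y -> d1 x y < del -> d2 (f x) (f y) < eps.
Proof.
  intros [M0 [M1 [M2 M3]]] [N0 [N1 [N2 N3]]] HK Cf He.
  destruct (compact_uniform d1 K
    (fun n x => forall y, K y -> d1 x y < / INR (S n) -> d2 (f x) (f y) < eps) HK) as [n Hn].
  - intros l Kl. destruct (Cf l Kl (eps / 2)) as [r [Hr Fr]]; [lra |].
    destruct (inv_INR_lt (r / 2)) as [N HN]; [lra |].
    exists (r / 2), N. split; [lra |]. intros n x Hn Kx Hd y Ky Hxy. specialize (HN n Hn).
    rewrite M2 in Hd. pose proof (M3 l x y).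
    pose proof (Fr x Kx ltac:(lra)) as F1. pose proof (Fr y Ky ltac:(lra)) as F2.
    pose proof (N3 (f x) (f l) (f y)). rewrite (N2 (f x) (f l)) in H0. lra.
  - exists (/ INR (S n)). split; [apply Rinv_0_lt_compat, lt_0_INR; lia |].
    intros x y Kx Ky. apply Hn; auto.
Qed.

(** [X] is compact, so the inverse chart is uniformly continuous: it carries uniform limits of
    boundary homeomorphisms to such limits, and biLipschitz arcs close to a set in [X] to arcs close
    to its copy in the disc. *)
Lemma chart_disc_map (X : Type) (d : X -> X -> R) (h g : R * R -> X) (hi : X -> R * R)
    (v : R * R -> X) :
  is_metric d -> geodesic d -> homeo_onto dR2 d cdisc (fun _ => True) h ->
  (forall y, True -> cdisc (hi y) /\ h (hi y) = y) -> (forall x, cdisc x -> hi (h x) = x) ->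
  cont_on d dR2 (fun _ => True) hi ->
  cont_on dR2 d cdisc v ->
  weakly_monotone_param d (fun y => exists p, circle p /\ h p = y) v ->
  (forall T, bilip_arc d T -> forall C, component_of dR2 (fun p => cdisc p /\ T (v p)) C ->
     cell_like dR2 C) ->
  disc_map (fun p => hi (v p)).
Proof.
  intros Md Hgeo [_ [_ [_ [Ch _]]]] Hhi Hhi' Chi Cv [WM1 [WM2 [WM3 [cn [WM4 WM5]]]]] Hcl.
  assert (HX : cluster_compact d (fun _ => True)).
  { intros u _.
    destruct (cluster_compact_image dR2 d (fun _ => True) cdisc h dR2_metric
      (is_metric_on _ _ Md) (fun _ _ => I) cdisc_compact Ch u) as [l [_ Hl]].
    - intros n. exists (hi (u n)). apply Hhi; auto.
    - exists l. auto. }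
  assert (SC : forall p, circle p -> cdisc p) by (intros p; unfold circle, cdisc; lra).
  assert (Gam : forall y, (exists p, circle p /\ h p = y) -> circle (hi y)).
  { intros y [p [Cp <-]]. rewrite Hhi'; auto. }
  assert (Din : forall p, cdisc p -> cdisc (hi (v p))) by (intros; apply Hhi; auto).
  assert (Cw : cont_on dR2 dR2 cdisc (fun p => hi (v p))).
  { apply (cont_on_comp dR2 d dR2 cdisc (fun _ => True)); auto. }
  constructor; auto.
  - intros e Ce. apply (circle_limit_fiber (fun p => hi (v p)) (fun n p => hi (cn n p))); auto.
    + apply cont_on_sub with cdisc; auto.
    + intros n. destruct (WM4 n) as [A1 [A2 [A3 [A4 A5]]]]. split; [| split; [| split; [| split]]].
      * intros; apply Gam; auto.
      * intros y Cy. destruct (A2 (h y)) as [p [Cp Ep]]; [exists y; auto |].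
        exists p. split; auto. rewrite Ep. auto.
      * intros x x' Cx Cx' E. apply A3; auto.
        rewrite <- (proj2 (Hhi (cn n x) I)), E. apply Hhi; auto.
      * apply (cont_on_comp dR2 d dR2 circle (fun _ => True)); auto.
      * intros x Cx eps He. destruct (A5 x Cx eps He) as [r [Hr Fr]].
        destruct (Ch (hi (cn n x)) (proj1 (Hhi _ I)) r Hr) as [s [Hs Fs]].
        exists s. split; auto. intros x' Cx' Hd. apply Fr; auto.
        specialize (Fs (hi (cn n x')) (proj1 (Hhi _ I)) Hd).
        rewrite !(proj2 (Hhi _ I)) in Fs. auto.
    + intros eps He.
      destruct (uniformly_continuous d dR2 _ hi eps Md dR2_metric HX Chi He) as [r [Hr Fr]].
      destruct (WM5 r Hr) as [N HN]. exists N. intros n Hn p Cp. apply Fr; auto.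
  - intros C eta x y CD CC Heta Cx Cy Hxy.
    destruct (uniformly_continuous d dR2 _ hi eta Md dR2_metric HX Chi Heta) as [r [Hr Fr]].
    destruct (bilip_arc_near d (fun z => exists p, C p /\ h p = z) r (h x) (h y))
      as [b [L [ga [Hb [HL [G0 [G1 [Gn Gl]]]]]]]]; eauto.
    + apply (connected_image dR2 d C h dR2_metric Md CC). apply cont_on_sub with cdisc; auto.
    + intros E. apply Hxy. rewrite <- (Hhi' x), <- (Hhi' y), E; auto.
    + assert (Hbt : forall t, 0 <= t <= 1 -> 0 <= b * t <= b) by (intros; nra).
      assert (P : is_path (fun t => hi (ga (b * t)))).
      { split; [| intros; apply Hhi; auto].
        apply (cont_on_comp _ d dR2 _ (fun _ => True) (fun t => ga (b * t)) hi); auto.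
        intros t Ht e He. exists (e / (L * b)).
        assert (0 < L * b) by (apply Rmult_lt_0_compat; auto).
        split; [apply Rdiv_lt_0_compat; auto |]. intros u Hu Hd.
        destruct (Gl (b * t) (b * u)) as [_ U]; auto. eapply Rle_lt_trans; [apply U |].
        rewrite <- Rmult_minus_distr_l, Rabs_mult, (Rabs_pos_eq b) by lra.
        apply Rlt_div_r in Hd; auto. lra. }
      exists (fun t => hi (ga (b * t))). split; auto.
      rewrite Rmult_0_r, Rmult_1_r, G0, G1, !Hhi' by auto. split; auto. split; auto. split.
      * intros t Ht. destruct (Gn (b * t) (Hbt t Ht)) as [z [[p [Cp <-]] Hz]].
        exists p. split; auto. rewrite <- (Hhi' p) by auto. apply Fr; auto.
      (* The trace in the disc and the arc [T] in [X] have the same preimage, so the components of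
         the former are cell-like by hypothesis, and log-triviality passes from the components to
         the whole. *)
      * set (T := fun y => exists s, 0 <= s <= b /\ ga s = y).
        assert (E : forall p, preim (fun p => hi (v p)) (trace (fun t => hi (ga (b * t)))) p <->
                              cdisc p /\ T (v p)).
        { intros p. split; intros [Dp [t [Ht Et]]]; split; auto.
          - exists (b * t). split; auto.
            rewrite <- (proj2 (Hhi (ga (b * t)) I)), Et. apply Hhi; auto.
          - exists (t / b). split.
            + split; [apply Rdiv_le_0_compat; lra | apply Rle_div_l; lra].
            + replace (b * (t / b)) with t by (field; lra). rewrite Et. auto. }
        apply log_trivial_components; [apply dR2_metric | |].
        -- apply preim_compact, cont_preim_closed; auto. apply trace_closed; auto.
        -- intros K [K1 [K2 [K3 K4]]].
           apply cell_like_log_trivial; [apply dR2_metric |]. apply (Hcl T).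
           ++ exists 0, b, L, ga. split; auto. split; auto. split; auto. intros; tauto.
           ++ split; auto. split; [intros; apply E; auto |]. split; auto.
              intros K' A1 A2 A3. apply K4; auto. intros; apply E; auto.
Qed.

Theorem theorem4p1 (X : Type) (d : X -> X -> R) (h : R * R -> X)
  (v : R * R -> X) :
  is_metric d ->
  geodesic d ->
  (* h : D -> X is a homeomorphism; the boundary circle of X is h(S^1) *)
  homeo_onto dR2 d cdisc (fun _ => True) h ->
  cont_on dR2 d cdisc v ->
  (forall q : X, exists p, cdisc p /\ v p = q) ->
  weakly_monotone_param d (fun y => exists p, circle p /\ h p = y) v ->
  (forall T : X -> Prop,
     ((exists q, forall y, T y <-> y = q) \/ bilip_arc d T) ->
     forall C, component_of dR2 (fun p => cdisc p /\ T (v p)) C ->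
       cell_like dR2 C) ->
  cell_like_map v.
Proof.
  intros Md Hgeo Hh Cv Surj WM Hcl q.
  destruct (homeo_inverse _ _ _ _ _ Hh) as [hi [Hhi [Hhi' Chi]]].
  { exists (0, 0). unfold cdisc; cbn [fst snd]. lra. }
  assert (W : disc_map (fun p => hi (v p))) by (eapply chart_disc_map; eauto).
  (* A connected fiber is its own unique component, so the single-point case of hypothesis (ii)
     makes it cell-like. *)
  apply (Hcl (fun y => y = q)); [left; exists q; tauto |].
  split; [destruct (Surj q) as [p Hp]; exists p; auto |]. split; auto. split.
  - apply connected_ext with (fun p => cdisc p /\ hi (v p) = hi q).
    + intros p. split; intros [Dp E]; split; auto.
      * rewrite <- (proj2 (Hhi (v p) I)), E. apply Hhi; auto.
      * rewrite E. auto.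
    + apply (disc_map_fiber_connected _ (hi q) W). apply Hhi; auto.
  - intros K _ _ HK x Kx. apply HK; auto.
Qed.
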